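(* Let $D$ be good, with $r$ distinct prime factors, and assume $\operatorname{sign}(D) = \epsilon_D$. Let $I_D(X)$ be the number of integers $q$ with $|q|\le X$, $Dq$ square-free, such that $\mathbb{Q}(\sqrt{Dq})$ is an imaginary quadratic field over which there exists an elliptic curve with everywhere good reduction and rational $j$-invariant. Then $$I_D(X) \gg \frac{X}{(\log X)^{1-1/2^r}}.$$
   Context: Let $\mathcal{R}=\{A\in\mathbb{Z} : \text{if } 2\mid A \text{ then } 16\mid A \text{ or } 16\mid A-4;\ \text{if } 3\mid A \text{ then } 27\mid A-12\}$. A square-free integer $D$ is called good if there exist $A\in\mathcal{R}$ and $t\in\mathbb{Z}$ with $Dt^2 = A^3-1728$. For good $D$, set $\epsilon_D = 1$ if $D\equiv 1 \pmod 4$ and $\epsilon_D=-1$ otherwise. An elliptic curve $E/K$ has everywhere good reduction if it has good reduction at every prime of $\mathcal{O}_K$. *)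

(* Defs.v *)
From Stdlib Require Import Reals.
From HB Require Import structures.
From mathcomp Require Import all_boot all_order all_algebra all_field.
Set Implicit Arguments. Unset Strict Implicit. Unset Printing Implicit Defensive.
Import Order.TTheory GRing.Theory Num.Theory.

Local Open Scope ring_scope.

Definition in_Rset (A : int) : Prop :=
  ((2 %| A)%Z -> (16 %| A)%Z \/ (16 %| A - 4)%Z) /\
  ((3 %| A)%Z -> (27 %| A - 12)%Z).

Definition squarefree (D : int) : Prop :=
  D != 0 /\ forall n : nat, (n ^ 2 %| `|D|)%N -> n = 1%N.

Definition good (D : int) : Prop :=
  squarefree D /\ exists (A : int) (t : int), in_Rset A /\ D * t ^+ 2 = A ^+ 3 - 1728.

Definition eps (D : int) : int := if (D %% 4)%Z == 1 then 1 else -1.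

Definition nprimes (D : int) : nat := size (primes `|D|%N).

Definition inK (d : int) (x : algC) : Prop :=
  exists a b : rat, x = ratr a + ratr b * sqrtC (d%:~R).

Definition inOK (d : int) (x : algC) : Prop := inK d x /\ x \in Aint.

Definition prime_ideal (d : int) (P : algC -> Prop) : Prop :=
  (forall x, P x -> inOK d x) /\
  P 0 /\
  (forall x y, P x -> P y -> P (x + y)) /\
  (forall x y, inOK d x -> P y -> P (x * y)) /\
  ~ P 1 /\
  (forall x y, inOK d x -> inOK d y -> P (x * y) -> P x \/ P y) /\
  (exists x, P x /\ x != 0).

Definition inOP (d : int) (P : algC -> Prop) (x : algC) : Prop :=
  exists a b : algC, [/\ inOK d a, inOK d b, ~ P b & x * b = a].

Definition unitOP (d : int) (P : algC -> Prop) (x : algC) : Prop :=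
  exists a b : algC, [/\ inOK d a, inOK d b, ~ P a, ~ P b & x * b = a].

Record weier := Weier { a1 : algC; a2 : algC; a3 : algC; a4 : algC; a6 : algC }.

Definition wb2 (E : weier) := a1 E ^+ 2 + 4 * a2 E.
Definition wb4 (E : weier) := 2 * a4 E + a1 E * a3 E.
Definition wb6 (E : weier) := a3 E ^+ 2 + 4 * a6 E.
Definition wb8 (E : weier) :=
  a1 E ^+ 2 * a6 E + 4 * a2 E * a6 E - a1 E * a3 E * a4 E
  + a2 E * a3 E ^+ 2 - a4 E ^+ 2.
Definition wdisc (E : weier) :=
  - wb2 E ^+ 2 * wb8 E - 8 * wb4 E ^+ 3 - 27 * wb6 E ^+ 2
  + 9 * wb2 E * wb4 E * wb6 E.
Definition wc4 (E : weier) := wb2 E ^+ 2 - 24 * wb4 E.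
Definition jinv (E : weier) := wc4 E ^+ 3 / wdisc E.

Definition weier_over (d : int) (E : weier) : Prop :=
  [/\ inK d (a1 E), inK d (a2 E), inK d (a3 E), inK d (a4 E) & inK d (a6 E)].

Definition ell_curve (d : int) (E : weier) : Prop :=
  weier_over d E /\ wdisc E != 0.

(* E' is obtained from E by the standard change of variables
   x = u^2 x' + r, y = u^3 y' + s u^2 x' + t  (Silverman III.1) *)
Definition wchange (E E' : weier) (u r s t : algC) : Prop :=
  u != 0 /\ [/\
      u * a1 E' = a1 E + 2 * s,
      u ^+ 2 * a2 E' = a2 E - s * a1 E + 3 * r - s ^+ 2,
      u ^+ 3 * a3 E' = a3 E + r * a1 E + 2 * t,
      u ^+ 4 * a4 E' = a4 E - s * a3 E + 2 * r * a2 E - (t + r * s) * a1 E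
                       + 3 * r ^+ 2 - 2 * s * t &
      u ^+ 6 * a6 E' = a6 E + r * a4 E + r ^+ 2 * a2 E + r ^+ 3 - t * a3 E
                       - t ^+ 2 - r * t * a1 E].

Definition good_red_at (d : int) (E : weier) (P : algC -> Prop) : Prop :=
  exists (E' : weier) (u r s t : algC),
    [/\ inK d u, inK d r, inK d s & inK d t] /\ wchange E E' u r s t /\
        [/\ inOP d P (a1 E'), inOP d P (a2 E'), inOP d P (a3 E'),
            inOP d P (a4 E') & inOP d P (a6 E')] /\
        unitOP d P (wdisc E').

Definition everywhere_good (d : int) (E : weier) : Prop :=
  forall P, prime_ideal d P -> good_red_at d E P.

Definition counted (D q : int) : Prop :=
  squarefree (D * q) /\ D * q < 0 /\
  exists E : weier, [/\ ell_curve (D * q) E, everywhere_good (D * q) E &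
                       jinv E \in Crat].

Definition I_at_least (D : int) (X : R) (n : nat) : Prop :=
  exists s : seq int, [/\ uniq s, size s = n &
    forall q, q \in s -> Rle (INR `|q|%N) X /\ counted D q].

Definition Rbound (X : R) (r : nat) : R :=
  Rdiv X (Rpower (ln X) (Rminus (INR 1) (Rinv (pow (INR 2) r)))).

(* Main.v *)
Require Import Defs.
From Stdlib Require Import Reals.
From HB Require Import structures.
From mathcomp Require Import all_boot all_order all_algebra all_field.
From mathcomp Require Import Rstruct Rstruct_topology.
From mathcomp Require Import boolp reals sequences exp.
From mathcomp Require Import ring lra zify.
Set Implicit Arguments. Unset Strict Implicit. Unset Printing Implicit Defensive.
Import Order.TTheory GRing.Theory Num.Theory.

(** Put E = |D| and q = - sgn(D) Q.  If E X^2 + Q Y^2 = 4 Z^2 has a primitive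
    solution, then mu = (D X + Y sqrt(D q)) / 2 has norm +-D Z^2, so that up to
    squares it is a unit at every prime not dividing D.  The curve with
    c4 = A D mu^2 and c6 = D^2 t mu^3 has discriminant D^3 mu^6 and j = A^3, and
    it has good reduction everywhere as soon as Q lies in a suitable class
    modulo 8 and the sign of t is chosen accordingly.

    Hence it is enough to produce many square-free Q in this class which are
    norms from Q(sqrt E).  By Thue's lemma a product of primes splitting in
    Q(sqrt E) is a norm times one of finitely many integers, so after
    multiplication by one of finitely many factors every such product yields a
    Q.  There are >> Y / sqrt(log Y) square-free products of split primes up to
    Y, because the sum of log p / p over the split primes p <= n is
    (1/2) log n + O(1); this follows by evaluating the sum of log(z^2 - E y^2)
    over a box in two ways, the number of points of the box with
    p | z^2 - E y^2 being controlled by a short basis of the lattice z = w y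
    modulo p, where w^2 = E.

    Finally |D| <> 1, so r >= 1 and X / (log X)^(1 - 1/2^r) <= X / sqrt(log X). *)


(** * Chebyshev and Mertens bounds *)

(** The norm of mu is D (D X^2 - q Y^2) / 4. In an imaginary field it is positive, hence it has to
    be |D| Z^2. The sign hypothesis says that |D| = 1 modulo 4 for odd D, which is what reduction at
    2 requires, and that an even D is negative. With q = - sgn(D) Q the norm equation becomes a
    conic whose solvability means that Q is a norm from Q(sqrt E): a condition multiplicative in Q,
    so it can be met by multiplying primes. The obstacle is that a product of split primes need not
    be a norm. Finitely many obstructions occur, and two products with the same obstruction multiply
    to a norm, so one fixed representative for each obstruction repairs all products. If
    representative and product also agree modulo 8, they multiply to 1 modulo 8, and one integer Q0
    in the right class modulo 8 serves for the whole family. Replacing t by -t twists the curve by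
    -1 and preserves D t^2; this is the freedom spent at the prime 2. *)

Section Chebyshev.

Lemma prod_primes_dvd (s : seq nat) (N : nat) :
  uniq s -> all prime s -> all (dvdn^~ N) s -> \prod_(p <- s) p %| N.
Proof.
elim: s => [|p s IH] /=; first by rewrite big_nil dvd1n.
move=> /andP[ps us] /andP[pp sp] /andP[pN sN]; rewrite big_cons.
rewrite Gauss_dvd; first by rewrite pN IH.
rewrite big_seq; elim/big_ind: _ => [|x y hx hy|q qs]; first exact: coprimen1.
  by rewrite coprimeMr hx.
rewrite prime_coprime // dvdn_prime2 //; last exact: (allP sp).
by apply: contraNneq ps => ->.
Qed.

(** The two equal middle coefficients of row 2m+1 add up to at most the row sum 2^(2m+1). *)
Lemma bin_odd_le m : 'C(m.*2.+1, m) <= 4 ^ m.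
Proof.
have : 2 * 'C(m.*2.+1, m) <= 2 ^ m.*2.+1.
  have -> : 2 ^ m.*2.+1 = \sum_(i < m.*2.+2) 'C(m.*2.+1, i).
    by rewrite (expnDn 1 1); apply: eq_bigr => i _; rewrite !exp1n !muln1.
  have hm : m < m.*2.+2 by lia.
  have hm1 : m.+1 < m.*2.+2 by lia.
  rewrite (bigD1 (Ordinal hm)) //= (bigD1 (Ordinal hm1)) /=; last by apply/eqP => -[]; lia.
  have -> : 'C(m.*2.+1, m.+1) = 'C(m.*2.+1, m).
    by rewrite -bin_sub; [congr 'C(_, _); lia | lia].
  by rewrite addnA mul2n -addnn leq_addr.
by rewrite expnS leq_pmul2l // -mul2n expnM.
Qed.

(** Erdos's induction: an even n > 2 adds no prime, and for n = 2m+1 the primes in (m+1, 2m+1] all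
    divide C(2m+1, m) <= 4^m. *)
Lemma primorial_le n : \prod_(0 <= p < n.+1 | prime p) p <= 4 ^ n.
Proof.
elim/ltn_ind: n => n IH.
case: (ltnP n 3) => [|n3].
  by case: n {IH} => [|[|[|]]] // _; rewrite unlock.
case: (boolP (odd n)) => on; last first.
  have np : prime n = false by apply/negbTE; apply: contra on => /even_prime; lia.
  rewrite big_mkcond big_nat_recr //= np muln1 -big_mkcond.
  case: n IH n3 on {np} => // n IH n3 on.
  by apply: leq_trans (IH n _) _ => //; rewrite leq_exp2l.
pose m := n./2; have En : n = m.*2.+1 by rewrite -[n]odd_double_half on.
rewrite (big_cat_nat _ (n := m.+2)) //=; last by lia.
have -> : 4 ^ n = 4 ^ m.+1 * 4 ^ m by rewrite -expnD; congr expn; lia.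
apply: leq_mul; first by apply: IH; lia.
apply: leq_trans (bin_odd_le m); apply: dvdn_leq; first by rewrite bin_gt0; lia.
rewrite -big_filter; apply: prod_primes_dvd.
- exact/filter_uniq/iota_uniq.
- exact: filter_all.
apply/allP => p; rewrite mem_filter mem_index_iota => /and3P[pp h1 h2].
have := bin_fact (n := m.*2.+1) (m := m); move=> /(_ ltac:(lia)) hf.
have : p %| (m.*2.+1)`! by rewrite dvdn_fact // prime_gt0 //= -En.
rewrite -hf !Euclid_dvdM //.
have nd k : k < p -> p %| k`! = false.
  move=> kp; apply/negbTE; elim: k kp => [|k IHk] kp; first by rewrite Euclid_dvd1.
  by rewrite factS Euclid_dvdM // negb_or IHk ?gtnNdvd //; lia.
by rewrite !nd ?orbF //; lia.
Qed.

Lemma exists_isqrt n : exists2 s, (s ^ 2 <= n) & (n < s.+1 ^ 2).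
Proof.
have ex : exists s, (s ^ 2 <= n) by exists 0.
have bd s : (s ^ 2 <= n) -> (s <= n) by case: s => // s h; rewrite (leq_trans _ h) // leq_pmulr.
case: (ex_maxnP ex bd) => s h1 h2; exists s => //.
by rewrite ltnNge; apply/negP => /h2; rewrite ltnn.
Qed.

End Chebyshev.

(** * Logarithmic sums over primes *)

Section Mertens.
Variable R : realType.
Local Open Scope ring_scope.
Implicit Types (a b f : nat -> R) (S : pred nat).

Notation lnn n := (ln (n%:R : R)).

(** It includes n = 0, where [ln] takes the value 0; sums can therefore start at 0. *)
Lemma lnn_ge0 n : 0 <= lnn n.
Proof.
case: n => [|n]; first by rewrite ln0.
by apply: ln_ge0; rewrite ler1n.
Qed.

Lemma lnn_gt0 n : (1 < n)%N -> 0 < lnn n.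
Proof. by move=> h; apply: ln_gt0; rewrite ltr1n. Qed.

Lemma lnnM m n : (0 < m)%N -> (0 < n)%N -> lnn (m * n) = lnn m + lnn n.
Proof. by move=> m0 n0; rewrite natrM lnM // posrE ltr0n. Qed.

Lemma lnnX m k : (0 < m)%N -> lnn (m ^ k) = k%:R * lnn m.
Proof. by move=> m0; rewrite natrX lnXn ?ltr0n // mulr_natl. Qed.

Lemma ler_lnn m n : (m <= n)%N -> lnn m <= lnn n.
Proof.
case: m => [|m] h; first by rewrite ln0 ?lnn_ge0.
by rewrite ler_ln ?posrE ?ltr0n ?ler_nat //; lia.
Qed.

Lemma lnn_prod (I : eqType) (s : seq I) (P : pred I) (F : I -> nat) :
  (forall i, i \in s -> P i -> (0 < F i)%N) ->
  lnn (\prod_(i <- s | P i) F i) = \sum_(i <- s | P i) lnn (F i).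
Proof.
elim: s => [|i s IH] h; first by rewrite !big_nil ln1.
rewrite !big_cons; case: ifP => Pi; last by apply: IH => j js; apply: h; rewrite inE js orbT.
have h' j : j \in s -> P j -> (0 < F j)%N by move=> js; apply: h; rewrite inE js orbT.
rewrite lnnM ?IH //; first by apply: h; rewrite ?inE ?eqxx.
by rewrite big_seq_cond prodn_cond_gt0 // => j /andP[]; apply: h'.
Qed.

Definition theta S n : R := \sum_(0 <= p < n.+1 | S p) lnn p.

Lemma theta_prime_le n : theta prime n <= n%:R * lnn 4.
Proof.
rewrite -lnnX // /theta -lnn_prod; last by move=> p _; exact: prime_gt0.
exact/ler_lnn/primorial_le.
Qed.

Lemma theta_le S n : {subset S <= prime} -> theta S n <= theta prime n.
Proof.
move=> sS; rewrite /theta big_mkcond [leRHS]big_mkcond; apply: ler_sum => p _.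
case: ifP => [/sS|_]; first by move=> pp; rewrite ifT.
by case: ifP => // _; apply: lnn_ge0.
Qed.

(** Summation by parts. It turns a Chebyshev or Mertens bound on partial sums into a bound on a
    weighted sum over primes. *)
Lemma abel_majorization a b f n :
  (forall k, \sum_(0 <= i < k) a i <= \sum_(0 <= i < k) b i) ->
  (forall k, f k.+1 <= f k) -> (forall k, 0 <= f k) ->
  \sum_(0 <= i < n) a i * f i <= \sum_(0 <= i < n) b i * f i.
Proof.
move=> ab fd f0; rewrite -subr_ge0 -sumrB.
have ab' k : 0 <= \sum_(0 <= i < k) (b i - a i) by rewrite sumrB subr_ge0.
(* Nonnegativity alone is not inductive; the stronger lower bound by the last partial sum times
   [f n] is. *)
apply: (@le_trans _ _ ((\sum_(0 <= i < n) (b i - a i)) * f n)).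
  exact: mulr_ge0.
elim: n => [|n IH]; first by rewrite !big_geq // mul0r.
apply: (@le_trans _ _ ((\sum_(0 <= i < n.+1) (b i - a i)) * f n)).
  exact: ler_wpM2l.
rewrite !big_nat_recr //= mulrDl; apply: lerD; first exact: IH.
by rewrite mulrBl.
Qed.

(** The range [B] is left free so that different k can share one sum over primes. *)
Lemma lnn_logn k B : (0 < k)%N -> (k <= B)%N ->
  lnn k = \sum_(0 <= p < B.+1 | prime p) (logn p k)%:R * lnn p.
Proof.
move=> k0 kB.
have {1}-> : k = (\prod_(0 <= p < B.+1 | prime p) p ^ logn p k)%N.
  rewrite -{1}(partnT k0) (widen_partn _ kB) big_mkcond [RHS]big_mkcond.
  apply: eq_bigr => p _ /=; case: ifP => // /negbT np.
  by rewrite (_ : logn p k = 0%N) //; apply/eqP; rewrite -leqn0 leqNgt logn_gt0 mem_primes (negbTE np).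
rewrite lnn_prod; last by move=> p _ pp; rewrite expn_gt0 prime_gt0.
by apply: eq_bigr => p pp; rewrite lnnX ?prime_gt0.
Qed.

Lemma lnn_fact n : n%:R * lnn n - n%:R <= lnn (n`!).
Proof.
elim: n => [|n IH]; first by rewrite mul0r subr0 lnn_ge0.
rewrite factS lnnM ?fact_gt0 //.
case: n IH => [|n] IH; first by rewrite ln1 mulr0 sub0r add0r; have := lnn_ge0 (0`!); lra.
set m := n.+1 in IH *.
have m0 : 0 < m%:R :> R by rewrite ltr0n.
have h : m%:R * (lnn m.+1 - lnn m) <= 1.
  rewrite -ler_pdivlMl // mulr1 -ln_div ?posrE ?ltr0n //.
  have -> : m.+1%:R / m%:R = 1 + m%:R^-1 :> R by rewrite -natr1 mulrDl divff ?gt_eqF // mul1r.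
  by apply: le_ln1Dx; apply: lt_le_trans (_ : 0 <= _); rewrite ?ltrN10 // invr_ge0 ltW.
rewrite -[in X in X%:R * _]addn1 natrD -[in X in _ - X]addn1 natrD.
nra.
Qed.

(** Legendre's formula gives floor(n/p) <= v_p(n!), and ln n! <= n ln n. Replacing floor(n/p) by n/p
    costs theta(n) <= n ln 4. *)
Lemma mertens_upper n : (0 < n)%N ->
  \sum_(0 <= p < n.+1 | prime p) lnn p / p%:R <= lnn n + lnn 4.
Proof.
move=> n0; have n0' : 0 < n%:R :> R by rewrite ltr0n.
rewrite -(ler_pM2l n0') mulr_sumr.
apply: (@le_trans _ _ (\sum_(0 <= p < n.+1 | prime p) (n %/ p)%:R * lnn p + theta prime n)).
  rewrite /theta -big_split /=; apply: ler_sum => p pp.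
  have p0 : 0 < p%:R :> R by rewrite ltr0n prime_gt0.
  have := ltn_ceil n (prime_gt0 pp); rewrite -(ltr_nat R) natrM -natr1 => h.
  have h2 : n%:R / p%:R <= (n %/ p)%:R + 1 :> R by rewrite ler_pdivrMr // ltW.
  have := lnn_ge0 p; nra.
have h1 : \sum_(0 <= p < n.+1 | prime p) (n %/ p)%:R * lnn p <= n%:R * lnn n.
  have -> : n%:R * lnn n = lnn (n ^ n) by rewrite lnnX.
  apply: (@le_trans _ _ (lnn (n`!))); last first.
    apply: ler_lnn; rewrite -ffactnn.
    have ff k : (n ^_ k <= n ^ k)%N.
      by elim: k => // k IH; rewrite ffactnSr expnSr leq_mul // leq_subr.
    exact: ff.
  rewrite (@lnn_logn _ (n`!)) ?fact_gt0 //.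
  have nf : (n <= n`!)%N by rewrite dvdn_leq ?fact_gt0 // dvdn_fact // n0 /=.
  rewrite [leRHS](@big_cat_nat _ _ _ n.+1) //=.
  rewrite -[leLHS]addr0; apply: lerD; last first.
    by apply: sumr_ge0 => p _; rewrite mulr_ge0 ?lnn_ge0.
  apply: ler_sum => p pp; apply: ler_wpM2r; first exact: lnn_ge0.
  rewrite ler_nat logn_fact //.
  case: n n0 {n0' nf} => // n _.
  by rewrite big_nat_recl // expn1 leq_addr.
have := theta_prime_le n; lra.
Qed.

Lemma sqrt_step (u v k : R) : u ^+ 2 = k -> v ^+ 2 = k + 1 -> 1 <= v * (2 * (v - u)).
Proof. by move=> h1 h2; have := sqr_ge0 (v - u); lra. Qed.

Lemma sum_inv_sqrt_le n :
  \sum_(0 <= k < n) (Num.sqrt (k.+1%:R : R))^-1 <= 2 * Num.sqrt n%:R.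
Proof.
elim: n => [|n IH]; first by rewrite big_geq // mulr_ge0 ?sqrtr_ge0.
rewrite big_nat_recr //=; apply: (le_trans (lerD IH (lexx _))).
set x : R := Num.sqrt n%:R; set y : R := Num.sqrt n.+1%:R.
have x0 : 0 <= x by apply: sqrtr_ge0.
have y0 : 0 < y by rewrite sqrtr_gt0 ltr0n.
have hx : x ^+ 2 = n%:R by rewrite sqr_sqrtr.
have hy : y ^+ 2 = n%:R + 1 by rewrite sqr_sqrtr // natr1.
rewrite -lerBrDl -mulrBr -(ler_pM2l y0) divff ?gt_eqF //.
exact: sqrt_step hx hy.
Qed.

(** By Chebyshev the partial sums of ln p over primes are dominated by those of the constant ln 4;
    the weights are 1/sqrt k. *)
Lemma sum_ln_inv_sqrt_le n :
  \sum_(0 <= p < n.+1 | prime p) lnn p / Num.sqrt p%:R <= 2 * lnn 4 * Num.sqrt n%:R.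
Proof.
rewrite big_mkcond big_nat_recl //= add0r.
have -> : \sum_(0 <= i < n) (if prime i.+1 then lnn i.+1 / Num.sqrt i.+1%:R else 0)
   = \sum_(0 <= i < n) (if prime i.+1 then lnn i.+1 else 0) * (Num.sqrt i.+1%:R)^-1.
  by apply: eq_bigr => i _; case: ifP => _ //; rewrite mul0r.
apply: (le_trans (@abel_majorization _ (fun=> lnn 4) _ _ _ _ _)).
- move=> k; have := theta_prime_le k; rewrite /theta big_mkcond big_nat_recl //= add0r.
  by rewrite sumr_const_nat subn0 mulr_natl.
- by move=> k; rewrite lef_pV2 ?posrE ?sqrtr_gt0 ?ltr0n // ler_sqrt ?ltr0n // ler_nat.
- by move=> k; rewrite invr_ge0 sqrtr_ge0.
rewrite -mulr_sumr -mulrA mulrCA; apply: ler_wpM2l; first exact: lnn_ge0.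
exact: sum_inv_sqrt_le.
Qed.

Lemma sum_ln_div_sqr_le n : \sum_(0 <= d < n.+1) lnn d / d%:R ^+ 2 <= 2.
Proof.
case: n => [|n]; first by rewrite big_nat1 ln0 // mul0r.
(* Modelled on the primitive -(ln x + 1)/x of ln x / x^2, with 2 in place of 1 to leave room for the
   discrete step. *)
suff : \sum_(0 <= d < n.+2) lnn d / d%:R ^+ 2 <= 2 - (lnn n.+1 + 2) / n.+1%:R.
  by move=> h; apply: le_trans h _; rewrite gerBl divr_ge0 ?addr_ge0 ?lnn_ge0.
elim: n => [|n IH].
  by rewrite !big_nat_recr //= big_geq // ln0 // ln1 mul0r !add0r !divr1 subrr mul0r.
rewrite big_nat_recr //=; apply: (le_trans (lerD IH (lexx _))).
have e : n.+2%:R = n.+1%:R + 1 :> R by rewrite natr1.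
have x0 : 0 < n.+1%:R :> R by rewrite ltr0n.
have h : lnn n.+2 - lnn n.+1 <= n.+1%:R^-1.
  rewrite -ln_div ?posrE ?ltr0n // e mulrDl divff ?gt_eqF // mul1r.
  by apply: le_ln1Dx; apply: lt_le_trans (_ : 0 <= _); rewrite ?ltrN10 // invr_ge0 ltW.
have L0 := lnn_ge0 n.+1; have L1 := lnn_ge0 n.+2.
rewrite e in h L1 *; move: (lnn n.+1) (ln (n.+1%:R + 1)) h L0 L1 => u v h u0 v0.
have x1 : 1 <= n.+1%:R :> R by rewrite ler1n.
move: (n.+1%:R : R) x0 h x1 => x x0 h x1.
rewrite -subr_ge0.
have -> : 2 - (v + 2) / (x + 1) - (2 - (u + 2) / x + v / (x + 1) ^+ 2)
  = ((u + 2 - x * (v - u)) * (x + 1) - v * x) / (x * (x + 1) ^+ 2).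
  by field; rewrite !gt_eqF //; lra.
have h1 : x * (v - u) <= 1 by rewrite -ler_pdivlMl // mulr1.
apply: divr_ge0; last by apply: mulr_ge0; [exact: ltW | exact: sqr_ge0].
have h2 : v - u <= 1 by apply: le_trans h _; rewrite invf_le1.
nra.
Qed.

(** pi(n) ln n - theta(n) is the sum of ln n - ln p over the primes p <= n. Extending that sum to
    all integers i <= n bounds it by n ln n - ln n!, which is at most n. *)
Lemma prime_count_le n :
  (\sum_(0 <= p < n.+1 | prime p) 1) * lnn n <= n%:R * (lnn 4 + 1).
Proof.
have h : (\sum_(0 <= p < n.+1 | prime p) 1) * lnn n - theta prime n
         <= n%:R * lnn n - lnn (n`!).
  rewrite mulr_suml /theta -sumrB fact_prod lnn_prod; last first.
    by move=> i; rewrite mem_index_iota => /andP[].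
  have -> : n%:R * lnn n = \sum_(1 <= i < n.+1) lnn n.
    by rewrite sumr_const_nat subSS subn0 mulr_natl.
  rewrite -sumrB big_mkcond big_nat_recl //= add0r big_add1 /= big_nat [leRHS]big_nat.
  apply: ler_sum => i /andP[_ hi]; have := ler_lnn hi; case: ifP => _; lra.
have := lnn_fact n; have := theta_prime_le n; lra.
Qed.

End Mertens.

(** * Square-free integers supported on a set of primes *)

Section SquarefreeSupported.

Definition sqfree_on (S : pred nat) (m : nat) : bool :=
  (0 < m) && all (fun p => S p && (logn p m == 1)) (primes m).

Lemma sqfree_onP (S : pred nat) m :
  reflect (0 < m /\ forall p, prime p -> p %| m -> S p /\ logn p m = 1) (sqfree_on S m).
Proof.
apply: (iffP andP) => -[m0 h]; split=> //.
  move=> p pp pm; have /(allP h)/andP[-> /eqP ->] // : p \in primes m.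
  by rewrite mem_primes pp m0.
by apply/allP => p; rewrite mem_primes => /and3P[pp _ pm]; have [-> ->] := h _ pp pm.
Qed.

Lemma sqfree_on_gt0 S m : sqfree_on S m -> 0 < m.
Proof. by case/andP. Qed.

Lemma sqfree_onW (S S' : pred nat) m :
  (forall p, prime p -> p %| m -> S p -> S' p) -> sqfree_on S m -> sqfree_on S' m.
Proof.
move=> h /sqfree_onP[m0 hm]; apply/sqfree_onP; split=> // p pp pm.
by have [sp ->] := hm _ pp pm; split=> //; apply: h.
Qed.

Lemma sqfree_onM (S : pred nat) p m : prime p -> S p -> ~~ (p %| m) ->
  sqfree_on S m -> sqfree_on S (p * m).
Proof.
move=> pp sp npm /sqfree_onP[m0 hm]; apply/sqfree_onP; split.
  by rewrite muln_gt0 prime_gt0.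
move=> r pr; rewrite Euclid_dvdM // (lognM _ (prime_gt0 pp) m0) (logn_prime _ pp).
case: (eqVneq r p) => [->|rp].
  by rewrite lognE (negbTE npm) andbF andbF.
by rewrite dvdn_prime2 // (negbTE rp) /= add0n; apply: hm.
Qed.

Lemma sqfree_on_div (S : pred nat) p m : prime p -> p %| m ->
  sqfree_on S m -> sqfree_on S (m %/ p) /\ ~~ (p %| m %/ p).
Proof.
move=> pp /dvdnP[k ->] /sqfree_onP[km hm]; rewrite mulnK ?prime_gt0 //.
move: km; rewrite muln_gt0 => /andP[k0 _].
have npk : ~~ (p %| k).
  have [_] := hm p pp (dvdn_mull _ (dvdnn p)).
  rewrite (lognM _ k0 (prime_gt0 pp)) (logn_prime _ pp) eqxx addn1 => -[].
  by rewrite lognE pp k0 /=; case: ifP.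
split=> //; apply/sqfree_onP; split=> // r pr rk.
have [sr] := hm r pr (dvdn_mulr _ rk).
rewrite (lognM _ k0 (prime_gt0 pp)) (logn_prime _ pp).
by case: eqVneq rk npk => [-> -> //|_ _ _]; rewrite addn0.
Qed.

Lemma sqfree_decomposition k : 0 < k ->
  exists a b, [/\ sqfree_on prime a, 0 < b & k = a * b ^ 2].
Proof.
elim/ltn_ind: k => k IH k0.
case: (boolP (has (fun p => 1 < logn p k) (primes k))) => [/hasP[p]|/hasPn h].
  rewrite mem_primes => /and3P[pp _ pk] l1.
  have /dvdnP[k' ek] : p ^ 2 %| k by rewrite pfactor_dvdn.
  have p0 := prime_gt0 pp; have p1 := prime_gt1 pp.
  have k'0 : 0 < k' by move: k0; rewrite ek; case: (k').
  have [||a [b [ha hb eb]]] := IH k' => //.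
    by rewrite ek ltn_Pmulr // (ltn_exp2l 0).
  exists a, (b * p); split=> //; first by rewrite muln_gt0 hb.
  by rewrite ek eb expnMn mulnA.
exists k, 1; rewrite muln1; split=> //.
apply/sqfree_onP; split=> // p pp pk; split=> //.
have pin : p \in primes k by rewrite mem_primes pp k0.
have := h _ pin; have : 0 < logn p k by rewrite logn_gt0.
by case: (logn p k) => [|[|]].
Qed.

End SquarefreeSupported.

(** * Reciprocal sums of square-free integers supported on a set of primes *)

Section DensityHalf.
Variable R : realType.
Local Open Scope ring_scope.
Notation lnn n := (ln (n%:R : R)).

Lemma ler_sum_mem (J : eqType) (t : seq J) (Q : pred J) (g : J -> R) j :
  (forall j, j \in t -> Q j -> 0 <= g j) -> j \in t -> Q j ->
  g j <= \sum_(j <- t | Q j) g j.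
Proof.
move=> g0 jt Qj; elim: t g0 jt => // k t IH g0; rewrite inE big_cons.
have g0' i : i \in t -> Q i -> 0 <= g i by move=> it; apply: g0; rewrite inE it orbT.
have S0 : 0 <= \sum_(i <- t | Q i) g i.
  by rewrite big_seq_cond sumr_ge0 // => i /andP[]; apply: g0'.
case/predU1P => [<-|jt]; first by rewrite Qj lerDl.
case: ifP => Qk; last exact: IH.
by rewrite -[leLHS]add0r lerD ?IH // g0 ?inE ?eqxx.
Qed.

(** Each term on the left is charged to a term on the right that [h] sends back to it, so no
    right-hand term is charged twice. *)
Lemma ler_sum_surj (I J : eqType) (s : seq I) (t : seq J) (P : pred I) (Q : pred J)
  (f : I -> R) (g : J -> R) (h : J -> I) : uniq s ->
  (forall j, j \in t -> Q j -> 0 <= g j) ->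
  (forall i, i \in s -> P i -> exists j, [/\ j \in t, Q j, h j = i & f i <= g j]) ->
  \sum_(i <- s | P i) f i <= \sum_(j <- t | Q j) g j.
Proof.
move=> us g0 hex.
apply: (@le_trans _ _ (\sum_(i <- s | P i) \sum_(j <- t | Q j && (h j == i)) g j)).
  rewrite big_seq_cond [leRHS]big_seq_cond; apply: ler_sum => i /andP[si Pi].
  have [j [jt Qj hj fg]] := hex i si Pi; apply: le_trans fg _.
  apply: (@ler_sum_mem _ _ _ g) => //; last by rewrite Qj hj eqxx.
  by move=> k kt /andP[Qk _]; apply: g0.
rewrite (exchange_big_dep Q) /=; last by move=> i j _ /andP[].
rewrite big_seq_cond [leRHS]big_seq_cond; apply: ler_sum => j /andP[jt Qj].
rewrite big_const_seq iter_addr_0 -mulr_natr -[leRHS]mulr1.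
apply: ler_wpM2l; first exact: g0.
rewrite -[leRHS]/(1%:R) ler_nat.
apply: (@leq_trans (count_mem (h j) s)).
  by apply: sub_count => i /= /andP[_ /andP[_ /eqP ->]].
by rewrite count_uniq_mem // leq_b1.
Qed.

Definition recip_sum (S : pred nat) n : R := \sum_(0 <= k < n.+1 | sqfree_on S k) k%:R^-1.

Lemma recip_sum_ge0 S n : 0 <= recip_sum S n.
Proof. by apply: sumr_ge0 => k _; rewrite invr_ge0. Qed.

Lemma ln_le_harmonic n : lnn n <= \sum_(1 <= k < n.+1) k%:R^-1.
Proof.
apply: (@le_trans _ _ (lnn n.+1)); first exact: ler_lnn.
elim: n => [|n IH]; first by rewrite big_geq // ln1.
rewrite big_nat_recr //=; apply: le_trans (lerD IH (lexx _)).
rewrite -lerBlDl -ln_div ?posrE ?ltr0n //.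
rewrite -[n.+2%:R]natr1 mulrDl divff ?pnatr_eq0 // mul1r.
by apply: le_ln1Dx; apply: lt_le_trans (_ : 0 <= _); rewrite ?ltrN10 // invr_ge0.
Qed.

Lemma sum_inv_sqr_le n : \sum_(1 <= b < n.+1) (b%:R ^+ 2)^-1 <= 2 :> R.
Proof.
case: n => [|n]; first by rewrite big_geq.
suff : \sum_(1 <= b < n.+2) (b%:R ^+ 2)^-1 <= 2 - n.+1%:R^-1 :> R.
  by move=> h; apply: le_trans h _; rewrite gerBl invr_ge0.
elim: n => [|n IH]; first by rewrite big_nat1 expr1n invr1; lra.
rewrite big_nat_recr //=; apply: (le_trans (lerD IH (lexx _))).
have x1 : 1 <= n.+1%:R :> R by rewrite ler1n.
rewrite -[n.+2%:R]natr1; move: (n.+1%:R : R) x1 => x x1.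
rewrite -subr_ge0.
have -> : 2 - (x + 1)^-1 - (2 - x^-1 + ((x + 1) ^+ 2)^-1) = (x * (x + 1) ^+ 2)^-1.
  by field; rewrite !gt_eqF //; lra.
by rewrite invr_ge0 mulr_ge0 ?sqr_ge0 //; lra.
Qed.

(** Writing k = a b^2 with a square-free factors the harmonic sum, and the sum of 1/b^2 is at most
    2. *)
Lemma harmonic_le_recip_sum n : \sum_(1 <= k < n.+1) k%:R^-1 <= 2 * recip_sum prime n.
Proof.
set t := [seq (a, b) | a <- index_iota 0 n.+1, b <- index_iota 1 n.+1].
apply: (@le_trans _ _ (\sum_(ab <- t)
    if sqfree_on prime ab.1 then (ab.1%:R * ab.2%:R ^+ 2)^-1 else 0)).
  apply: (@ler_sum_surj _ _ _ t xpredT _ _ _ (fun ab => ab.1 * ab.2 ^ 2)%N).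
  - exact: iota_uniq.
  - by move=> j _ _; case: ifP => // _; rewrite invr_ge0 mulr_ge0 ?sqr_ge0.
  move=> k; rewrite mem_index_iota => /andP[k0 kn] _.
  have [a [b [ha hb ek]]] := sqfree_decomposition k0; exists (a, b); split=> //.
    have a0 := sqfree_on_gt0 ha.
    have [h1 h2] : (a <= k)%N /\ (b <= k)%N by rewrite ek; split; nia.
    by apply: allpairs_f; rewrite mem_index_iota; lia.
  by rewrite ha ek natrM natrX.
rewrite /t big_allpairs_dep /=.
rewrite /recip_sum mulr_sumr.
rewrite [leRHS]big_mkcond; apply: ler_sum => a _; case: ifP => ha; last by rewrite big1.
under eq_bigr => b _ do rewrite invfM.
rewrite -mulr_sumr mulrC; apply: ler_wpM2r; first by rewrite invr_ge0.
exact: sum_inv_sqr_le.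
Qed.

(** The terms divisible by the new prime p become terms prime to p after division by p. *)
Lemma recip_sumU1 (U U' : pred nat) p n : prime p ->
  (forall q, U' q -> U q || (q == p)) ->
  recip_sum U' n <= recip_sum U n * (1 + p%:R^-1).
Proof.
move=> pp UU'; rewrite /recip_sum (bigID (dvdn p)) /= addrC mulrDr mulr1; apply: lerD.
  rewrite big_mkcond [leRHS]big_mkcond; apply: ler_sum => k _.
  case: ifP => [/andP[hk npk]|_]; last by case: ifP => // _; rewrite invr_ge0.
  rewrite (_ : sqfree_on U k) //; apply: sqfree_onW hk => q pq qk /UU' /orP[]// /eqP eq.
  by rewrite -eq qk in npk.
rewrite mulr_suml.
apply: (@ler_sum_surj _ _ _ (index_iota 0 n.+1) _ _ _ _ (muln p)).
- exact: iota_uniq.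
- by move=> j _ _; rewrite mulr_ge0 // invr_ge0.
move=> k; rewrite mem_index_iota => /andP[_ kn] /andP[hk pk].
have [h1 h2] := sqfree_on_div pp pk hk.
exists (k %/ p)%N; split.
- by rewrite mem_index_iota /=; apply: leq_ltn_trans (leq_div _ _) kn.
- apply: sqfree_onW h1 => q pq qk /UU' /orP[]// /eqP eq.
  by rewrite eq (negbTE h2) in qk.
- by rewrite mulnC divnK.
by rewrite -invfM -natrM divnK.
Qed.

Lemma recip_sum_prime_le (S : pred nat) n :
  recip_sum prime n <=
  recip_sum S n * expR (\sum_(0 <= p < n.+1 | prime p && ~~ S p) p%:R^-1).
Proof.
pose U j : pred nat := fun p => prime p && (S p || (p < j)%N).
have h j : recip_sum (U j) n <=
    recip_sum S n * expR (\sum_(0 <= p < j | prime p && ~~ S p) p%:R^-1).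
  elim: j => [|j IH].
    rewrite big_geq // expR0 mulr1 /recip_sum.
    rewrite big_mkcond [leRHS]big_mkcond; apply: ler_sum => k _.
    case: ifP => hk; last by case: ifP => // _; rewrite invr_ge0.
    by rewrite (_ : sqfree_on S k) //; apply: sqfree_onW hk => q _ _ /andP[_]; rewrite orbF.
  rewrite big_mkcond big_nat_recr //= -big_mkcond /=.
  case: ifP => [/andP[pj nSj]|nj].
    apply: (le_trans (@recip_sumU1 (U j) _ j n pj _)).
      by move=> q; rewrite /U => /andP[-> /=]; rewrite ltnS leq_eqVlt [(_ == _) || _]orbC orbA.
    rewrite expRD mulrA; apply: ler_pM => //; rewrite ?recip_sum_ge0 //.
      by rewrite addr_ge0 // invr_ge0.
    exact: expR_ge1Dx.
  rewrite addr0; apply: le_trans IH; rewrite /recip_sum.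
  rewrite big_mkcond [leRHS]big_mkcond; apply: ler_sum => k _.
  case: ifP => hk; last by case: ifP => // _; rewrite invr_ge0.
  rewrite (_ : sqfree_on (U j) k) //; apply: sqfree_onW hk => q pq _.
  rewrite /U pq /= ltnS leq_eqVlt; case: (eqVneq q j) => [eqj|//] _.
  by move: nj; rewrite -eqj pq /=; case: (S q).
apply: le_trans (h n.+1); rewrite /recip_sum.
rewrite big_seq_cond [leRHS]big_seq_cond big_mkcond [leRHS]big_mkcond; apply: ler_sum => k _.
case: ifP => [/andP[]|]; last by case: ifP => // _; rewrite invr_ge0.
rewrite mem_index_iota => /andP[_ kn] hk; rewrite (_ : sqfree_on _ k) ?kn //.
have k0 := sqfree_on_gt0 hk.
by apply: sqfree_onW hk => q pq qk _; rewrite /U pq (leq_ltn_trans (dvdn_leq k0 qk) kn) orbT.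
Qed.

End DensityHalf.

(** * Counting the integers supported on a set of primes with Mertens density one half *)

Section CountSupported.
Variable R : realType.
Local Open Scope ring_scope.
Notation lnn n := (ln (n%:R : R)).

Definition mertens_sum (S : pred nat) n : R := \sum_(0 <= p < n.+1 | S p) lnn p / p%:R.

(** From ln x <= x - 1 at x = ln n / ln (n+1). It lets the weights 1/ln n telescope to ln ln n. *)
Lemma lnln_step n : (1 < n)%N ->
  (lnn n.+1 - lnn n) / lnn n.+1 <= ln (lnn n.+1) - ln (lnn n).
Proof.
move=> n1; have x0 : 0 < lnn n by apply: lnn_gt0.
have y0 : 0 < lnn n.+1 by apply: lnn_gt0; lia.
have := @le_ln1Dx R (lnn n / lnn n.+1 - 1).
rewrite addrCA subrr addr0 ln_div ?posrE // ltrBrDl subrr divr_gt0 // => /(_ isT).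
by rewrite mulrBl divff ?gt_eqF //; lra.
Qed.

(** Partial summation from ln p / p to 1/p with the weights 1/ln p. The indices are shifted to start
    at 2 because ln 1 = 0. *)
Lemma recip_sum_of_mertens (Q : pred nat) (C1 : R) : {subset Q <= prime} ->
  (forall n, (0 < n)%N -> mertens_sum Q n <= 2^-1 * lnn n + C1) ->
  exists C, forall n, (1 < n)%N ->
    \sum_(0 <= p < n.+1 | Q p) p%:R^-1 <= 2^-1 * ln (lnn n) + C.
Proof.
move=> Qp HQ; exists ((2^-1 * lnn 2 + C1) / lnn 2 - 2^-1 * ln (lnn 2)) => -[|[|n]] // _.
have nQ0 : Q 0%N = false by apply/negP => /Qp.
have nQ1 : Q 1%N = false by apply/negP => /Qp.
have shift F N : \sum_(0 <= p < N.+2 | Q p) F p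
    = \sum_(0 <= i < N) (if Q i.+2 then F i.+2 else 0) :> R.
  by rewrite big_mkcond big_nat_recl //= nQ0 add0r big_nat_recl //= nQ1 add0r.
rewrite shift.
(* Chosen so that its partial sums are exactly the assumed upper bound. *)
pose b i : R := if i is 0%N then 2^-1 * lnn 2 + C1 else 2^-1 * (lnn i.+2 - lnn i.+1).
have bs k : \sum_(0 <= i < k.+1) b i = 2^-1 * lnn k.+2 + C1.
  elim: k => [|k IH]; first by rewrite big_nat1.
  by rewrite big_nat_recr //= IH; lra.
apply: (@le_trans _ _ (\sum_(0 <= i < n.+1)
    (if Q i.+2 then lnn i.+2 / i.+2%:R else 0) * (lnn i.+2)^-1)).
  apply: ler_sum => i _; case: ifP => _; last by rewrite mul0r.
  by rewrite mulrAC divff ?mul1r // gt_eqF // lnn_gt0.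
apply: (le_trans (@abel_majorization _ _ b _ _ _ _ _)).
- case=> [|k]; first by rewrite !big_geq.
  rewrite bs; apply: le_trans (HQ k.+2 isT); rewrite /mertens_sum.
  by rewrite shift.
- by move=> k; rewrite lef_pV2 ?posrE ?lnn_gt0 // ler_lnn.
- by move=> k; rewrite invr_ge0 lnn_ge0.
elim: n {shift} => [|n IH]; first by rewrite big_nat1 /= [leRHS]addrC subrK.
rewrite big_nat_recr //=; apply: (le_trans (lerD IH (lexx _))).
have := @lnln_step n.+2 isT; rewrite -mulrA.
move: ((_ - _) / _) (_ / _ - _) (ln (lnn n.+3)) (ln (lnn n.+2)) => t u v w.
lra.
Qed.

(** The primes outside S have Mertens sum at most (1/2) ln n + O(1). Leaving them out divides the
    full reciprocal sum, which is >> ln n, by at most a constant times sqrt(ln n). *)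
Lemma recip_sum_sqfree_ge (S : pred nat) (C : R) :
  (forall n, (0 < n)%N -> mertens_sum S n >= 2^-1 * lnn n - C) -> {subset S <= prime} ->
  exists2 c, 0 < c & forall n, (1 < n)%N -> c * Num.sqrt (lnn n) <= recip_sum R S n.
Proof.
move=> HS Sp.
have HQ n : (0 < n)%N ->
    mertens_sum (fun p => prime p && ~~ S p) n <= 2^-1 * lnn n + (C + lnn 4).
  move=> n0; have h1 := HS n n0; have := mertens_upper R n0.
  rewrite (bigID S) /= (_ : \sum_(0 <= i < n.+1 | prime i && S i) _ = mertens_sum S n).
    by move=> h2; rewrite -(lerD2l (mertens_sum S n)); apply: le_trans h2 _; lra.
  apply: eq_bigl => p; case: (boolP (S p)) => [/Sp|]; last by rewrite andbF.
  by move=> pp; rewrite andbT; apply/idP.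
have [|C' hC'] := recip_sum_of_mertens _ HQ; first by move=> p /andP[].
exists (2 * expR C')^-1; first by rewrite invr_gt0 mulr_gt0 ?expR_gt0.
move=> n n1; set s := Num.sqrt _.
have L0 : 0 < lnn n by apply: lnn_gt0.
have s0 : 0 < s by rewrite sqrtr_gt0.
have es : expR (2^-1 * ln (lnn n)) = s.
  apply/eqP; rewrite -(@eqrXn2 _ 2) ?expR_ge0 ?ltW // sqr_sqrtr ?ltW //.
  by rewrite -expRM_natl mulrA divff ?pnatr_eq0 ?mul1r ?lnK ?posrE.
have h : lnn n <= 2 * (recip_sum R S n * (s * expR C')).
  apply: (le_trans (ln_le_harmonic R n)); apply: (le_trans (harmonic_le_recip_sum R n)).
  apply: ler_wpM2l => //; apply: (le_trans (recip_sum_prime_le R S n)).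
  apply: ler_wpM2l; first exact: recip_sum_ge0.
  by rewrite -es -expRD ler_expR; apply: hC'.
have s2 : s ^+ 2 = lnn n by rewrite sqr_sqrtr ?ltW.
rewrite -s2 in h; rewrite ler_pdivrMl ?mulr_gt0 ?expR_gt0 //.
by rewrite -(ler_pM2l s0); apply: le_trans (le_trans h _); rewrite ?expr2 //; lra.
Qed.

(** A bounded error in the Mertens sum forces the sum of ln p / p over n/K < p <= n to be at least 1
    once K is large, and there 1/p <= K/n. *)
Lemma theta_ge (S : pred nat) (C : R) : {subset S <= prime} ->
  (forall n, (0 < n)%N -> `|mertens_sum S n - 2^-1 * lnn n| <= C) ->
  exists2 K, (0 < K)%N & forall n, (K <= n)%N -> n%:R / K%:R <= theta R S n.
Proof.
move=> Sp HS.
(* The inequality (1/2) ln K - 2 C >= 1 amounts to ln K >= 4 C + 2. *)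
pose K := (Num.trunc (expR (4 * C + 2))).+1.
have hK : 4 * C + 2 <= lnn K.
  rewrite -[leLHS]expRK; apply: ltW; rewrite ltr_ln ?posrE ?expR_gt0 ?ltr0n //.
  exact: truncnS_gt.
exists K => // n Kn; set m := (n %/ K)%N.
have m0 : (0 < m)%N by rewrite divn_gt0.
have n0 : (0 < n)%N by apply: leq_trans Kn.
have mn : (m <= n)%N by apply: leq_div.
have mK : (m * K <= n)%N by apply: leq_trunc_div.
have nm : (n < m.+1 * K)%N by apply: ltn_ceil.
have h1 : lnn m + lnn K <= lnn n by rewrite -lnnM // ler_lnn.
have := HS n n0; have := HS m m0; rewrite !ler_norml => /andP[_ hm] /andP[hn _].
have e : mertens_sum S n = mertens_sum S m + \sum_(m.+1 <= p < n.+1 | S p) lnn p / p%:R.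
  by rewrite /mertens_sum (@big_cat_nat _ _ _ m.+1) //=.
have h2 : 1 <= \sum_(m.+1 <= p < n.+1 | S p) lnn p / p%:R by lra.
have h3 : \sum_(m.+1 <= p < n.+1 | S p) lnn p / p%:R <= theta R S n * (K%:R / n%:R).
  apply: (@le_trans _ _ (\sum_(m.+1 <= p < n.+1 | S p) lnn p * (K%:R / n%:R))).
    rewrite big_nat_cond [leRHS]big_nat_cond; apply: ler_sum => p /andP[/andP[mp _] Sp'].
    apply: ler_wpM2l; first exact: lnn_ge0.
    have p0 : (0 < p)%N by lia.
    rewrite -[leRHS]invf_div lef_pV2 ?posrE ?ltr0n ?divr_gt0 ?ltr0n //.
    rewrite ler_pdivrMr ?ltr0n // -natrM ler_nat; nia.
  rewrite -mulr_suml; apply: ler_wpM2r; first by rewrite divr_ge0.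
  rewrite /theta [leRHS](@big_cat_nat _ _ _ m.+1) //= lerDr.
  by apply: sumr_ge0 => p _; exact: lnn_ge0.
have n0' : 0 < n%:R :> R by rewrite ltr0n.
have K0' : 0 < K%:R :> R by rewrite ltr0n.
rewrite ler_pdivrMr // -[leLHS]mul1r -ler_pdivlMr // -mulrA; exact: le_trans h2 h3.
Qed.

Lemma sum_ln_dvd_le (s : seq nat) (Q : pred nat) m : uniq s -> (0 < m)%N ->
  (forall p, p \in s -> Q p -> prime p /\ (p %| m)%N) ->
  \sum_(p <- s | Q p) lnn p <= lnn m.
Proof.
move=> us m0 hQ; rewrite (lnn_logn R m0 (leqnn m)).
apply: (ler_sum_surj (h := id)) => // [p _ _|p ps Qp]; first by rewrite mulr_ge0 ?lnn_ge0.
have [pp pm] := hQ p ps Qp; exists p; split=> //.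
  by rewrite mem_index_iota ltnS (dvdn_leq m0 pm).
have l1 : 1 <= (logn p m)%:R :> R by rewrite ler1n logn_gt0 mem_primes pp m0.
by rewrite -[leLHS]mul1r ler_wpM2r ?lnn_ge0.
Qed.

(* Both sides count log p over factorizations k = p m of supported integers k <= n. *)
Lemma sum_theta_le (S : pred nat) n s : {subset S <= prime} ->
  \sum_(0 <= m < s.+1 | sqfree_on S m) (theta R S (n %/ m) - lnn m)
  <= (\sum_(0 <= k < n.+1 | sqfree_on S k) 1) * lnn n.
Proof.
move=> Sp.
have Spp p : S p -> prime p by move/Sp.
apply: (@le_trans _ _ (\sum_(0 <= m < s.+1 | sqfree_on S m)
   \sum_(0 <= p < n.+1 | S p && (~~ (p %| m)%N && (p * m <= n)%N)) lnn p)).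
  apply: ler_sum => m hm; have m0 := sqfree_on_gt0 hm.
  rewrite lerBlDr /theta (@big_nat_widen _ _ _ _ _ n.+1) ?ltnS ?leq_div //.
  rewrite (bigID (dvdn^~ m)) /= addrC; apply: lerD.
    rewrite le_eqVlt; apply/orP; left; apply/eqP/eq_bigl => p.
    by rewrite ltnS leq_divRL // -andbA; congr (_ && _); rewrite andbC.
  apply: sum_ln_dvd_le => //; first exact: iota_uniq.
  by move=> p _ /andP[/andP[/Spp pp _] pm].
rewrite (exchange_big_dep S) /=; last by move=> m p _ /andP[].
apply: (@le_trans _ _ (\sum_(0 <= p < n.+1 | S p)
   \sum_(0 <= k < n.+1 | sqfree_on S k && (p %| k)%N) lnn p)).
  apply: ler_sum => p hp; have pp := Spp _ hp.
  apply: (ler_sum_surj (h := fun k => k %/ p)%N).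
  - exact: iota_uniq.
  - by move=> *; exact: lnn_ge0.
  move=> m _ /andP[hm /andP[_ /andP[npm pmn]]]; exists (p * m)%N; split=> //.
  - by rewrite mem_index_iota.
  - by rewrite sqfree_onM // dvdn_mulr.
  - by rewrite mulKn // prime_gt0.
rewrite (exchange_big_dep (sqfree_on S)) /=; last by move=> p k _ /andP[].
rewrite mulr_suml big_nat_cond [leRHS]big_nat_cond.
apply: ler_sum => k /andP[/andP[_ kn] hk]; rewrite mul1r.
have k0 := sqfree_on_gt0 hk.
apply: (@le_trans _ _ (lnn k)); last exact: ler_lnn.
apply: sum_ln_dvd_le => //; first exact: iota_uniq.
by move=> p _ /andP[/Spp pp /andP[_ pk]].
Qed.

Lemma lnn_large (A : R) : exists n0 : nat, forall n, (n0 <= n)%N -> A <= lnn n.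
Proof.
exists (Num.trunc (expR A)).+1 => n hn.
rewrite -[leLHS]expRK; apply: ltW; rewrite ltr_ln ?posrE ?expR_gt0 ?ltr0n //; last by lia.
apply: lt_le_trans (truncnS_gt _) _; by rewrite ler_nat.
Qed.

(** With s the integer square root of n, [sum_theta_le] bounds N ln n below by the sum of theta(n/m)
    over supported m <= s, up to an error n. As theta(n/m) >> n/m, that sum is n times the
    reciprocal sum up to s, hence >> n sqrt(ln s). *)
Lemma sqfree_on_count_ge (S : pred nat) (C : R) : {subset S <= prime} ->
  (forall n, (0 < n)%N -> `|mertens_sum S n - 2^-1 * lnn n| <= C) ->
  exists2 c, 0 < c & exists n0, forall n, (n0 <= n)%N ->
    c * n%:R <= (\sum_(0 <= k < n.+1 | sqfree_on S k) 1) * Num.sqrt (lnn n).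
Proof.
move=> Sp HS; have [K K0 hK] := theta_ge Sp HS.
have [|c c0 hc] := @recip_sum_sqfree_ge S C _ Sp.
  by move=> n n0; have := HS n n0; rewrite ler_norml => /andP[h _]; lra.
have K0' : 0 < K%:R :> R by rewrite ltr0n.
(* The main term is 2 c1 r n with r = sqrt(ln s); half of it absorbs the error n as soon as c1 r >=
   1. *)
pose c1 : R := c / (4 * K%:R).
have c10 : 0 < c1 by rewrite divr_gt0 // mulr_gt0.
have [n1 hn1] := lnn_large (c1^-1 ^+ 2).
exists (c1 / 2); first by rewrite divr_gt0.
exists (maxn ((maxn n1 2).+1 ^ 2) (K.+1 ^ 2)) => n; rewrite geq_max => /andP[nn1 nK].
have [s s2 s3] := exists_isqrt n.
have Ks : (K <= s)%N.
  by have : (K.+1 ^ 2 < s.+1 ^ 2)%N by [apply: leq_ltn_trans s3]; rewrite ltn_exp2r //; lia.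
have n1s : (maxn n1 2 <= s)%N.
  by have : ((maxn n1 2).+1 ^ 2 < s.+1 ^ 2)%N by [apply: leq_ltn_trans s3]; rewrite ltn_exp2r //; lia.
have sn1 : (n1 <= s)%N by lia.
have s1 : (1 < s)%N by lia.
have L := @sum_theta_le S n s Sp.
set N := \sum_(0 <= k < n.+1 | sqfree_on S k) 1 in L *.
have n0 : (0 < n)%N by nia.
have n0' : 0 < n%:R :> R by rewrite ltr0n.
pose r : R := Num.sqrt (lnn s).
have lns0 : 0 < lnn s by apply: lnn_gt0.
have r0 : 0 < r by rewrite sqrtr_gt0.
have h1 : n%:R / (2 * K%:R) * recip_sum R S s - n%:R <= N * lnn n.
  apply: le_trans L; rewrite sumrB; apply: lerB.
    rewrite /recip_sum mulr_sumr big_nat_cond [leRHS]big_nat_cond.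
    apply: ler_sum => m /andP[/andP[_ ms] hm]; have m0 := sqfree_on_gt0 hm.
    have Kd : (K <= n %/ m)%N by rewrite leq_divRL //; nia.
    apply: le_trans (hK _ Kd).
    have m0' : 0 < m%:R :> R by rewrite ltr0n.
    rewrite ler_pdivlMr // -(ler_pM2r m0').
    have e : (n <= 2 * (n %/ m * m))%N by have := divn_eq n m; have := ltn_pmod n m0; nia.
    rewrite -(ler_nat R) !natrM in e.
    have -> : n%:R / (2 * K%:R) / m%:R * K%:R * m%:R = n%:R / 2 :> R.
      by field; rewrite !gt_eqF.
    by rewrite ler_pdivrMr // [leRHS]mulrC.
  apply: (@le_trans _ _ (\sum_(0 <= m < s) lnn s)).
    rewrite big_mkcond big_nat_recl //= add0r big_nat_cond [leRHS]big_nat_cond.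
    apply: ler_sum => m /andP[/andP[_ ms] _].
    by case: ifP => _; rewrite ?lnn_ge0 // ler_lnn.
  rewrite sumr_const_nat subn0 -[leLHS]mulr_natr.
  have h : lnn s <= s%:R by apply: ltW; apply: ln_sublinear; rewrite ltr0n; lia.
  apply: (@le_trans _ _ (s%:R * s%:R)); first by rewrite ler_wpM2r.
  by rewrite -natrM ler_nat .
have h2 := hc s s1.
have r2 : r ^+ 2 = lnn s by rewrite sqr_sqrtr ?ltW.
have hr : 1 <= c1 * r.
  rewrite -ler_pdivrMl // mulr1 -(@ler_pXn2r _ 2) ?nnegrE ?invr_ge0 ?(ltW c10) ?(ltW r0) //.
  by rewrite r2; apply: hn1.
have h3 : c1 * r * n%:R <= N * lnn n.
  have hh : n%:R / (2 * K%:R) * (c * r) - n%:R <= N * lnn n.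
    apply: le_trans h1; rewrite lerD2r; apply: ler_wpM2l => //.
    by rewrite divr_ge0 // mulr_ge0.
  have e : n%:R / (2 * K%:R) * (c * r) = 2 * (c1 * r * n%:R).
    by rewrite /c1; field; rewrite gt_eqF.
  have : n%:R <= c1 * r * n%:R by rewrite -[leLHS]mul1r ler_wpM2r.
  lra.
set t := Num.sqrt (lnn n).
have lnn0 : 0 < lnn n.
  by apply/lnn_gt0/(leq_trans s1)/(leq_trans _ s2); rewrite -{1}[s]expn1 leq_exp2l.
have t0 : 0 < t by rewrite sqrtr_gt0.
have t2 : t ^+ 2 = lnn n by rewrite sqr_sqrtr ?ltW.
(* Since n < (s+1)^2 <= s^4, one has ln n <= 4 ln s. *)
have tr : t <= 2 * r.
  rewrite -(@ler_pXn2r _ 2) ?nnegrE ?mulr_ge0 ?(ltW t0) ?(ltW r0) // t2 exprMn r2.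
  have : lnn n <= lnn (s ^ 4).
    apply/ler_lnn/(leq_trans (ltnW s3)); rewrite (expnM s 2 2) leq_sqr expnS expn1.
    apply: (@leq_trans (2 * s)%N); last by rewrite leq_mul2r s1 orbT.
    by rewrite mul2n -addnn -addn1 leq_add2l ltnW.
  rewrite (lnnX R 4 (ltnW s1)).
  by move=> h; apply: le_trans h _; rewrite -natrX.
rewrite -t2 in h3.
rewrite -(ler_pM2r t0) -mulrA -[leRHS]mulrA -expr2; apply: le_trans h3.
have : 0 <= n%:R * c1 by rewrite mulr_ge0 // ltW.
nra.
Qed.

End CountSupported.

(** * Lattice points in boxes *)

Section LatticeCount.
Local Open Scope ring_scope.

(** Pigeonhole on the (s+1)^2 > p values of a - w b modulo p. *)
Lemma thue (p s : nat) (w : int) : (0 < p)%N -> (p < s.+1 ^ 2)%N ->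
  exists x y : int, [/\ (x != 0) || (y != 0), (`|x| <= s)%N, (`|y| <= s)%N
                      & (p %| x - w * y)%Z].
Proof.
move=> p0 ps.
have pz : (p%:Z != 0) by lia.
have hm (u : int) : (absz (u %% p)%Z < p)%N.
  have := modz_ge0 u pz; have := ltz_pmod u (d := p%:Z); lia.
pose f (a : 'I_s.+1 * 'I_s.+1) : 'I_p := Ordinal (hm (a.1%:Z - w * a.2%:Z)).
have /injectivePn[a [b ab fab]] : ~~ injectiveb f.
  apply/negP => /injectiveP/leq_card; rewrite card_prod !card_ord; lia.
exists (a.1%:Z - b.1%:Z), (a.2%:Z - b.2%:Z).
have [a1 a2 b1 b2] := And4 (ltn_ord a.1) (ltn_ord a.2) (ltn_ord b.1) (ltn_ord b.2).
split; try lia.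
  rewrite -negb_and; apply: contra ab => /andP[/eqP h1 /eqP h2].
  by case: a b {fab a1 a2 b1 b2} h1 h2 => [a1 a2] [b1 b2] /= h1 h2; apply/eqP; congr (_, _); apply: val_inj => /=; lia.
have := congr1 val fab => /= h.
have e1 := modz_ge0 (a.1%:Z - w * a.2%:Z) pz.
have e2 := modz_ge0 (b.1%:Z - w * b.2%:Z) pz.
have /eqP : ((a.1%:Z - w * a.2%:Z) %% p)%Z = ((b.1%:Z - w * b.2%:Z) %% p)%Z by lia.
rewrite eqz_mod_dvd; congr (_ %| _)%Z; ring.
Qed.

(** The quotients r1/D and r2/D have absolute value below 1: they are the fractional coordinates of
    a vector in a basis of determinant D. *)
Lemma small_residual (D x y r1 r2 : int) (B : nat) : D != 0 ->
  0 <= r1 < `|D| -> 0 <= r2 < `|D| -> (`|x| + `|y| <= B)%N ->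
  forall u, D * u = r1 * x + r2 * y -> (`|u| <= B)%N.
Proof.
move=> D0 /andP[a1 b1] /andP[a2 b2] xy u e.
have h : `|D| * `|u| <= `|D| * B%:Z.
  rewrite -normrM e; apply: le_trans (ler_normD _ _) _; rewrite !normrM.
  have h1 : `|r1| * `|x| <= `|D| * `|x| by apply: ler_wpM2r => //; rewrite ger0_norm // ltW.
  have h2 : `|r2| * `|y| <= `|D| * `|y| by apply: ler_wpM2r => //; rewrite ger0_norm // ltW.
  apply: le_trans (lerD h1 h2) _; rewrite -mulrDr; apply: ler_wpM2l => //; lia.
rewrite ler_pM2l ?normr_gt0 // in h; lia.
Qed.

(* The vectors (x, y) and (E y, x) both lie in the lattice {u = w v mod p}, so
   any (c, 0) can be reduced modulo the sublattice they span. *)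
Lemma small_representative (E p s : nat) (w : int) : (0 < E)%N ->
  (forall x y : int, x ^+ 2 = E%:Z * y ^+ 2 -> y = 0) ->
  (0 < p)%N -> (p < s.+1 ^ 2)%N -> (p %| w ^+ 2 - E%:Z)%Z ->
  forall c : int, exists x y : int,
    [/\ (`|x| <= E.+1 * s)%N, (`|y| <= E.+1 * s)%N & (p %| x - w * y - c)%Z].
Proof.
move=> E0 Ens p0 ps hw c.
have [x [y [xy0 xs ys hxy]]] := thue w p0 ps.
pose D := x ^+ 2 - E%:Z * y ^+ 2.
have D0 : D != 0.
  rewrite subr_eq0; apply/negP => /eqP h; have y0 := Ens _ _ h.
  by move: h xy0; rewrite y0 expr0n mulr0 => /eqP; rewrite sqrf_eq0 => ->.
pose al := (c * x %/ D)%Z; pose be := (- (c * y) %/ D)%Z.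
pose r1 := (c * x %% D)%Z; pose r2 := (- (c * y) %% D)%Z.
have e1 : c * x = al * D + r1 by apply: divz_eq.
have e2 : - (c * y) = be * D + r2 by apply: divz_eq.
have hr1 : 0 <= r1 < `|D| by rewrite modz_ge0 // ltz_mod.
have hr2 : 0 <= r2 < `|D| by rewrite modz_ge0 // ltz_mod.
exists (c - al * x - be * (E%:Z * y)), (- (al * y) - be * x); split.
- apply: (@small_residual D x (E%:Z * y) r1 r2) => //.
    by rewrite abszM mulSn leq_add // leq_mul2l ys orbT.
  have -> : r1 = c * x - al * D by rewrite e1; ring.
  have -> : r2 = - (c * y) - be * D by rewrite e2; ring.
  by rewrite /D; ring.
- apply: (@small_residual D y x r1 r2) => //.
    by rewrite addnC mulSn leq_add // (leq_trans ys) // leq_pmull.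
  have -> : r1 = c * x - al * D by rewrite e1; ring.
  have -> : r2 = - (c * y) - be * D by rewrite e2; ring.
  by rewrite /D; ring.
have -> : c - al * x - be * (E%:Z * y) - w * (- (al * y) - be * x) - c
   = - (al - be * w) * (x - w * y) + be * y * (w ^+ 2 - E%:Z) by ring.
by rewrite rpredD // dvdz_mull.
Qed.

(** The integer [c] selects a coset of the lattice u = w v modulo p. *)
Definition box_count (p : nat) (w c a0 b0 : int) (a b : nat) : nat :=
  (\sum_(0 <= i < a) \sum_(0 <= j < b) (p %| ((a0 + i%:Z) - w * (b0 + j%:Z) - c)%R)%Z)%N.

Lemma box_count_mono p w c (a0 b0 : int) (a b k l k' l' : nat) :
  (box_count p w c (a0 + k%:Z) (b0 + l%:Z) a b
   <= box_count p w c a0 b0 (k + a + k') (l + b + l'))%N.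
Proof.
rewrite /box_count.
rewrite [leqRHS](@big_cat_nat _ _ _ (k + a)) //=; last by lia.
rewrite [X in (_ <= X + _)%N](@big_cat_nat _ _ _ k) //=; last by lia.
apply: leq_trans (leq_addr _ _); apply: leq_trans (leq_addl _ _).
rewrite -{2}[k]add0n big_addn addKn; apply: leq_sum => i _.
rewrite [leqRHS](@big_cat_nat _ _ _ (l + b)) //=; last by lia.
rewrite [X in (_ <= X + _)%N](@big_cat_nat _ _ _ l) //=; last by lia.
apply: leq_trans (leq_addr _ _); apply: leq_trans (leq_addl _ _).
rewrite -{2}[l]add0n big_addn addKn; apply: leq_sum => j _.
have -> : (a0 + (i + k)%N%:Z) - w * (b0 + (j + l)%N%:Z) - c
  = (a0 + k%:Z + i%:Z) - w * (b0 + l%:Z + j%:Z) - c by rewrite !PoszD; ring.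
exact: leqnn.
Qed.

Lemma box_count_total p w (a0 b0 : int) (a b : nat) : (0 < p)%N ->
  (\sum_(0 <= c < p) box_count p w c%:Z a0 b0 a b = a * b)%N.
Proof.
move=> p0; rewrite exchange_big /=.
transitivity (\sum_(0 <= i < a) b)%N; last by rewrite sum_nat_const_nat subn0.
apply: eq_bigr => i _; rewrite exchange_big /=.
transitivity (\sum_(0 <= j < b) 1)%N; last by rewrite sum_nat_const_nat subn0 muln1.
apply: eq_bigr => j _; set t := _ - _.
have pz : (p%:Z != 0) by lia.
have h1 := modz_ge0 t pz; have h2 := ltz_pmod t (d := p%:Z).
have ht : (absz (t %% p)%Z < p)%N by lia.
rewrite (@big_cat_nat _ _ _ (absz (t %% p)%Z)) //=; last exact: ltnW.
rewrite [X in (_ + X)%N]big_ltn //= big1_seq; last first.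
  move=> c; rewrite mem_index_iota => /andP[_ /andP[_ hc]].
  by rewrite -eqz_mod_dvd [(c%:Z %% p)%Z]modz_small; lia.
rewrite [X in (_ + (_ + X))%N]big1_seq; last first.
  move=> c; rewrite mem_index_iota => /andP[_ /andP[hc1 hc2]].
  by rewrite -eqz_mod_dvd [(c%:Z %% p)%Z]modz_small; lia.
by rewrite -eqz_mod_dvd gez0_abs // modz_mod eqxx.
Qed.

(** A translation of size at most L carries any coset to any other, so the p cosets have nearly
    equal counts in the box, while their total is known exactly. Moving the boundary by L gives the
    error. *)
Lemma lattice_count (p L : nat) (w c a0 b0 : int) (a b : nat) : (0 < p)%N ->
  (forall c : int, exists x y : int,
    [/\ (`|x| <= L)%N, (`|y| <= L)%N & (p %| x - w * y - c)%Z]) ->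
  (p * box_count p w c a0 b0 a b <= (a + L.*2) * (b + L.*2))%N /\
  (a * b <= p * box_count p w c a0 b0 a b + L.*2 * (a + b))%N.
Proof.
move=> p0 hL.
have shift (d d' u0 v0 : int) (k l : nat) :
  (box_count p w d u0 v0 k l
   <= box_count p w d' (u0 - L%:Z) (v0 - L%:Z) (k + L.*2) (l + L.*2))%N.
  have [x [y [xL yL hxy]]] := hL (d' - d).
  have -> : box_count p w d u0 v0 k l = box_count p w d' (u0 + x) (v0 + y) k l.
    apply: eq_bigr => i _; apply: eq_bigr => j _; congr nat_of_bool.
    have -> : u0 + x + i%:Z - w * (v0 + y + j%:Z) - d'
      = (u0 + i%:Z - w * (v0 + j%:Z) - d) + (x - w * y - (d' - d)) by ring.
    by rewrite (rpredDr _ hxy).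
  have := @box_count_mono p w d' (u0 - L%:Z) (v0 - L%:Z) k l
    (absz (x + L%:Z)%R) (absz (y + L%:Z)%R) (absz (L%:Z - x)%R) (absz (L%:Z - y)%R).
  have -> : u0 - L%:Z + (absz (x + L%:Z)%R)%:Z = u0 + x by lia.
  have -> : v0 - L%:Z + (absz (y + L%:Z)%R)%:Z = v0 + y by lia.
  have -> : (absz (x + L%:Z)%R + k + absz (L%:Z - x)%R = k + L.*2)%N by lia.
  by have -> : (absz (y + L%:Z)%R + l + absz (L%:Z - y)%R = l + L.*2)%N by lia.
split.
  rewrite -(box_count_total w (a0 - L%:Z) (b0 - L%:Z) (a + L.*2) (b + L.*2) p0).
  have -> : (p * box_count p w c a0 b0 a b = \sum_(0 <= c' < p) box_count p w c a0 b0 a b)%N.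
    by rewrite sum_nat_const_nat subn0.
  by apply: leq_sum => c' _; apply: shift.
case: (leqP (L.*2) a) => ha; last by nia.
case: (leqP (L.*2) b) => hb; last by nia.
have : ((a - L.*2) * (b - L.*2) <= p * box_count p w c a0 b0 a b)%N.
  rewrite -(box_count_total w (a0 + L%:Z) (b0 + L%:Z) (a - L.*2) (b - L.*2) p0).
  have -> : (p * box_count p w c a0 b0 a b = \sum_(0 <= c' < p) box_count p w c a0 b0 a b)%N.
    by rewrite sum_nat_const_nat subn0.
  apply: leq_sum => c' _; apply: leq_trans (shift _ c _ _ _ _) _.
  by rewrite !addrK !subnK.
nia.
Qed.

End LatticeCount.

(** * Split primes and the values of the norm form *)

Section NormForm.

Lemma count_congruent_le (P : pred nat) (a n q : nat) : 0 < q ->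
  (forall i i', a <= i < a + n -> a <= i' < a + n -> P i -> P i' ->
     (q%:Z %| (i%:Z - i'%:Z)%R)%Z) ->
  count P (index_iota a (a + n)) <= n %/ q + 1.
Proof.
move=> q0 hP; rewrite -size_filter -(size_map (fun i => (i - a) %/ q)).
rewrite -[leqRHS](size_iota 0); apply: uniq_leq_size.
  rewrite map_inj_in_uniq; first exact/filter_uniq/iota_uniq.
  move=> i i'; rewrite !mem_filter !mem_index_iota => /andP[Pi hi] /andP[Pi' hi'] e.
  have := hP _ _ hi hi' Pi Pi'.
  have := divn_eq (i - a) q; have := divn_eq (i' - a) q; rewrite e.
  have := ltn_pmod (i - a) q0; have := ltn_pmod (i' - a) q0.
  move: ((i - a) %% q) ((i' - a) %% q) ((i' - a) %/ q * q) => u v w hv hu e1 e2.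
  move=> /dvdzP[t et]; have : t = 0; last by nia.
  nia.
move=> u /mapP[i]; rewrite mem_filter mem_index_iota => /andP[_ hi] ->.
rewrite mem_iota /= add0n addn1 ltnS leq_div2r //; lia.
Qed.

(** Fix one solution i0. Every other solution is congruent either to i0 or to its mirror image, and
    each class is counted by [count_congruent_le]. *)
Lemma count_congruent2_le (P : pred nat) (a n q m : nat) (c : int) : 0 < q -> coprime q m ->
  (forall i i', a <= i < a + n -> a <= i' < a + n -> P i -> P i' ->
     (q%:Z %| (i%:Z - i'%:Z)%R)%Z \/ (q%:Z %| (m%:Z * (i%:Z + i'%:Z) + c)%R)%Z) ->
  count P (index_iota a (a + n)) <= 2 * (n %/ q + 1).
Proof.
move=> q0 qm hP.
case: (boolP (has P (index_iota a (a + n)))) => [/hasP[i0]|]; last first.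
  by rewrite has_count -leqNgt leqn0 => /eqP ->.
rewrite mem_index_iota => hi0 Pi0.
pose Q i := (q%:Z %| (i%:Z - i0%:Z)%R)%Z.
rewrite -size_filter -(count_predC Q) !count_filter.
rewrite mul2n -addnn; apply: leq_add; apply: count_congruent_le => // i i' hi hi' /andP[Qi Pi] /andP[Qi' Pi'].
  have -> : (i%:Z - i'%:Z = (i%:Z - i0%:Z) - (i'%:Z - i0%:Z))%R by ring.
  by rewrite rpredB.
have h1 : (q%:Z %| (m%:Z * (i%:Z + i0%:Z) + c)%R)%Z.
  by case: (hP i i0 hi hi0 Pi Pi0) => // h; rewrite /= /Q h in Qi.
have h2 : (q%:Z %| (m%:Z * (i'%:Z + i0%:Z) + c)%R)%Z.
  by case: (hP i' i0 hi' hi0 Pi' Pi0) => // h; rewrite /= /Q h in Qi'.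
have : (q%:Z %| (m%:Z * (i%:Z - i'%:Z))%R)%Z.
  have -> : (m%:Z * (i%:Z - i'%:Z) = (m%:Z * (i%:Z + i0%:Z) + c) - (m%:Z * (i'%:Z + i0%:Z) + c))%R by ring.
  by rewrite rpredB.
by rewrite Gauss_dvdzr.
Qed.

Lemma coprime_div_gcdn z y : 0 < y -> coprime (z %/ gcdn z y) (y %/ gcdn z y).
Proof.
move=> y0; have g0 : 0 < gcdn z y by rewrite gcdn_gt0 y0 orbT.
rewrite /coprime -(eqn_pmul2r g0) mul1n muln_gcdl.
by rewrite !divnK ?dvdn_gcdl ?dvdn_gcdr.
Qed.

Variables (E m : nat).
Hypothesis E1 : 1 < E.
Hypothesis Em : 2 * E %| m.
Hypothesis m0 : 0 < m.

Local Open Scope ring_scope.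

(** As m is a multiple of 2 E, the prime 2 and the ramified primes are excluded; enlarging m
    discards finitely many further primes. *)
Definition split_prime (p : nat) : bool :=
  [&& prime p, ~~ (p %| m)%N & [exists w : 'I_p, (p%:Z %| (w : nat)%:Z ^+ 2 - E%:Z)%Z]].

(** The value 0 is a default for moduli without a root. *)
Definition root_mod (p : nat) : int :=
  if [pick w : 'I_p | (p%:Z %| (w : nat)%:Z ^+ 2 - E%:Z)%Z] is Some w then (w : nat)%:Z else 0.

Lemma split_prime_prime : {subset split_prime <= prime}.
Proof. by move=> p /and3P[]. Qed.

Lemma root_modP p : split_prime p -> (p%:Z %| root_mod p ^+ 2 - E%:Z)%Z.
Proof.
case/and3P=> _ _ /existsP[w hw]; rewrite /root_mod; case: pickP => [//|/(_ w)].
by rewrite hw.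
Qed.

Lemma split_prime_ndvd2 p : split_prime p -> ~~ (p %| 2)%N.
Proof.
case/and3P=> pp + _; apply: contra => p2; apply: dvdn_trans Em.
exact: dvdn_mulr.
Qed.

Lemma split_prime_ndvdE p : split_prime p -> ~~ (p %| E)%N.
Proof.
case/and3P=> pp + _; apply: contra => p2; apply: dvdn_trans Em.
exact: dvdn_mull.
Qed.

Lemma Euclid_dvdzM p (a b : int) : prime p -> (p%:Z %| a * b)%Z = (p%:Z %| a)%Z || (p%:Z %| b)%Z.
Proof. by move=> pp; rewrite !dvdzE abszM /= Euclid_dvdM. Qed.

(** The quotient z / y modulo p is a square root of E. *)
Lemma split_prime_of_dvd p (z y : int) : prime p -> ~~ (p %| m)%N -> ~~ (p%:Z %| y)%Z ->
  (p%:Z %| z ^+ 2 - E%:Z * y ^+ 2)%Z -> split_prime p.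
Proof.
move=> pp pm py h; rewrite /split_prime pp pm /=.
have cop : coprimez p y by rewrite coprimezE prime_coprime.
have /coprimezP[[u v] /= uv] := cop.
have pz : p%:Z != 0 by have := prime_gt0 pp; lia.
have h1 := modz_ge0 (z * v) pz; have h2 := ltz_pmod (z * v) (d := p%:Z).
have hw : (absz (z * v %% p)%Z < p)%N.
  by rewrite -ltz_nat gez0_abs // ltz_pmod // ltz_nat prime_gt0.
apply/existsP; exists (Ordinal hw) => /=; rewrite gez0_abs //.
have e := divz_eq (z * v) p.
set w := (_ %% _)%Z in e *; set k := (_ %/ _)%Z in e.
have -> : w = z * v - k * p by rewrite e; ring.
(* The last summand is isolated because it vanishes by the Bezout relation u p + v y = 1. *)
have -> : (z * v - k * p%:Z) ^+ 2 - E%:Z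
  = v ^+ 2 * (z ^+ 2 - E%:Z * y ^+ 2) + p%:Z * (- 2 * z * v * k + k ^+ 2 * p%:Z
      - E%:Z * u * (1 + v * y)) + E%:Z * ((u * p%:Z + v * y) * (1 + v * y) - 1 - v * y).
  by ring.
have -> : (u * p%:Z + v * y) * (1 + v * y) - 1 - v * y = 0 by rewrite uv; ring.
by rewrite mulr0 addr0; apply: rpredD; [apply: dvdz_mull | apply: dvdz_mulr].
Qed.

(** Counts the lines z = w y and z = -w y modulo p through the point. It is a sum of indicators of
    two lattices, so lattice point counts apply to it directly. *)
Definition hits (p : nat) (z y : int) : nat :=
  ((p%:Z %| (z - root_mod p * y)%R)%Z + (p%:Z %| (z + root_mod p * y)%R)%Z)%N.

(** A point on both lines has p dividing 2 z and 2 w y, hence z and y. *)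
Lemma hits_le p (z y : nat) : split_prime p ->
  (hits p z y <= (p%:Z %| (z%:Z ^+ 2 - E%:Z * y%:Z ^+ 2)%R)%Z + (p %| gcdn z y)%N)%N.
Proof.
move=> hp; have hr := root_modP hp; have /and3P[pp pm _] := hp.
rewrite /hits; set r := root_mod p in hr *.
have e : (p%:Z %| z%:Z ^+ 2 - E%:Z * y%:Z ^+ 2)%Z
  = (p%:Z %| z%:Z - r * y%:Z)%Z || (p%:Z %| z%:Z + r * y%:Z)%Z.
  rewrite -Euclid_dvdzM //.
  have -> : z%:Z ^+ 2 - E%:Z * y%:Z ^+ 2
    = (z%:Z - r * y%:Z) * (z%:Z + r * y%:Z) + y%:Z ^+ 2 * (r ^+ 2 - E%:Z) by ring.
  by apply: rpredDr; apply: dvdz_mull.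
rewrite e; case h1 : (_ %| z%:Z - _)%Z; case h2 : (_ %| z%:Z + _)%Z => //=.
rewrite (_ : (p %| gcdn z y)%N) // dvdn_gcd.
have h3 : (p%:Z %| 2 * z%:Z)%Z.
  have -> : 2 * z%:Z = (z%:Z - r * y%:Z) + (z%:Z + r * y%:Z) by ring.
  by rewrite rpredD.
have h4 : (p%:Z %| 2 * (r * y%:Z))%Z.
  have -> : 2 * (r * y%:Z) = (z%:Z + r * y%:Z) - (z%:Z - r * y%:Z) by ring.
  by rewrite rpredB.
have p2 : (p%:Z %| 2)%Z = false by apply/negbTE; apply: (split_prime_ndvd2 hp).
rewrite !Euclid_dvdzM // p2 /= in h3 h4.
have pr : (p%:Z %| r)%Z = false.
  apply/negbTE; apply: contra (split_prime_ndvdE hp) => pr.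
  have : (p%:Z %| r ^+ 2 - (r ^+ 2 - E%:Z))%Z by apply: rpredB => //; rewrite expr2; apply: dvdz_mull.
  by rewrite opprB addrC subrK.
by rewrite pr /= in h4; apply/andP.
Qed.

Lemma hits_gt0 p (z y : nat) : split_prime p ->
  (p%:Z %| z%:Z ^+ 2 - E%:Z * y%:Z ^+ 2)%Z -> (0 < hits p z y)%N.
Proof.
move=> hp; have hr := root_modP hp; have /and3P[pp pm _] := hp.
have -> : z%:Z ^+ 2 - E%:Z * y%:Z ^+ 2
    = (z%:Z - root_mod p * y%:Z) * (z%:Z + root_mod p * y%:Z)
      + y%:Z ^+ 2 * (root_mod p ^+ 2 - E%:Z) by ring.
rewrite rpredDr; last exact: dvdz_mull.
rewrite Euclid_dvdzM // /hits.
by case/orP => ->; rewrite ?addn1.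
Qed.

(* The two congruences z1 = +-z2 survive although the common factors of (z1, y)
   and (z2, y) may differ, because p divides neither cofactor of y. *)
Lemma two_roots p k (z1 z2 y : nat) : split_prime p -> (0 < k)%N -> (0 < y)%N ->
  ((p ^ k)%:Z %| (z1 %/ gcdn z1 y)%:Z ^+ 2 - E%:Z * (y %/ gcdn z1 y)%:Z ^+ 2)%Z ->
  ((p ^ k)%:Z %| (z2 %/ gcdn z2 y)%:Z ^+ 2 - E%:Z * (y %/ gcdn z2 y)%:Z ^+ 2)%Z ->
  ((p ^ k)%:Z %| z1%:Z - z2%:Z)%Z \/ ((p ^ k)%:Z %| z1%:Z + z2%:Z)%Z.
Proof.
move=> hp k0 y0; have /and3P[pp pm _] := hp.
have aux z : ((p ^ k)%:Z %| (z %/ gcdn z y)%:Z ^+ 2 - E%:Z * (y %/ gcdn z y)%:Z ^+ 2)%Z ->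
   ~~ (p %| z %/ gcdn z y)%N /\ ~~ (p %| y %/ gcdn z y)%N.
  set g := gcdn z y; have g0 : (0 < g)%N by rewrite gcdn_gt0 y0 orbT.
  have cop : coprime (z %/ g) (y %/ g) by apply: coprime_div_gcdn.
  move=> h.
  have h' : (p%:Z %| (z %/ g)%:Z ^+ 2 - E%:Z * (y %/ g)%:Z ^+ 2)%Z.
    by apply: dvdz_trans h; rewrite dvdzE /= dvdn_exp.
  have npy : ~~ (p %| y %/ g)%N.
    apply/negP => py; have : (p %| z %/ g)%N.
      have : (p%:Z %| (z %/ g)%:Z ^+ 2)%Z.
        rewrite -(subrK (E%:Z * (y %/ g)%:Z ^+ 2) (_ ^+ 2)); apply: rpredD => //.
        by rewrite expr2; do 2!apply: dvdz_mull.
      by rewrite expr2 Euclid_dvdzM // orbb.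
    move=> pz; have : (p %| 1)%N by rewrite -(eqP cop) dvdn_gcd pz.
    by rewrite Euclid_dvd1.
  split=> //; apply/negP => pz.
  have : (p%:Z %| E%:Z * (y %/ g)%:Z ^+ 2)%Z.
    have -> : E%:Z * (y %/ g)%:Z ^+ 2 =
      (z %/ g)%:Z ^+ 2 - ((z %/ g)%:Z ^+ 2 - E%:Z * (y %/ g)%:Z ^+ 2) by ring.
    by apply: rpredB => //; rewrite expr2; apply: dvdz_mull.
  rewrite expr2 !Euclid_dvdzM // orbb !dvdzE /=.
  by rewrite (negbTE (split_prime_ndvdE hp)) (negbTE npy).
move=> h1 h2; have [nu1 ny1] := aux _ h1; have [nu2 ny2] := aux _ h2.
set g1 := gcdn z1 y in h1 nu1 ny1; set g2 := gcdn z2 y in h2 nu2 ny2.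
set u1 := (z1 %/ g1)%N in h1 nu1; set u2 := (z2 %/ g2)%N in h2 nu2.
set y1 := (y %/ g1)%N in h1 ny1; set y2 := (y %/ g2)%N in h2 ny2.
have ez1 : z1 = (u1 * g1)%N by rewrite divnK ?dvdn_gcdl.
have ez2 : z2 = (u2 * g2)%N by rewrite divnK ?dvdn_gcdl.
have ey1 : y = (y1 * g1)%N by rewrite divnK ?dvdn_gcdr.
have ey2 : y = (y2 * g2)%N by rewrite divnK ?dvdn_gcdr.
have key (s : int) : ((p ^ k)%:Z %| u1%:Z * y2%:Z + s * (u2%:Z * y1%:Z))%Z ->
    ((p ^ k)%:Z %| z1%:Z + s * z2%:Z)%Z.
  move=> h; have : ((p ^ k)%:Z %| y2%:Z * (z1%:Z + s * z2%:Z))%Z.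
    have -> : y2%:Z * (z1%:Z + s * z2%:Z)
        = g1%:Z * (u1%:Z * y2%:Z + s * (u2%:Z * y1%:Z)).
      have e : y2%:Z * g2%:Z = y1%:Z * g1%:Z by rewrite -!PoszM -ey1 -ey2.
      rewrite {1}ez1 {1}ez2 !PoszM.
      transitivity (y2%:Z * (u1%:Z * g1%:Z) + s * u2%:Z * (y2%:Z * g2%:Z)); first by ring.
      by rewrite e; ring.
    by rewrite dvdz_mull.
  rewrite Gauss_dvdzr // coprimezE coprimeXl //.
  by rewrite prime_coprime.
have hprod : ((p ^ k)%:Z %| (u1%:Z * y2%:Z - u2%:Z * y1%:Z) * (u1%:Z * y2%:Z + u2%:Z * y1%:Z))%Z.
  have -> : (u1%:Z * y2%:Z - u2%:Z * y1%:Z) * (u1%:Z * y2%:Z + u2%:Z * y1%:Z)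
    = y2%:Z ^+ 2 * (u1%:Z ^+ 2 - E%:Z * y1%:Z ^+ 2)
      - y1%:Z ^+ 2 * (u2%:Z ^+ 2 - E%:Z * y2%:Z ^+ 2) by ring.
  by apply: rpredB; apply: dvdz_mull.
case: (boolP (p%:Z %| u1%:Z * y2%:Z - u2%:Z * y1%:Z)%Z) => pa; last first.
  right; have := key 1; rewrite !mul1r; apply.
  move: hprod; rewrite Gauss_dvdzr // coprimezE coprimeXl //.
  by rewrite prime_coprime.
left; have := key (-1); rewrite !mulN1r; apply.
move: hprod; rewrite Gauss_dvdzl // coprimezE coprimeXl // prime_coprime //.
apply/negP => pb.
have : (p%:Z %| 2 * (u1%:Z * y2%:Z))%Z.
  have -> : 2 * (u1%:Z * y2%:Z) = (u1%:Z * y2%:Z - u2%:Z * y1%:Z) + (u1%:Z * y2%:Z + u2%:Z * y1%:Z) by ring.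
  by rewrite rpredD.
rewrite !Euclid_dvdzM // !dvdzE /=.
by rewrite (negbTE (split_prime_ndvd2 hp)) (negbTE nu1) (negbTE ny2).
Qed.

End NormForm.

(** * Size and factorization of the norm form on a box *)

Section NormValues.
Variable R : realType.
Variables (E m : nat).
Hypothesis E1 : 1 < E.
Hypothesis Em : 2 * E %| m.
Hypothesis m0 : 0 < m.

(* z = 1 and y = 0 modulo m keep the values of z^2 - E y^2 prime to m. *)
Definition zbox N i := 1 + m * (E * N + i).
Definition ybox j := m * j.+1.
Definition nform z y := z ^ 2 - E * y ^ 2.
Definition nform_prim z y := nform (z %/ gcdn z y) (y %/ gcdn z y).

(** The offset E N in [zbox] gives z >= E m N while y <= m N. As E >= 2, z^2 is at least 2 E y^2,
    and for fixed E and m the values have exact order N^2. *)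
Lemma nform_bounds N i j : i < E * N -> j < N ->
  [/\ E * ybox j ^ 2 <= zbox N i ^ 2, N ^ 2 <= nform (zbox N i) (ybox j)
    & nform (zbox N i) (ybox j) <= (3 * m * E * N) ^ 2].
Proof.
move=> hi hj; rewrite /nform /zbox /ybox.
have h1 : m * j.+1 <= m * N by rewrite leq_mul2l hj orbT.
have h2 : E * (m * N) <= 1 + m * (E * N + i) by nia.
have h3 : 1 + m * (E * N + i) <= 3 * m * E * N by nia.
have h4 : (E * (m * N)) ^ 2 <= (1 + m * (E * N + i)) ^ 2 by rewrite leq_sqr.
have h5 : E * (m * j.+1) ^ 2 <= E * (m * N) ^ 2 by rewrite leq_mul2l leq_sqr h1 orbT.
have h6 : N ^ 2 <= (m * N) ^ 2 by rewrite leq_sqr leq_pmull.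
have h7 : (1 + m * (E * N + i)) ^ 2 <= (3 * m * E * N) ^ 2 by rewrite leq_sqr.
move: h4 h5 h6 h7; rewrite expnMn; move: ((m * N) ^ 2) (N ^ 2) ((m * j.+1) ^ 2) ((1 + _) ^ 2) => a b c d.
move=> h4 h5 h6 h7.
have h8 : 2 * (E * a) <= E ^ 2 * a by rewrite mulnA leq_mul2r expnS expn1 leq_mul2r E1 !orbT.
have h9 : a <= E * a by rewrite leq_pmull //; lia.
by clear -h4 h5 h6 h7 h8 h9; split; lia.
Qed.

Lemma nformE z y : E * y ^ 2 <= z ^ 2 ->
  ((nform z y)%:Z = z%:Z ^+ 2 - E%:Z * y%:Z ^+ 2)%R.
Proof. by move=> h; rewrite /nform -subzn // PoszM -!rmorphXn. Qed.

Lemma nform_gcd z y : nform z y = gcdn z y ^ 2 * nform_prim z y.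
Proof.
rewrite /nform_prim /nform mulnBr mulnCA -!expnMn.
by rewrite ![gcdn z y * _]mulnC !divnK ?dvdn_gcdl ?dvdn_gcdr.
Qed.

Lemma nform_prim_bounds z y : 0 < nform z y ->
  0 < nform_prim z y <= nform z y.
Proof.
move=> h; have := nform_gcd z y; move: h; case: (nform_prim z y) => [|k]; first by lia.
move=> h e; rewrite e /= leq_pmull //; move: h; rewrite e; case: (gcdn z y) => //.
Qed.

Lemma nform_primE z y : E * y ^ 2 <= z ^ 2 -> 0 < y ->
  ((nform_prim z y)%:Z = (z %/ gcdn z y)%:Z ^+ 2 - E%:Z * (y %/ gcdn z y)%:Z ^+ 2)%R.
Proof.
move=> h y0; apply: nformE.
have g0 : 0 < gcdn z y by rewrite gcdn_gt0 y0 orbT.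
rewrite -(@leq_pmul2l (gcdn z y ^ 2)) ?expn_gt0 ?g0 // mulnCA -!expnMn.
by rewrite ![gcdn z y * _]mulnC !divnK ?dvdn_gcdl ?dvdn_gcdr.
Qed.

Local Open Scope ring_scope.
Notation lnn n := (ln (n%:R : R)).
Notation S := (split_prime E m).
Notation hits := (hits E).

(** By [hits_le] a second hit is paid for by the gcd, and distinct primes dividing an integer
    contribute at most its logarithm. *)
Lemma sum_hits_le n z y : (E * y ^ 2 <= z ^ 2)%N -> (0 < nform z y)%N -> (0 < y)%N ->
  \sum_(0 <= p < n.+1 | S p) (hits p z y)%:R * lnn p <= lnn (nform z y) + lnn (gcdn z y).
Proof.
move=> zy F0 y0.
have g0 : (0 < gcdn z y)%N by rewrite gcdn_gt0 y0 orbT.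
apply: (@le_trans _ _ (\sum_(0 <= p < n.+1 | S p && (p %| nform z y)%N) lnn p
   + \sum_(0 <= p < n.+1 | S p && (p %| gcdn z y)%N) lnn p)).
  rewrite [X in _ <= X + _]big_mkcondr [X in _ <= _ + X]big_mkcondr -big_split /=.
  apply: ler_sum => p hp.
  have := hits_le Em z y hp; rewrite -(nformE zy) dvdzE /=.
  have := lnn_ge0 R p.
  move: (hits _ _ _) => h l0; rewrite -(ler_nat R) natrD => hh.
  apply: (@le_trans _ _ ((((p %| nform z y)%N : nat)%:R + ((p %| gcdn z y)%N : nat)%:R) * lnn p)).
    exact: ler_wpM2r.
  by rewrite mulrDl; apply: lerD; case: ifP => _; rewrite ?mul1r ?mul0r.
by apply: lerD; apply: sum_ln_dvd_le => //; rewrite ?iota_uniq // => p _ /andP[/and3P[]].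
Qed.

(** An exponent a in the primitive value is split as 1 + (a - 1): the 1 is seen by [hits], the rest
    is the error from higher powers. Only split primes occur, since a prime dividing m divides y but
    not z, and z and y are coprime after division by their gcd. *)
Lemma ln_nform_le n z y : (E * y ^ 2 <= z ^ 2)%N -> (0 < nform z y)%N -> (0 < y)%N ->
  coprime m z -> (m %| y)%N -> (nform z y <= n)%N ->
  lnn (nform z y) <= 2 * lnn (gcdn z y) +
    (\sum_(0 <= p < n.+1 | S p) (hits p z y)%:R * lnn p
     + \sum_(0 <= p < n.+1 | S p) ((logn p (nform_prim z y)).-1)%:R * lnn p).
Proof.
move=> zy F0 y0 cop my Fn.
have g0 : (0 < gcdn z y)%N by rewrite gcdn_gt0 y0 orbT.
have /andP[F'0 F'F] := nform_prim_bounds F0.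
rewrite {1}nform_gcd lnnM ?expn_gt0 ?g0 // lnnX //; apply: lerD => //.
rewrite (@lnn_logn R _ n) //; last exact: leq_trans F'F Fn.
rewrite -big_split /= big_mkcond [leRHS]big_mkcond; apply: ler_sum => p _.
have l0 := lnn_ge0 R p.
have rhs0 : 0 <= (hits p z y)%:R * lnn p + ((logn p (nform_prim z y)).-1)%:R * lnn p.
  by rewrite addr_ge0 // mulr_ge0.
case: ifP => pp; last by case: ifP.
have [l|l] := posnP (logn p (nform_prim z y)); first by move: rhs0; rewrite l (mul0r (lnn p)) addr0; case: ifP.
have pF' : (p %| nform_prim z y)%N by move: l; rewrite logn_gt0 mem_primes => /and3P[].
have pF : (p %| nform z y)%N by rewrite nform_gcd dvdn_mull.
have pF'' : (p%:Z %| z%:Z ^+ 2 - E%:Z * y%:Z ^+ 2)%Z by rewrite -nformE.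
have Sp : S p.
  have npm : ~~ (p %| m)%N.
    apply/negP => pm.
    have pz : (p%:Z %| z%:Z ^+ 2)%Z.
      rewrite -(subrK (E%:Z * y%:Z ^+ 2) (_ ^+ 2)); apply: rpredD => //.
      by rewrite expr2; do 2!apply: dvdz_mull; rewrite dvdzE /= (dvdn_trans pm my).
    rewrite expr2 Euclid_dvdzM // orbb dvdzE /= in pz.
    have : (p %| 1)%N by rewrite -(eqP cop) dvdn_gcd pm.
    by rewrite Euclid_dvd1.
  have pFi : (p%:Z %| (z %/ gcdn z y)%:Z ^+ 2 - E%:Z * (y %/ gcdn z y)%:Z ^+ 2)%Z.
    by rewrite -nform_primE.
  apply: (split_prime_of_dvd E1 Em m0 pp npm _ pFi); apply/negP => py.
  have pz : (p%:Z %| (z %/ gcdn z y)%:Z ^+ 2)%Z.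
    rewrite -(subrK (E%:Z * (y %/ gcdn z y)%:Z ^+ 2) (_ ^+ 2)); apply: rpredD => //.
    by rewrite expr2; do 2!apply: dvdz_mull.
  rewrite expr2 Euclid_dvdzM // orbb dvdzE /= in pz; rewrite dvdzE /= in py.
  have : (p %| 1)%N by rewrite -(eqP (coprime_div_gcdn z y0)) dvdn_gcd pz.
  by rewrite Euclid_dvd1.
rewrite Sp -mulrDl; apply: ler_wpM2r => //; rewrite -natrD ler_nat.
move: l (hits_gt0 Sp pF''); move: (logn _ _) (hits _ _ _) => [//|a] b _ b0.
by rewrite -add1n leq_add2r.
Qed.

Lemma zbox_coprime N i : coprime m (zbox N i).
Proof. by rewrite /zbox /coprime addnC mulnC gcdnMDl gcdn1. Qed.

Lemma ybox_gt0 j : (0 < ybox j)%N.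
Proof. by rewrite muln_gt0 m0. Qed.

Lemma zbox_diff N i i' : (zbox N i)%:Z - (zbox N i')%:Z = m%:Z * (i%:Z - i'%:Z).
Proof. by rewrite /zbox !PoszD !PoszM !PoszD; ring. Qed.

Lemma zbox_sum N i i' :
  (zbox N i)%:Z + (zbox N i')%:Z = m%:Z * (i%:Z + i'%:Z) + (2 + 2 * m%:Z * (E * N)%:Z).
Proof. by rewrite /zbox !PoszD !PoszM !PoszD; ring. Qed.

Lemma sum_bool_count (I : Type) (r : seq I) (P : pred I) :
  (\sum_(i <- r) (P i : nat) = count P r)%N.
Proof. by rewrite -sum1_count [RHS]big_mkcond; apply: eq_bigr => i _; case: (P i). Qed.

(** The logarithm of the gcd is at most the sum of ln d over the common divisors d. These are prime
    to m, so d divides both coordinates for O(N^2/d^2) points, and the sum of ln d / d^2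
    converges. *)
Lemma sum_ln_gcd_le N : (0 < N)%N ->
  \sum_(0 <= i < E * N) \sum_(0 <= j < N) lnn (gcdn (zbox N i) (ybox j))
  <= (4 * E.+1 * N ^ 2)%:R.
Proof.
move=> N0.
have N0' : 0 < N%:R :> R by rewrite ltr0n.
pose g i j d := (d %| zbox N i)%N && (d %| j.+1)%N.
apply: (@le_trans _ _ (\sum_(0 <= i < E * N) \sum_(0 <= j < N)
    \sum_(0 <= d < N.+1 | g i j d) lnn d)).
  apply: ler_sum => i _; rewrite big_nat [leRHS]big_nat; apply: ler_sum => j /andP[_ hj].
  set d := gcdn _ _; have dz : (d %| zbox N i)%N by apply: dvdn_gcdl.
  have cmd : coprime d m by rewrite coprime_sym; apply: coprime_dvdr dz (zbox_coprime _ _).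
  have dj : (d %| j.+1)%N by rewrite -(Gauss_dvdr _ cmd) dvdn_gcdr.
  apply: (@ler_sum_mem R _ _ _ (fun d => lnn d)) => [k _ _||]; first exact: lnn_ge0.
    by rewrite mem_index_iota ltnS (leq_trans (dvdn_leq _ dj)).
  by rewrite /g dz dj.
under eq_bigr => i _ do under eq_bigr => j _ do rewrite big_mkcond.
under eq_bigr => i _ do rewrite exchange_big /=.
rewrite exchange_big /=.
apply: (@le_trans _ _ (\sum_(0 <= d < N.+1) (2 * E.+1 * N ^ 2)%:R * (lnn d / d%:R ^+ 2))); last first.
  rewrite -mulr_sumr; apply: (@le_trans _ _ ((2 * E.+1 * N ^ 2)%:R * 2)).
    by apply: ler_wpM2l => //; apply: sum_ln_div_sqr_le.
  by rewrite -natrM ler_nat; lia.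
rewrite big_nat [leRHS]big_nat; apply: ler_sum => d /andP[_]; rewrite ltnS => dN.
have [->|d0] := posnP d.
  rewrite ln0 // mul0r mulr0; apply: sumr_le0 => i _; apply: sumr_le0 => j _.
  exact: lexx.
have d0' : 0 < d%:R :> R by rewrite ltr0n.
have dN' : d%:R <= N%:R :> R by rewrite ler_nat.
apply: (@le_trans _ _ (((E * N) %/ d + 1)%:R * (N %/ d + 1)%:R * lnn d)); last first.
  rewrite [leRHS]mulrA [leRHS]mulrAC.
  apply: ler_wpM2r; first exact: lnn_ge0.
  have -> : (2 * E.+1 * N ^ 2)%:R = 2 * (E%:R + 1) * N%:R ^+ 2 :> R.
    by rewrite 2!natrM natrX -[E.+1%:R]natr1.
  rewrite ler_pdivlMr ?exprn_gt0 // [d%:R ^+ 2]expr2.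
  rewrite [((E * N) %/ d + 1)%:R]natrD [(N %/ d + 1)%:R]natrD.
  have h1 : ((E * N) %/ d)%:R * d%:R <= E%:R * N%:R :> R.
    by rewrite -!natrM ler_nat leq_trunc_div.
  have h2 : (N %/ d)%:R * d%:R <= N%:R :> R by rewrite -natrM ler_nat leq_trunc_div.
  have h3 : (((E * N) %/ d)%:R + 1) * d%:R <= (E%:R + 1) * N%:R :> R by rewrite !mulrDl !mul1r lerD.
  have h4 : ((N %/ d)%:R + 1) * d%:R <= 2 * N%:R :> R by rewrite mulrDl mul1r; lra.
  have -> : 2 * (E%:R + 1) * N%:R ^+ 2 = ((E%:R + 1) * N%:R) * (2 * N%:R) :> R by ring.
  have -> : (((E * N) %/ d)%:R + 1) * ((N %/ d)%:R + 1) * (d%:R * d%:R)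
    = ((((E * N) %/ d)%:R + 1) * d%:R) * (((N %/ d)%:R + 1) * d%:R) :> R by ring.
  by apply: ler_pM => //; rewrite mulr_ge0 // addr_ge0.
have -> : \sum_(0 <= i < E * N) \sum_(0 <= j < N) (if g i j d then lnn d else 0)
   = (\sum_(0 <= i < E * N) ((d %| zbox N i) : nat))%N%:R
     * (\sum_(0 <= j < N) ((d %| j.+1) : nat))%N%:R * lnn d.
  rewrite !natr_sum big_distrl /= big_distrl /=; apply: eq_bigr => i _.
  rewrite big_distrr /= big_distrl /=; apply: eq_bigr => j _.
  by rewrite /g; do 2!case: (_ %| _)%N; rewrite ?mulr1 ?mul1r ?mulr0 ?mul0r.
apply: ler_wpM2r; first exact: lnn_ge0.
rewrite !sum_bool_count -!natrM ler_nat; apply: leq_mul.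
  case: (boolP (has (fun i => d %| zbox N i)%N (index_iota 0 (E * N)))) => [/hasP[i1 _ h1]|].
    apply: (@count_congruent_le _ 0 (E * N) d d0) => i i' _ _ hi hi'.
    have cmd : coprime d m by rewrite coprime_sym; apply: coprime_dvdr h1 (zbox_coprime _ _).
    rewrite -(@Gauss_dvdzr _ m%:Z) ?coprimezE // -(zbox_diff N).
    by apply: rpredB.
  by rewrite has_count -leqNgt leqn0 => /eqP ->.
apply: (@count_congruent_le _ 0 N d d0) => i i' _ _ hi hi'.
have -> : i%:Z - i'%:Z = (i.+1)%:Z - (i'.+1)%:Z by lia.
by apply: rpredB.
Qed.

End NormValues.

(** * Contribution of higher prime powers *)

Section NormMertens.
Variable R : realType.
Variables (E m : nat).
Hypothesis E1 : 1 < E.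
Hypothesis Em : 2 * E %| m.
Hypothesis m0 : 0 < m.

Local Open Scope ring_scope.
Notation lnn n := (ln (n%:R : R)).
Notation S := (split_prime E m).
Notation hits := (hits E).
Notation zbox := (zbox E m).
Notation ybox := (ybox m).
Notation nform := (nform E).
Notation nform_prim := (nform_prim E).

Lemma logn_pred_le p n K : prime p -> (0 < n)%N -> (logn p n <= K)%N ->
  ((logn p n).-1 <= \sum_(2 <= k < K.+1) (p ^ k %| n)%N)%N.
Proof.
move=> pp n0 lK; have [l1|l1] := leqP (logn p n) 1.
  by case: (logn p n) l1 => [|[|]].
rewrite (@big_cat_nat _ _ _ (logn p n).+1) //=; last exact: leqW.
apply: leq_trans (leq_addr _ _).
rewrite big_nat (eq_bigr (fun=> 1%N)) -?big_nat.
  by rewrite sum_nat_const_nat muln1; lia.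
by move=> k /andP[_ kl]; rewrite pfactor_dvdn //; move: kl; rewrite ltnS => ->.
Qed.

(** For fixed y, [two_roots] confines z to two classes modulo p^k, whatever its gcd with y. Powers
    beyond the [trunc_log] exceed every value of the form. *)
Lemma prime_power_count_le N j p : (j < N)%N -> S p ->
  (\sum_(0 <= i < E * N) (logn p (nform_prim (zbox N i) (ybox j))).-1
   <= \sum_(2 <= k < (trunc_log p ((3 * m * E * N) ^ 2)).+1) 2 * ((E * N) %/ p ^ k + 1))%N.
Proof.
move=> hj hp; have /and3P[pp pm _] := hp.
set K := trunc_log _ _.
apply: (@leq_trans (\sum_(0 <= i < E * N) \sum_(2 <= k < K.+1)
   (p ^ k %| nform_prim (zbox N i) (ybox j)))%N).
  rewrite big_nat [leqRHS]big_nat; apply: leq_sum => i /andP[_ hi].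
  have [h1 h2 h3] := nform_bounds E1 Em m0 hi hj.
  have F0 : (0 < nform (zbox N i) (ybox j))%N by apply: leq_trans h2; rewrite expn_gt0 (leq_ltn_trans _ hj).
  have /andP[F'0 F'F] := nform_prim_bounds E1 Em m0 F0.
  apply: logn_pred_le => //; apply: trunc_log_max; first exact: prime_gt1.
  by apply: leq_trans h3; apply: leq_trans F'F; rewrite dvdn_leq // pfactor_dvdnn.
rewrite exchange_big /= big_nat [leqRHS]big_nat; apply: leq_sum => k /andP[k2 _].
rewrite sum_bool_count.
have cop : coprime (p ^ k) m by rewrite coprimeXl // prime_coprime.
have y0 := ybox_gt0 m0 j.
apply: (@count_congruent2_le _ 0 (E * N) (p ^ k) m (2 + 2 * m%:Z * (E * N)%:Z)) => //.
  by rewrite expn_gt0 prime_gt0.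
move=> i i' hi hi' Pi Pi'.
have [h1 _ _] := nform_bounds E1 Em m0 (hi : (i < E * N)%N) hj.
have [h1' _ _] := nform_bounds E1 Em m0 (hi' : (i' < E * N)%N) hj.
have k0 : (0 < k)%N by lia.
have := @two_roots E m Em p k (zbox N i) (zbox N i') (ybox j) hp k0 y0.
rewrite -!nform_primE // => /(_ Pi Pi') [h|h]; [left|right].
  by rewrite -(@Gauss_dvdzr _ m%:Z) ?coprimezE // -(zbox_diff E m N).
by rewrite -(zbox_sum E m N).
Qed.

Lemma geometric_le p K : (1 < p)%N ->
  \sum_(2 <= k < K.+1) ((p ^ k)%:R)^-1 <= 2 / p%:R ^+ 2 :> R.
Proof.
move=> p1; have p0 : 0 < p%:R :> R by rewrite ltr0n; lia.
have xp : p%:R^-1 <= 2^-1 :> R by rewrite lef_pV2 ?posrE // ler_nat.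
have x0 : 0 <= p%:R^-1 :> R by rewrite invr_ge0 ltW.
have geo n : \sum_(0 <= k < n) p%:R^-1 ^+ k <= 2 :> R.
  elim: n => [|n IH]; first by rewrite big_geq.
  rewrite big_nat_recl // expr0.
  under eq_bigr => k _ do rewrite exprS.
  rewrite -mulr_sumr.
  have s0 : 0 <= \sum_(0 <= k < n) p%:R^-1 ^+ k :> R by apply: sumr_ge0 => k _; exact: exprn_ge0.
  have : p%:R^-1 * (\sum_(0 <= k < n) p%:R^-1 ^+ k) <= 2^-1 * 2 :> R by apply: ler_pM.
  lra.
case: K => [|K]; first by rewrite big_geq // divr_ge0 // exprn_ge0 // ltW.
rewrite -[2%N]add0n big_addn subn2 /=.
under eq_bigr => k _ do rewrite expnD natrM invfM natrX -exprVn.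
by rewrite -mulr_suml natrX; apply: ler_wpM2r; rewrite ?invr_ge0 ?exprn_ge0 // ltW.
Qed.

(** With B = 3 m E N, a square p^2 dividing a value forces p <= B. Each exponent k <= K then
    contributes 2 E N / p^k + 2, and K ln p <= 2 ln B. *)
Lemma prime_power_ln_le N j p : (j < N)%N -> S p ->
  \sum_(0 <= i < E * N) ((logn p (nform_prim (zbox N i) (ybox j))).-1)%:R * lnn p
  <= if (p <= 3 * m * E * N)%N then
       4 * (E * N)%:R * (lnn p / p%:R ^+ 2) + 4 * lnn (3 * m * E * N) else 0.
Proof.
move=> hj hp; have /and3P[pp pm _] := hp.
have p1 := prime_gt1 pp.
set B := (3 * m * E * N)%N.
have B0 : (0 < B)%N by rewrite /B !muln_gt0 m0; lia.
rewrite -mulr_suml -natr_sum.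
apply: (@le_trans _ _ ((\sum_(2 <= k < (trunc_log p (B ^ 2)).+1)
    2 * ((E * N) %/ p ^ k + 1))%N%:R * lnn p)).
  by apply: ler_wpM2r; rewrite ?lnn_ge0 // ler_nat; apply: prime_power_count_le.
set K := trunc_log p _.
have hK : (p ^ K <= B ^ 2)%N by apply: trunc_logP => //; rewrite expn_gt0 B0.
case: (leqP p B) => pB; last first.
  rewrite big_geq ?mul0r // ltnNge; apply/negP => K2.
  have h : (p ^ 2 <= B ^ 2)%N by apply: leq_trans hK; rewrite leq_exp2l.
  by move: h; rewrite leq_sqr leqNgt pB.
have hKl : K%:R * lnn p <= 2 * lnn B.
  rewrite -lnnX; last by lia.
  by rewrite -(lnnX R 2 B0); apply: ler_lnn.
have l0 := lnn_ge0 R p.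
have step : (\sum_(2 <= k < K.+1) 2 * ((E * N) %/ p ^ k + 1))%N%:R
   <= 2 * (E * N)%:R * (2 / p%:R ^+ 2) + 2 * K%:R :> R.
  apply: (@le_trans _ _ (\sum_(2 <= k < K.+1) (2 * (E * N)%:R * ((p ^ k)%:R)^-1 + 2))).
    rewrite natr_sum; apply: ler_sum => k _; rewrite natrM natrD mulrDr mulr1 lerD2r.
    rewrite -mulrA ler_wpM2l // ler_pdivlMr ?ltr0n ?expn_gt0 ?prime_gt0 //.
    by rewrite -natrM ler_nat leq_trunc_div.
  rewrite big_split /= -mulr_sumr; apply: lerD.
    by apply: ler_wpM2l; rewrite ?mulr_ge0 //; apply: geometric_le.
  rewrite sumr_const_nat -[leLHS]mulr_natr; apply: ler_wpM2l => //.
  by rewrite ler_nat; lia.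
apply: (le_trans (ler_wpM2r l0 step)).
rewrite mulrDl; apply: lerD; last by lra.
rewrite [leRHS]mulrA [leLHS]mulrC.
have -> : 2 * (E * N)%:R * (2 / p%:R ^+ 2) = 4 * (E * N)%:R * (p%:R ^+ 2)^-1 :> R by ring.
by rewrite mulrCA mulrA.
Qed.

(** The sum of ln p / p^2 converges, and ln B is added only for the primes p <= B, whose number
    times ln B is O(B) = O(N). *)
Lemma sum_prime_powers_le : exists C : R, forall N, (0 < N)%N ->
  \sum_(0 <= i < E * N) \sum_(0 <= j < N) \sum_(0 <= p < ((3 * m * E * N) ^ 2).+1 | S p)
    ((logn p (nform_prim (zbox N i) (ybox j))).-1)%:R * lnn p <= C * (N ^ 2)%:R.
Proof.
exists (8 * E%:R + 4 * (3 * m * E)%:R * (lnn 4 + 1)) => N N0.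
set B := (3 * m * E * N)%N.
have B0 : (0 < B)%N by rewrite /B !muln_gt0 m0; lia.
rewrite exchange_big /=.
apply: (@le_trans _ _ (\sum_(0 <= j < N)
   (8 * (E * N)%:R + 4 * (B%:R * (lnn 4 + 1))))); last first.
  rewrite sumr_const_nat subn0 -[leLHS]mulr_natr /B natrX.
  rewrite [(3 * m * E * N)%:R]natrM [(E * N)%:R]natrM le_eqVlt; apply/orP; left; apply/eqP; ring.
rewrite big_nat [leRHS]big_nat; apply: ler_sum => j /andP[_ hj].
rewrite exchange_big /=.
apply: (@le_trans _ _ (\sum_(0 <= p < (B ^ 2).+1 | S p) if (p <= B)%N then
       4 * (E * N)%:R * (lnn p / p%:R ^+ 2) + 4 * lnn B else 0)).
  by apply: ler_sum => p hp; apply: prime_power_ln_le.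
have BB : (B.+1 <= (B ^ 2).+1)%N by rewrite ltnS leq_pmull.
rewrite (@big_cat_nat _ _ _ B.+1) //= [X in _ + X]big1_seq ?addr0; last first.
  by move=> p /andP[_]; rewrite mem_index_iota => /andP[h _]; rewrite leqNgt h.
apply: (@le_trans _ _ (\sum_(0 <= p < B.+1)
   4 * (E * N)%:R * (lnn p / p%:R ^+ 2) + \sum_(0 <= p < B.+1 | prime p) 4 * lnn B)).
  rewrite [X in _ <= _ + X]big_mkcond -big_split /= big_mkcond big_nat [leRHS]big_nat.
  apply: ler_sum => p /andP[_ pB].
  have h : 0 <= 4 * (E * N)%:R * (lnn p / p%:R ^+ 2).
    by rewrite !mulr_ge0 ?invr_ge0 ?exprn_ge0 ?lnn_ge0.
  case: ifP => [/and3P[pp _ _]|_].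
    by rewrite -ltnS pB pp.
  by rewrite addr_ge0 //; case: ifP => // _; rewrite mulr_ge0 ?lnn_ge0.
apply: lerD.
  rewrite -mulr_sumr; have := sum_ln_div_sqr_le R B.
  have h : 0 <= 4 * (E * N)%:R :> R by rewrite mulr_ge0.
  by move=> h2; apply: (le_trans (ler_wpM2l h h2)); lra.
have := prime_count_le R B.
rewrite -[\sum_(0 <= p < B.+1 | prime p) 4 * lnn B](_ : 4 * ((\sum_(0 <= p < B.+1 | prime p) 1) * lnn B) = _).
  by move=> h; apply: ler_wpM2l.
by rewrite mulr_suml mulr_sumr; apply: eq_bigr => p _; rewrite mul1r.
Qed.

End NormMertens.

(** * The Mertens sum over the split primes *)

Section MertensHalf.
Variable R : realType.
Variables (E m : nat).
Hypothesis E1 : 1 < E.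
Hypothesis Em : 2 * E %| m.
Hypothesis m0 : 0 < m.
Hypothesis Ens : forall x y : int, (x ^+ 2 = E%:Z * y ^+ 2 -> y = 0)%R.

Local Open Scope ring_scope.
Notation lnn n := (ln (n%:R : R)).
Notation S := (split_prime E m).
Notation ht := (hits E).
Notation zb := (zbox E m).
Notation yb := (ybox m).
Notation nform := (nform E).
Notation nform_prim := (nform_prim E).

(** Dividing by m modulo p turns the progressions z = 1, y = 0 modulo m into a full box and the
    constant 1 into the coset shift -1/m. *)
Lemma line_hits_box p (w : int) N : prime p -> ~~ (p %| m)%N -> exists c,
  (\sum_(0 <= i < E * N) \sum_(0 <= j < N) (p%:Z %| ((zb N i)%:Z - w * (yb j)%:Z)%R)%Z
   = box_count p w c (E * N)%:Z 1 (E * N) N)%N.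
Proof.
move=> pp pm.
have cop : coprimez p m by rewrite coprimezE prime_coprime.
have /coprimezP[[u v] /= uv] := cop.
exists (- v); apply: eq_bigr => i _; apply: eq_bigr => j _; congr nat_of_bool.
have -> : (p%:Z %| (zb N i)%:Z - w * (yb j)%:Z)%Z
   = (p%:Z %| m%:Z * ((E * N)%:Z + i%:Z - w * (1 + j%:Z) - - v))%Z.
  have -> : m%:Z * ((E * N)%:Z + i%:Z - w * (1 + j%:Z) - - v)
    = (zb N i)%:Z - w * (yb j)%:Z + (- u * p%:Z).
    have -> : (zb N i)%:Z = (u * p%:Z + v * m%:Z) + m%:Z * ((E * N)%:Z + i%:Z).
      by rewrite uv /zbox PoszD PoszM PoszD.
    by rewrite /ybox !PoszM intS; ring.
  by apply/esym/rpredDr; apply: dvdz_mull.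
by rewrite Gauss_dvdzr.
Qed.

(** [lattice_count] is applied with L = (E+1) s and s <= sqrt p: the boundary terms L N / p and L^2
    / p are O(N / sqrt p) and O(1). *)
Lemma line_hits_estimate p (w : int) N : prime p -> ~~ (p %| m)%N ->
  (p%:Z %| w ^+ 2 - E%:Z)%Z ->
  `|(\sum_(0 <= i < E * N) \sum_(0 <= j < N)
       (p%:Z %| ((zb N i)%:Z - w * (yb j)%:Z)%R)%Z)%N%:R - (E * N ^ 2)%:R / p%:R|
  <= 4 * E.+1%:R ^+ 2 * (N%:R / Num.sqrt p%:R + 1) :> R.
Proof.
move=> pp pm hw; have [c ->] := line_hits_box w N pp pm.
have p0 := prime_gt0 pp.
have [s s1 s2] := exists_isqrt p.
have hL := small_representative (ltnW E1) Ens p0 s2 hw.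
have [h1 h2] := lattice_count c (E * N)%:Z 1 (E * N) N p0 hL.
set n := box_count _ _ _ _ _ _ _ in h1 h2 *.
have p0' : 0 < p%:R :> R by rewrite ltr0n.
set q : R := Num.sqrt p%:R.
have q0 : 0 < q by rewrite sqrtr_gt0.
have q2 : q ^+ 2 = p%:R by rewrite sqr_sqrtr ?ltW.
have sq : s%:R <= q.
  by rewrite -(@ler_pXn2r _ 2) ?nnegrE ?(ltW q0) // q2 -natrX ler_nat.
have -> : 4 * E.+1%:R ^+ 2 * (N%:R / q + 1) = 4 * E.+1%:R ^+ 2 * (N%:R * q + p%:R) / p%:R.
  by rewrite -q2; field; rewrite gt_eqF.
have -> : n%:R - (E * N ^ 2)%:R / p%:R = (p%:R * n%:R - (E * N ^ 2)%:R) / p%:R :> R.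
  by field; rewrite gt_eqF.
rewrite normrM [X in _ * X <= _]ger0_norm ?invr_ge0 ?(ltW p0') //.
apply: ler_wpM2r; first by rewrite invr_ge0 ltW.
have e1 : (p * n <= E * N ^ 2 + (2 * E.+1 ^ 2 * (s * N) + 4 * E.+1 ^ 2 * s ^ 2))%N.
  by apply: leq_trans h1 _; rewrite -!muln2 !expnS !expn0; nia.
have e2 : (E * N ^ 2 <= p * n + 2 * E.+1 ^ 2 * (s * N))%N.
  by move: h2; rewrite -!muln2 !expnS !expn0; nia.
have hb : (2 * E.+1 ^ 2 * (s * N) + 4 * E.+1 ^ 2 * s ^ 2)%:R
    <= 4 * E.+1%:R ^+ 2 * (N%:R * q + p%:R) :> R.
  have b1 : (s * N)%:R <= N%:R * q :> R by rewrite natrM mulrC ler_wpM2l.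
  have b2 : (s ^ 2)%:R <= p%:R :> R by rewrite ler_nat.
  have b3 : 0 <= N%:R * q by rewrite mulr_ge0 // ltW.
  have b4 : 0 <= E.+1%:R ^+ 2 :> R by apply: sqr_ge0.
  rewrite natrD [(2 * _ * _)%:R]natrM [(2 * _)%:R]natrM [(4 * _ * _)%:R]natrM [(4 * _)%:R]natrM.
  rewrite [(E.+1 ^ 2)%:R]natrX mulrDr; apply: lerD; apply: ler_pM => //; rewrite ?mulr_ge0 //.
  by rewrite ler_wpM2r // ler_nat.
have hb2 : (2 * E.+1 ^ 2 * (s * N))%:R <= 4 * E.+1%:R ^+ 2 * (N%:R * q + p%:R) :> R.
  by apply: le_trans hb; rewrite ler_nat leq_addr.
rewrite -(ler_nat R) natrD natrM in e1; rewrite -(ler_nat R) natrD [(p * n)%:R]natrM in e2.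
by rewrite ler_norml; apply/andP; split; lra.
Qed.

Lemma hits_estimate p N : S p ->
  `|\sum_(0 <= i < E * N) \sum_(0 <= j < N) (ht p (zb N i) (yb j))%:R
     - 2 * (E * N ^ 2)%:R / p%:R|
  <= 8 * E.+1%:R ^+ 2 * (N%:R / Num.sqrt p%:R + 1) :> R.
Proof.
move=> hp; have /and3P[pp pm _] := hp; have hr := root_modP hp.
have h1 := line_hits_estimate N pp pm hr.
have hr' : (p%:Z %| (- root_mod E p) ^+ 2 - E%:Z)%Z by rewrite sqrrN.
have h2 := line_hits_estimate N pp pm hr'.
have -> : \sum_(0 <= i < E * N) \sum_(0 <= j < N) (ht p (zb N i) (yb j))%:R =
  (\sum_(0 <= i < E * N) \sum_(0 <= j < N)
       (p%:Z %| ((zb N i)%:Z - root_mod E p * (yb j)%:Z)%R)%Z)%N%:R +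
  (\sum_(0 <= i < E * N) \sum_(0 <= j < N)
       (p%:Z %| ((zb N i)%:Z - (- root_mod E p) * (yb j)%:Z)%R)%Z)%N%:R :> R.
  rewrite -natrD -big_split natr_sum; apply: eq_bigr => i _.
  rewrite -big_split natr_sum; apply: eq_bigr => j _.
  by rewrite /hits mulNr opprK.
move: h1 h2; set a := _%:R; set b := _%:R; rewrite !ler_norml.
have -> : 2 * (E * N ^ 2)%:R / p%:R = 2 * ((E * N ^ 2)%:R / p%:R) :> R by rewrite mulrA.
move=> /andP[h1 h2] /andP[h3 h4].
by apply/andP; split; lra.
Qed.

Lemma sum_hits_estimate N n :
  `|\sum_(0 <= i < E * N) \sum_(0 <= j < N) \sum_(0 <= p < n.+1 | S p)
       (ht p (zb N i) (yb j))%:R * lnn p - 2 * (E * N ^ 2)%:R * mertens_sum R S n|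
  <= 8 * E.+1%:R ^+ 2 * lnn 4 * (2 * N%:R * Num.sqrt n%:R + n%:R).
Proof.
have -> : \sum_(0 <= i < E * N) \sum_(0 <= j < N) \sum_(0 <= p < n.+1 | S p)
       (ht p (zb N i) (yb j))%:R * lnn p
  = \sum_(0 <= p < n.+1 | S p)
     (\sum_(0 <= i < E * N) \sum_(0 <= j < N) (ht p (zb N i) (yb j))%:R) * lnn p.
  under eq_bigr => i _ do rewrite exchange_big /=.
  rewrite exchange_big /=; apply: eq_bigr => p _; rewrite mulr_suml.
  by apply: eq_bigr => i _; rewrite mulr_suml.
rewrite /mertens_sum mulr_sumr -sumrB; apply: (le_trans (ler_norm_sum _ _ _)).
set K := 8 * E.+1%:R ^+ 2.
have K0 : 0 <= K by rewrite /K mulr_ge0 // sqr_ge0.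
apply: (@le_trans _ _ (\sum_(0 <= p < n.+1 | S p)
    (K * N%:R * (lnn p / Num.sqrt p%:R) + K * lnn p))).
  apply: ler_sum => p hp; have l0 := lnn_ge0 R p.
  have -> : 2 * (E * N ^ 2)%:R * (lnn p / p%:R) = (2 * (E * N ^ 2)%:R / p%:R) * lnn p :> R.
    by rewrite [LHS]mulrA mulrAC.
  rewrite -mulrBl normrM [X in _ * X]ger0_norm //.
  apply: le_trans (ler_wpM2r l0 (hits_estimate N hp)) _.
  by rewrite -/K le_eqVlt; apply/orP; left; apply/eqP; ring.
rewrite big_split /= -!mulr_sumr.
have sqrt0 p : 0 <= lnn p / Num.sqrt p%:R by rewrite divr_ge0 ?lnn_ge0 ?sqrtr_ge0.
have h1 : \sum_(0 <= p < n.+1 | S p) lnn p / Num.sqrt p%:R <= 2 * lnn 4 * Num.sqrt n%:R.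
  apply: le_trans (sum_ln_inv_sqrt_le R n); rewrite big_mkcond [leRHS]big_mkcond.
  by apply: ler_sum => p _; case: ifP => [/and3P[-> _ _]//|_]; case: ifP.
have h2 : \sum_(0 <= p < n.+1 | S p) lnn p <= n%:R * lnn 4.
  apply: le_trans (theta_prime_le R n); exact: (theta_le R n (@split_prime_prime E m)).
have -> : K * lnn 4 * (2 * N%:R * Num.sqrt n%:R + n%:R)
   = K * N%:R * (2 * lnn 4 * Num.sqrt n%:R) + K * (n%:R * lnn 4) by ring.
by apply: lerD; apply: ler_wpM2l => //; apply: mulr_ge0.
Qed.

(** For n = N^2 the error of [sum_hits_estimate] is O(N^2), the order of the number E N^2 of points,
    and every value has logarithm at most 2 ln N + O(1). Dividing by 2 E N^2 leaves ln N, half of ln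
    n. *)
Lemma mertens_split_upper : exists C : R, forall N, (0 < N)%N ->
  mertens_sum R S (N ^ 2) <= lnn N + C.
Proof.
pose K := 8 * E.+1%:R ^+ 2 * lnn 4.
exists (lnn (3 * m * E) + (4 * E.+1%:R + 3 * K) / (2 * E%:R)) => N N0.
have b0 : (0 < 3 * m * E)%N by rewrite !muln_gt0 m0 /=; lia.
have N0' : 0 < N%:R :> R by rewrite ltr0n.
have E0' : 0 < E%:R :> R by rewrite ltr0n; lia.
have := sum_hits_estimate N (N ^ 2); rewrite -/K.
have -> : Num.sqrt (N ^ 2)%:R = N%:R :> R by rewrite natrX sqrtr_sqr ger0_norm.
rewrite ler_norml => /andP[h _].
have A : \sum_(0 <= i < E * N) \sum_(0 <= j < N) \sum_(0 <= p < (N ^ 2).+1 | S p)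
       (ht p (zb N i) (yb j))%:R * lnn p
   <= (E * N ^ 2)%:R * (2 * (lnn (3 * m * E) + lnn N)) + (4 * E.+1 * N ^ 2)%:R.
  apply: (@le_trans _ _ (\sum_(0 <= i < E * N) \sum_(0 <= j < N)
      (2 * (lnn (3 * m * E) + lnn N) + lnn (gcdn (zb N i) (yb j))))).
    rewrite big_nat [leRHS]big_nat; apply: ler_sum => i /andP[_ hi].
    rewrite big_nat [leRHS]big_nat; apply: ler_sum => j /andP[_ hj].
    have [h1 h2 h3] := nform_bounds E1 Em m0 hi hj.
    have F0 : (0 < nform (zb N i) (yb j))%N by apply: leq_trans h2; rewrite expn_gt0 N0.
    apply: le_trans (sum_hits_le R Em _ h1 F0 (ybox_gt0 m0 j)) _; rewrite lerD2r.
    apply: (le_trans (ler_lnn R h3)).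
    have bN : (0 < 3 * m * E * N)%N by rewrite muln_gt0 b0.
    by rewrite (lnnX R 2 bN) (lnnM R b0 N0).
  under eq_bigr => i _ do rewrite big_split /=.
  rewrite big_split /=; apply: lerD; last exact: sum_ln_gcd_le.
  rewrite !sumr_const_nat !subn0 -mulrnA -[leLHS]mulr_natl.
  by rewrite (_ : (N * (E * N) = E * N ^ 2)%N) //; nia.
have c0 : 0 < 2 * (E * N ^ 2)%:R :> R by rewrite mulr_gt0 // ltr0n muln_gt0 expn_gt0 N0; lia.
rewrite -(ler_pM2l c0).
have e1 : (E * N ^ 2)%:R = E%:R * N%:R ^+ 2 :> R by rewrite natrM natrX.
have e2 : (4 * E.+1 * N ^ 2)%:R = 4 * E.+1%:R * N%:R ^+ 2 :> R by rewrite 2!natrM natrX.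
have e3 : (N ^ 2)%:R = N%:R ^+ 2 :> R by rewrite natrX.
rewrite e1 e2 in A; rewrite e1 e3 in h; rewrite e1.
have -> : 2 * (E%:R * N%:R ^+ 2) * (lnn N + (lnn (3 * m * E) + (4 * E.+1%:R + 3 * K) / (2 * E%:R)))
  = 2 * (E%:R * N%:R ^+ 2) * (lnn N + lnn (3 * m * E)) + (4 * E.+1%:R + 3 * K) * N%:R ^+ 2.
  by field; rewrite gt_eqF.
move: A h; set T := mertens_sum _ _ _; set Z := \sum_(_ <= _ < _) _; move=> A h.
lra.
Qed.

(** The range (b N)^2 with b = 3 m E bounds all values, so every prime factor of every value is
    included; the gcd terms and the higher powers are O(N^2). *)
Lemma mertens_split_lower : exists C : R, forall N, (0 < N)%N ->
  lnn N - C <= mertens_sum R S ((3 * m * E * N) ^ 2).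
Proof.
pose K := 8 * E.+1%:R ^+ 2 * lnn 4.
have [C hC] := sum_prime_powers_le R E1 Em m0.
pose b := (3 * m * E)%N.
exists ((8 * E.+1%:R + K * (2 * b%:R + b%:R ^+ 2) + C) / (2 * E%:R)) => N N0.
have b0 : (0 < b)%N by rewrite !muln_gt0 m0 /=; lia.
have N0' : 0 < N%:R :> R by rewrite ltr0n.
have E0' : 0 < E%:R :> R by rewrite ltr0n; lia.
have := sum_hits_estimate N ((b * N) ^ 2); rewrite -/K -/b.
have -> : Num.sqrt ((b * N) ^ 2)%:R = b%:R * N%:R :> R by rewrite natrX sqrtr_sqr ger0_norm // natrM.
rewrite ler_norml => /andP[_ h].
have A : (E * N ^ 2)%:R * (2 * lnn N) <=
   2 * (\sum_(0 <= i < E * N) \sum_(0 <= j < N) lnn (gcdn (zb N i) (yb j)))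
   + (\sum_(0 <= i < E * N) \sum_(0 <= j < N) \sum_(0 <= p < ((b * N) ^ 2).+1 | S p)
       (ht p (zb N i) (yb j))%:R * lnn p
   + \sum_(0 <= i < E * N) \sum_(0 <= j < N) \sum_(0 <= p < ((b * N) ^ 2).+1 | S p)
       ((logn p (nform_prim (zb N i) (yb j))).-1)%:R * lnn p).
  have -> : (E * N ^ 2)%:R * (2 * lnn N) = \sum_(0 <= i < E * N) \sum_(0 <= j < N) lnn (N ^ 2).
    rewrite !sumr_const_nat !subn0 -mulrnA lnnX // -[RHS]mulr_natl.
    by rewrite (_ : (N * (E * N) = E * N ^ 2)%N) //; nia.
  rewrite mulr_sumr -!big_split /= big_nat [leRHS]big_nat; apply: ler_sum => i /andP[_ hi].
  rewrite mulr_sumr -!big_split /= big_nat [leRHS]big_nat; apply: ler_sum => j /andP[_ hj].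
  have [h1 h2 h3] := nform_bounds E1 Em m0 hi hj.
  have F0 : (0 < nform (zb N i) (yb j))%N by apply: leq_trans h2; rewrite expn_gt0 N0.
  apply: (le_trans (ler_lnn R h2)).
  apply: (ln_nform_le R E1 Em m0 h1 F0 (ybox_gt0 m0 j)) h3; first exact: zbox_coprime.
  exact: dvdn_mulr.
have c0 : 0 < 2 * (E * N ^ 2)%:R :> R by rewrite mulr_gt0 // ltr0n muln_gt0 expn_gt0 N0; lia.
rewrite -(ler_pM2l c0).
have e1 : (E * N ^ 2)%:R = E%:R * N%:R ^+ 2 :> R by rewrite natrM natrX.
have e2 : (4 * E.+1 * N ^ 2)%:R = 4 * E.+1%:R * N%:R ^+ 2 :> R by rewrite 2!natrM natrX.
have e3 : (N ^ 2)%:R = N%:R ^+ 2 :> R by rewrite natrX.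
have e4 : ((b * N) ^ 2)%:R = b%:R ^+ 2 * N%:R ^+ 2 :> R by rewrite natrX natrM exprMn.
have h1 := hC N N0; have h2 := sum_ln_gcd_le R E1 Em m0 N0.
rewrite e1 in A; rewrite e1 e4 in h; rewrite e1; rewrite e3 -/b in h1; rewrite e2 in h2.
have -> : 2 * (E%:R * N%:R ^+ 2) *
     (lnn N - (8 * E.+1%:R + K * (2 * b%:R + b%:R ^+ 2) + C) / (2 * E%:R))
  = 2 * (E%:R * N%:R ^+ 2) * lnn N - (8 * E.+1%:R + K * (2 * b%:R + b%:R ^+ 2) + C) * N%:R ^+ 2.
  by field; rewrite gt_eqF.
rewrite -/b; lra.
Qed.

Theorem mertens_split : exists C : R, forall n, (0 < n)%N ->
  `|mertens_sum R S n - 2^-1 * lnn n| <= C.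
Proof.
have [Cu hu] := mertens_split_upper; have [Cl hl] := mertens_split_lower.
set b := (3 * m * E)%N in hl.
have b0 : (0 < b)%N by rewrite !muln_gt0 m0 /=; lia.
exists (lnn 2 + lnn (2 * b) + `|Cu| + `|Cl|) => n n0.
have [s s1 s2] := exists_isqrt n.
have s0 : (0 < s)%N by case: s s1 s2 => [|//] _; rewrite exp1n; lia.
have mono k l : (k <= l)%N -> mertens_sum R S k <= mertens_sum R S l.
  move=> kl; rewrite /mertens_sum [leRHS](@big_cat_nat _ _ _ k.+1) //= lerDl.
  by apply: sumr_ge0 => p _; rewrite divr_ge0 ?lnn_ge0.
have lns : 2 * lnn s <= lnn n by rewrite -(lnnX R 2 s0); apply: ler_lnn.
have lns1 : lnn n <= 2 * lnn s.+1 by rewrite -(lnnX R 2 (ltn0Sn s)); apply/ler_lnn/ltnW.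
have u1 := ler_norm Cu; have u2 := ler_norm Cl.
have z1 := normr_ge0 Cu; have z2 := normr_ge0 Cl.
have l2 := lnn_ge0 R 2; have lb := lnn_ge0 R (2 * b).
rewrite ler_norml; apply/andP; split.
  (* For s < b no N is available, but ln n is bounded and nonnegativity of the sum suffices. *)
  have [sb|sb] := ltnP s b.
    have T0 : 0 <= mertens_sum R S n.
      by apply: sumr_ge0 => p _; rewrite divr_ge0 ?lnn_ge0.
    have : lnn s.+1 <= lnn (2 * b) by apply/ler_lnn/(leq_trans sb)/leq_pmull.
    lra.
  have N0 : (0 < s %/ b)%N by rewrite divn_gt0.
  have h := hl _ N0.
  have h2 : mertens_sum R S ((b * (s %/ b)) ^ 2) <= mertens_sum R S n.
    apply: mono; apply: leq_trans s1; rewrite leq_sqr mulnC; exact: leq_trunc_div.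
  have h3 : lnn s.+1 <= lnn (2 * b) + lnn (s %/ b).
    have b2 : (0 < 2 * b)%N by rewrite muln_gt0.
    rewrite -(lnnM R b2 N0); apply: ler_lnn.
    apply: leq_trans (ltn_ceil s b0) _; rewrite mulnAC leq_mul2r mul2n -addnn -addn1.
    by rewrite leq_add2l N0 orbT.
  lra.
have h := hu _ (ltn0Sn s).
have h2 : mertens_sum R S n <= mertens_sum R S (s.+1 ^ 2) by apply/mono/ltnW.
have h3 : lnn s.+1 <= lnn 2 + lnn s 
  by rewrite -(lnnM R (isT : (0 < 2)%N) s0) ler_lnn // mul2n -addnn -addn1 leq_add2l.
lra.
Qed.

End MertensHalf.

(** * Norm classes *)

Section NormClasses.

Lemma sqfree_on_coprimeM (S : pred nat) a b : coprime a b ->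
  sqfree_on S a -> sqfree_on S b -> sqfree_on S (a * b).
Proof.
move=> cab /sqfree_onP[a0 ha] /sqfree_onP[b0 hb]; apply/sqfree_onP; split=> [|p pp].
  by rewrite muln_gt0 a0.
have nab : ~~ ((p %| a) && (p %| b)).
  apply/negP => /andP[pa pb]; have : p %| 1 by rewrite -(eqP cab) dvdn_gcd pa.
  by rewrite Euclid_dvd1.
rewrite Euclid_dvdM // lognM //; case: (boolP (p %| a)) nab => [pa|npa] /= nab.
  by have [? ->] := ha p pp pa; split=> //; rewrite lognE (negbTE nab) !andbF.
move=> pb; have [? ->] := hb p pp pb; split=> //.
by rewrite lognE (negbTE npa) !andbF.
Qed.

Lemma sqfree_on_coprime (S : pred nat) a b :
  (forall p, prime p -> S p -> ~~ (p %| b)) -> sqfree_on S a -> coprime a b.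
Proof.
move=> h /sqfree_onP[a0 ha]; apply/negPn/negP; rewrite /coprime neq_ltn => /orP[g0|g1].
  by have := gcdn_gt0 a b; rewrite a0 /= lt0n -leqn0 -ltnS g0.
have pp := pdiv_prime g1; have := pdiv_dvd (gcdn a b); rewrite dvdn_gcd => /andP[pa pb].
by have [sp _] := ha _ pp pa; move: (h _ pp sp); rewrite pb.
Qed.

Local Open Scope ring_scope.

(** The valuation at a prime factor of E is even on the left and odd on the right. *)
Lemma sqfree_nonsquare E : (1 < E)%N -> sqfree_on prime E ->
  forall x y : int, x ^+ 2 = E%:Z * y ^+ 2 -> y = 0.
Proof.
move=> E1 /sqfree_onP[_ hE] x y /(congr1 absz); rewrite abszM !abszX /= => e.
apply/eqP; rewrite -absz_eq0 -leqn0 leqNgt; apply/negP => y0.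
have x0 : (0 < `|x|)%N by move: e y0; case: (absz x) => // e y0; exfalso; nia.
have pp := pdiv_prime E1; have [_ l1] := hE _ pp (pdiv_dvd E).
have := congr1 (logn (pdiv E)) e.
rewrite lognX lognM ?lognX ?expn_gt0 ?y0 // ?l1; lia.
Qed.

(** Norms from Q(sqrt E), with y as common denominator. *)
Definition is_norm (E : nat) (n : int) : Prop :=
  exists x y z : int, y != 0 /\ n * y ^+ 2 = z ^+ 2 - E%:Z * x ^+ 2.

Lemma is_norm1 E : is_norm E 1.
Proof. by exists 0, 1, 1; split=> //; ring. Qed.

Lemma is_normM E a b : is_norm E a -> is_norm E b -> is_norm E (a * b).
Proof.
move=> [x [y [z [y0 e]]]] [x' [y' [z' [y0' e']]]].
exists (z * x' + x * z'), (y * y'), (z * z' + E%:Z * (x * x')); split.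
  by rewrite mulf_neq0.
rewrite exprMn; transitivity ((a * y ^+ 2) * (b * y' ^+ 2)); first by ring.
by rewrite e e'; ring.
Qed.

Lemma is_norm_sqr E a w : w != 0 -> is_norm E (a * w ^+ 2) -> is_norm E a.
Proof.
move=> w0 [x [y [z [y0 e]]]]; exists x, (w * y), z; split; first by rewrite mulf_neq0.
by rewrite -e; ring.
Qed.

Variables (E : nat).
Hypothesis E1 : (1 < E)%N.
Hypothesis Esq : sqfree_on prime E.

(** Thue's lemma makes x^2 - E y^2 = k p with |x| and |y| at most sqrt p, so |k| <= E; k is nonzero
    because E is not a square. *)
Lemma small_norm_multiple m p : split_prime E m p ->
  exists k : int, [/\ k != 0, (`|k| <= E)%N & is_norm E (p%:Z * k)].
Proof.
move=> hp; have hr := root_modP hp; have /and3P[pp pm _] := hp.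
have p0 := prime_gt0 pp.
have [s s1 s2] := exists_isqrt p.
have [x [y [xy xs ys hxy]]] := thue (root_mod E p) p0 s2.
have Ens := sqfree_nonsquare E1 Esq.
have : (p%:Z %| x ^+ 2 - E%:Z * y ^+ 2)%Z.
  have -> : x ^+ 2 - E%:Z * y ^+ 2 = (x + root_mod E p * y) * (x - root_mod E p * y)
     + y ^+ 2 * (root_mod E p ^+ 2 - E%:Z) by ring.
  by apply: rpredD; apply: dvdz_mull.
case/dvdzP => k ek; exists k.
have k0 : k != 0.
  apply/negP => /eqP k0; move: ek; rewrite k0 mul0r => /eqP; rewrite subr_eq0 => /eqP h.
  have y0 := Ens _ _ h; move: h xy; rewrite y0 expr0n mulr0 => /eqP.
  by rewrite sqrf_eq0 => ->.
split=> //; last by exists y, 1, x; split=> //; rewrite expr1n mulr1 mulrC ek.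
have b1 : (`|x| ^ 2 <= p)%N by apply: leq_trans s1; rewrite leq_sqr.
have b2 : (`|y| ^ 2 <= p)%N by apply: leq_trans s1; rewrite leq_sqr.
have h1 : x ^+ 2 <= p%:Z by rewrite -[x ^+ 2]ger0_norm ?sqr_ge0 // normrX -abszE -rmorphXn /=.
have h2 : y ^+ 2 <= p%:Z by rewrite -[y ^+ 2]ger0_norm ?sqr_ge0 // normrX -abszE -rmorphXn /=.
have h3 : 0 <= x ^+ 2 by apply: sqr_ge0.
have h4 : 0 <= E%:Z * y ^+ 2 by rewrite mulr_ge0 ?sqr_ge0.
have h5 : E%:Z * y ^+ 2 <= E%:Z * p%:Z by rewrite ler_wpM2l.
have h6 : p%:Z <= E%:Z * p%:Z by rewrite ler_peMl //; lia.
have : `|k * p%:Z| <= E%:Z * p%:Z.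
  rewrite -ek ler_norml; apply/andP; split.
    by rewrite lerBrDl (le_trans _ h3) // subr_le0.
  by rewrite lerBlDr (le_trans h1) // (le_trans h6) // lerDl.
by rewrite normrM [`|p%:Z|]ger0_norm // ler_pM2r ?ltr0n.
Qed.

(** Index i stands for i - E, so the indices cover -E to E; the value 1 replaces 0 to keep products
    nonzero. *)
Definition small_int (i : 'I_(E.*2.+1)) : int :=
  if i == E :> nat then 1 else (i : nat)%:Z - E%:Z.

Definition small_prod (T : {set 'I_(E.*2.+1)}) : int := \prod_(i in T) small_int i.

Lemma small_int_neq0 i : small_int i != 0.
Proof. by rewrite /small_int; case: (eqVneq (i : nat) E) => // /eqP h; rewrite subr_eq0; apply/eqP => -[]. Qed.

Lemma small_prod_neq0 T : small_prod T != 0.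
Proof. by apply/prodf_neq0 => i _; apply: small_int_neq0. Qed.

(** Each prime factor contributes one small k. A k met twice contributes a square and cancels, so
    the obstruction is recorded by a set. *)
Lemma norm_class m n : sqfree_on (split_prime E m) n ->
  exists T, is_norm E (n%:Z * small_prod T).
Proof.
elim/ltn_ind: n => n IH hn; have n0 := sqfree_on_gt0 hn.
case: (ltnP 1 n) => [n1|]; last first.
  move=> n1; have -> : n = 1%N by lia.
  by exists set0; rewrite /small_prod big_set0 mulr1; apply: is_norm1.
have pp := pdiv_prime n1; have pn := pdiv_dvd n.
have hp : split_prime E m (pdiv n) by have /sqfree_onP[_ h] := hn; have [] := h _ pp pn.
have [hn' _] := sqfree_on_div pp pn hn.
have [T hT] := IH (n %/ pdiv n)%N (ltn_Pdiv (prime_gt1 pp) n0) hn'.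
have [k [k0 kE hk]] := small_norm_multiple hp.
have iE : (`|(k + E%:Z)%R| < E.*2.+1)%N by lia.
pose i : 'I_(E.*2.+1) := Ordinal iE.
have ki : small_int i = k by rewrite /small_int /=; case: (eqVneq _ E) => h; lia.
have hh := is_normM hT hk.
have en : n%:Z = (n %/ pdiv n)%N%:Z * (pdiv n)%:Z by rewrite -PoszM divnK.
case: (boolP (i \in T)) => iT.
  exists (T :\ i); apply: (@is_norm_sqr _ _ k) => //.
  move: hh; rewrite /small_prod (big_setD1 i) //= ki en; set w := \prod_(_ in _) _; congr is_norm; ring.
exists (i |: T); rewrite /small_prod big_setU1 //= ki -/(small_prod T) en.
by move: hh; congr is_norm; ring.
Qed.

End NormClasses.

(** * Many norms in a fixed class modulo 8 *)

Section NormFamily.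

Lemma pigeonhole (C : finType) (c0 : C) (f : nat -> C) (L : seq nat) :
  exists c, size L <= #|C| * count (fun k => f k == c) L.
Proof.
case: (@arg_maxnP C c0 xpredT (fun c => count (fun k => f k == c) L)) => // c _ hc.
exists c; have -> : size L = \sum_(d : C) count (fun k => f k == d) L.
  elim: L {hc} => [|x L IH] /=; first by rewrite big1.
  rewrite big_split /= -IH -add1n; congr (_ + _); rewrite (bigD1 (f x)) //= eqxx big1 ?addn0 // => d.
  by rewrite eq_sym => /negbTE ->.
by rewrite -sum_nat_const; apply: leq_sum => d _; apply: hc.
Qed.

Lemma odd_mulmod8 r k : odd k -> r %% 8 = k %% 8 -> (r * k) %% 8 = 1.
Proof.
move=> ok e; rewrite -modnMml e modnMml.
have : odd (k %% 8) by rewrite odd_mod.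
rewrite -modnMm; have := ltn_pmod k (isT : 0 < 8).
by case: (k %% 8) => [|[|[|[|[|[|[|[|]]]]]]]].
Qed.

Lemma split_primeW E m m' p : m' %| m -> split_prime E m p -> split_prime E m' p.
Proof.
move=> mm /and3P[pp pm h]; apply/and3P; split=> //.
by apply: contra pm => pm'; apply: dvdn_trans mm.
Qed.

Variable R : realType.
Local Open Scope ring_scope.
Notation lnn n := (ln (n%:R : R)).

(** The members are Q = Q0 r k with k a product of split primes and r the representative of its
    class. Then r k times a square is a norm and r k = 1 modulo 8, so Q inherits both properties
    from Q0. *)
Theorem norm_family (E Q0 : nat) : (1 < E)%N -> sqfree_on prime (E * Q0) -> is_norm E Q0%:Z ->
  exists2 c : R, 0 < c & exists Y0, forall Y, (Y0 <= Y)%N -> exists s : seq nat,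
    [/\ uniq s, c * Y%:R <= (size s)%:R * Num.sqrt (lnn Y) &
      forall Q, Q \in s -> [/\ (Q <= Y)%N, sqfree_on prime (E * Q), (Q = Q0 %[mod 8])%N
                             & is_norm E Q%:Z]].
Proof.
move=> E1 hEQ nQ0.
have EQ0 : (0 < E * Q0)%N by apply: sqfree_on_gt0 hEQ.
have Q00 : (0 < Q0)%N by move: EQ0; rewrite muln_gt0 => /andP[].
have Esq : sqfree_on prime E.
  apply/sqfree_onP; split=> [|p pp pE]; first by lia.
  have /sqfree_onP[_ h] := hEQ; have [_] := h p pp (dvdn_mulr _ pE).
  rewrite lognM; [|lia|by []] => h1; split=> //.
  have : (0 < logn p E)%N by rewrite logn_gt0 mem_primes pp pE; lia.
  lia.
pose m1 := (2 * (E * Q0))%N.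
(* A class records the obstruction set of [norm_class] and the residue modulo 8. *)
pose C := ({set 'I_(E.*2.+1)} * 'I_8)%type.
pose cls n (k : C) := is_norm E (n%:Z * small_prod k.1) /\ (n %% 8 = k.2)%N.
pose G1 := sqfree_on (split_prime E m1).
(* One representative for each class that occurs; 1 is a placeholder for the others. *)
have /fin_all_exists[r hr] : forall k : C, exists r : nat, (0 < r)%N /\
    ((exists n, G1 n /\ cls n k) -> G1 r /\ cls r k).
  move=> k.
  have [[n [h1 h2]]|h] := EM (exists n, G1 n /\ cls n k).
    by exists n; split=> //; apply: sqfree_on_gt0 h1.
  by exists 1%N.
pose P := (\prod_(k : C) r k)%N.
have P0 : (0 < P)%N by apply: prodn_gt0 => k; have [] := hr k.
(* The representatives are fixed before m, so that k can be kept prime to all of them and r k stays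
   square-free. *)
pose m := (m1 * P)%N.
have m0 : (0 < m)%N by rewrite muln_gt0 P0 andbT muln_gt0 EQ0.
have m1m : (m1 %| m)%N by apply: dvdn_mulr.
have E2m1 : (2 * E %| m1)%N by rewrite /m1 mulnA dvdn_mulr.
have E2m : (2 * E %| m)%N by apply: dvdn_trans m1m.
pose G := sqfree_on (split_prime E m).
have GG1 n : G n -> G1 n by apply: sqfree_onW => p _ _; apply: split_primeW.
have /boolp.choice[kap hkap] : forall n, exists k : C, G n -> cls n k.
  move=> n.
  have [hn|hn] := boolP (G n); last by exists (set0, ord0).
  have [T hT] := norm_class E1 Esq hn.
  by exists (T, inord (n %% 8)); split=> //=; rewrite inordK // ltn_pmod.
have Ens := sqfree_nonsquare E1 Esq.
have [CM hCM] := mertens_split R E1 E2m m0 Ens.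
have [c c0 [n0 hn0]] := sqfree_on_count_ge (@split_prime_prime E m) hCM.
pose A := (Q0 * P)%N.
have A0 : (0 < A)%N by rewrite muln_gt0 Q00.
have C0 : (0 < #|{: C}|)%N by apply/card_gt0P; exists (set0, ord0).
have A0' : 0 < A%:R :> R by rewrite ltr0n.
have C0' : 0 < #|{: C}|%:R :> R by rewrite ltr0n.
exists (c / (2 * A%:R * #|{: C}|%:R)); first by rewrite divr_gt0 // !mulr_gt0.
exists (A * (n0.+1))%N => Y hY.
pose n := (Y %/ A)%N.
have nn0 : (n0 <= n)%N by rewrite leq_divRL // mulnC; apply: leq_trans hY; rewrite leq_mul2l leqnSn orbT.
have n1 : (0 < n)%N by rewrite divn_gt0 //; apply: leq_trans hY; rewrite leq_pmulr.
have nY : (n <= Y)%N by apply: leq_div.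
pose L := [seq k <- index_iota 0 n.+1 | G k].
have [k0 hk0] := pigeonhole (set0, ord0) kap L.
exists [seq (Q0 * r k0 * k)%N | k <- L & kap k == k0].
have rP : (r k0 %| P)%N by rewrite /P (bigD1 k0) //= dvdn_mulr.
have rk0 : (0 < r k0)%N by have [] := hr k0.
have rle : (r k0 <= P)%N by apply: dvdn_leq.
split.
- rewrite map_inj_uniq; first exact/filter_uniq/filter_uniq/iota_uniq.
  by move=> a b /eqP; rewrite eqn_pmul2l ?muln_gt0 ?Q00 // => /eqP.
- rewrite size_map size_filter.
  have hL := hn0 n nn0.
  have eL : \sum_(0 <= k < n.+1 | G k) 1 = (size L)%:R :> R.
    by rewrite -big_filter -/L big_const_seq count_predT iter_addr_0.
  rewrite eL in hL; set s := count _ _.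
  have sL : (size L)%:R <= #|{: C}|%:R * s%:R :> R by rewrite -natrM ler_nat.
  have q0 : 0 <= Num.sqrt (lnn Y) by apply: sqrtr_ge0.
  have qn : Num.sqrt (lnn n) <= Num.sqrt (lnn Y).
    by apply: ler_wsqrtr; apply: ler_lnn.
  have Yn : Y%:R <= 2 * A%:R * n%:R :> R.
    rewrite -!natrM ler_nat; apply/ltnW/(leq_trans (ltn_ceil Y A0)); rewrite -/n.
    by rewrite mulnC [(2 * A)%N]mulnC -mulnA leq_mul2l mul2n -addnn -addn1 leq_add2l n1 orbT.
  have h1 : c * n%:R <= #|{: C}|%:R * s%:R * Num.sqrt (lnn Y).
    by apply: le_trans hL _; apply: ler_pM; rewrite ?sqrtr_ge0.
  rewrite mulrAC ler_pdivrMr ?mulr_gt0 //.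
  apply: (@le_trans _ _ (c * (2 * A%:R * n%:R))); first by rewrite ler_wpM2l // ltW.
  have -> : c * (2 * A%:R * n%:R) = (c * n%:R) * (2 * A%:R) by ring.
  have -> : s%:R * Num.sqrt (lnn Y) * (2 * A%:R * #|{: C}|%:R)
    = (#|{: C}|%:R * s%:R * Num.sqrt (lnn Y)) * (2 * A%:R) by ring.
  by apply: ler_wpM2r => //; rewrite mulr_ge0.
move=> Q /mapP[k]; rewrite mem_filter mem_filter mem_index_iota ltnS.
move=> /andP[/eqP kk /andP[Gk /andP[_ kn]]] ->.
have ck := hkap k Gk; rewrite kk in ck.
(* The class k0 occurs, k itself being an example, so its representative is not the placeholder. *)
have [|G1r cr] := (hr k0).2; first by exists k; split=> //; apply: GG1.
have copkm : coprime k m.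
  by apply: sqfree_on_coprime Gk => p pp /and3P[].
have copr : coprime (r k0) m1.
  by apply: sqfree_on_coprime G1r => p pp /and3P[].
split.
- have h1 : (Q0 * r k0 * k <= A * n)%N by rewrite leq_mul // leq_mul2l rle orbT.
  by apply: leq_trans h1 _; rewrite mulnC leq_trunc_div.
- rewrite !mulnA; apply: sqfree_on_coprimeM.
  + rewrite coprime_sym; apply: coprime_dvdr copkm.
    by rewrite /m /m1 -!mulnA dvdn_mull // !mulnA dvdn_mul.
  + apply: sqfree_on_coprimeM => //.
      by rewrite coprime_sym; apply: coprime_dvdr copr; apply: dvdn_mull.
    by apply: sqfree_onW G1r => p.
  by apply: sqfree_onW Gk => p.
- have ok : odd k.
    have : coprime k 2 by apply: coprime_dvdr copkm; rewrite /m /m1 -mulnA dvdn_mulr.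
    by rewrite coprimen2.
  rewrite -mulnA -modnMmr (odd_mulmod8 ok) ?muln1 //.
  by rewrite cr.2 ck.2.
rewrite -mulnA PoszM; apply: is_normM => //.
apply: (@is_norm_sqr _ _ (small_prod k0.1)); first exact: small_prod_neq0.
have -> : (r k0 * k)%N%:Z * small_prod k0.1 ^+ 2
   = ((r k0)%:Z * small_prod k0.1) * (k%:Z * small_prod k0.1) by rewrite PoszM; ring.
exact: is_normM cr.1 ck.1.
Qed.

End NormFamily.

(** * Localization at a prime of an imaginary quadratic field *)

Section LocalRing.
Local Open Scope ring_scope.

Lemma Aint_quadratic (x : algC) (T N : int) :
  x ^+ 2 - T%:~R * x + N%:~R = 0 -> x \in Aint.
Proof.
move=> h; pose p : {poly algC} := 'X^2 + (- T%:~R *: 'X + (N%:~R)%:P).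
have sz : (size (- (T%:~R : algC) *: 'X + (N%:~R)%:P)%R < size ('X^2 : {poly algC})%R)%N.
  rewrite size_polyXn ltnS; apply: leq_trans (size_polyD _ _) _.
  rewrite geq_max (leq_trans (size_scale_leq _ _)) ?size_polyX //.
  by rewrite (leq_trans (size_polyC_leq1 _)).
apply: (@root_monic_Aint p).
- by rewrite /root hornerD hornerXn hornerD hornerZ hornerX hornerC mulNr addrA h.
- by rewrite monicE lead_coefDl // lead_coefXn.
apply/polyOverP => i; rewrite /p coefD coefXn coefD coefZ coefX coefC -mulrNz.
have -> : (if i == 0%N then N%:~R else 0) = (if i == 0%N then N else 0)%:~R :> algC.
  by case: (i == 0%N).
by rewrite [(i == 2)%:R]pmulrn [(i == 1)%:R]pmulrn -intrM -!intrD intr_int.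
Qed.

Variable d : int.
Hypothesis d0 : d < 0.

Let w : algC := sqrtC d%:~R.

Lemma sqr_sqrt_d : w ^+ 2 = d%:~R.
Proof. exact: sqrtCK. Qed.

Lemma inK_ratr (a : rat) : inK d (ratr a).
Proof. by exists a, 0; rewrite rmorph0 mul0r addr0. Qed.

Lemma inK_int (n : int) : inK d n%:~R.
Proof. by rewrite -ratr_int; apply: inK_ratr. Qed.

Lemma inK_sqrt : inK d w.
Proof. by exists 0, 1; rewrite rmorph0 rmorph1 mul1r add0r. Qed.

Lemma inKD x y : inK d x -> inK d y -> inK d (x + y).
Proof.
by move=> [a [b ->]] [a' [b' ->]]; exists (a + a'), (b + b'); rewrite !rmorphD; ring.
Qed.

Lemma inKN x : inK d x -> inK d (- x).
Proof. by move=> [a [b ->]]; exists (- a), (- b); rewrite !rmorphN /=; ring. Qed.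

Lemma inKM x y : inK d x -> inK d y -> inK d (x * y).
Proof.
move=> [a [b ->]] [a' [b' ->]].
exists (a * a' + b * b' * d%:~R), (a * b' + b * a').
by rewrite -/w !rmorphD !rmorphM /= ratr_int -sqr_sqrt_d; ring.
Qed.

Lemma inKX x n : inK d x -> inK d (x ^+ n).
Proof.
move=> hx; elim: n => [|n IH]; first exact: (inK_int 1).
by rewrite exprS; apply: inKM.
Qed.

Lemma inK_div x (n : int) : inK d x -> inK d (x / n%:~R).
Proof.
by move=> hx; apply: inKM => //; rewrite -ratr_int -fmorphV; apply: inK_ratr.
Qed.

Lemma inOK_int (n : int) : inOK d n%:~R.
Proof. by split; [apply: inK_int | apply: Aint_int]. Qed.

Lemma inOKD x y : inOK d x -> inOK d y -> inOK d (x + y).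
Proof. by move=> [? ?] [? ?]; split; [apply: inKD | apply: rpredD]. Qed.

Lemma inOKM x y : inOK d x -> inOK d y -> inOK d (x * y).
Proof. by move=> [? ?] [? ?]; split; [apply: inKM | apply: rpredM]. Qed.

Lemma inOKN x : inOK d x -> inOK d (- x).
Proof. by move=> [? ?]; split; [apply: inKN | rewrite rpredN]. Qed.

Lemma inOK_sqrt : inOK d w.
Proof.
split; first exact: inK_sqrt.
by apply: (@Aint_quadratic _ 0 (- d)); rewrite sqr_sqrt_d mul0r subr0 rmorphN /= subrr.
Qed.

(** As d < 0 the root is not real, so complex conjugation is the nontrivial automorphism of the
    field. *)
Lemma conj_sqrt : w^* = - w.
Proof.
have h : (w^*) ^+ 2 = w ^+ 2 by rewrite -rmorphXn /= sqr_sqrt_d rmorph_int.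
move/eqP: h; rewrite eqf_sqr => /orP[/eqP h|/eqP //].
have : 0 <= w ^+ 2 by rewrite real_exprn_even_ge0 //; apply/CrealP.
by rewrite sqr_sqrt_d ler0z leNgt d0.
Qed.

Lemma conj_inK (a b : rat) : (ratr a + ratr b * w)^* = ratr a - ratr b * w.
Proof.
transitivity ((ratr a)^* + (ratr b)^* * w^*); first by rewrite -rmorphM -rmorphD.
by rewrite !(conj_Crat (Crat_rat _)) conj_sqrt mulrN.
Qed.

Lemma inOK_conj x : inOK d x -> inOK d x^*.
Proof.
move=> [[a [b e]] h]; split; last by rewrite Aint_aut.
by exists a, (- b); rewrite e -/w conj_inK rmorphN mulNr.
Qed.

Lemma norm_inOK x : inOK d x -> exists n : int, x * x^* = n%:~R.
Proof.
move=> hx; have [[a [b e]] h] := hx.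
apply/intrP; apply: Cint_rat_Aint; last by rewrite rpredM // Aint_aut.
apply/CratP; exists (a ^+ 2 - b ^+ 2 * d%:~R).
rewrite e -/w conj_inK rmorphB /= rmorphXn /= rmorphM /= rmorphXn /= ratr_int -sqr_sqrt_d; ring.
Qed.

Variable P : algC -> Prop.
Hypothesis hP : prime_ideal d P.

Lemma ideal_nat_prime n : (0 < n)%N -> P n%:R ->
  exists p, prime p /\ P p%:R.
Proof.
have [_ [_ [_ [_ [P1 [Pp _]]]]]] := hP.
elim/ltn_ind: n => n IH n0 Pn; case: (ltnP 1 n) => [n1|n1]; last first.
  by case: P1; rewrite (_ : n = 1%N) in Pn; last by lia.
have pp := pdiv_prime n1; have pn := pdiv_dvd n.
have : P ((pdiv n)%:R * (n %/ pdiv n)%:R) by rewrite -natrM mulnC divnK.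
case/Pp => [||h|h]; try by rewrite pmulrn; apply: inOK_int.
  by exists (pdiv n).
apply: (IH (n %/ pdiv n)%N) => //; first by rewrite ltn_Pdiv // prime_gt1.
by rewrite divn_gt0 ?pdiv_gt0 // dvdn_leq.
Qed.

(** The norm of a nonzero element of P is a nonzero integer in P, and one of its prime factors lies
    in P. *)
Lemma residue_char : exists p, prime p /\ P p%:R.
Proof.
have [PO [_ [_ [PM [_ [_ [x [Px x0]]]]]]]] := hP.
have [n en] := norm_inOK (PO _ Px).
have Pn : P n%:~R by rewrite -en mulrC; apply: PM => //; apply/inOK_conj/PO.
have n0 : n != 0.
  apply: contra_neq x0 => n0; move: en; rewrite n0 => /eqP.
  by rewrite mulf_eq0 fmorph_eq0 orbb => /eqP.
apply: (@ideal_nat_prime `|n|%N); first by rewrite absz_gt0.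
have -> : (`|n|%N)%:R = (Num.sg n)%:~R * n%:~R :> algC.
  by rewrite -intrM -normrEsg -abszE pmulrn.
by apply: PM => //; apply: inOK_int.
Qed.

Lemma ideal_int p (n : int) : prime p -> P p%:R -> P n%:~R -> (p%:Z %| n)%Z.
Proof.
have [_ [_ [PA [PM [P1 _]]]]] := hP.
move=> pp Pp Pn; apply/negPn/negP => npn; apply: P1.
have cop : coprimez p n by rewrite coprimezE prime_coprime.
have /coprimezP[[u v] /= uv] := cop.
have -> : 1 = u%:~R * p%:R + v%:~R * n%:~R :> algC by rewrite [p%:R]pmulrn -!intrM -intrD uv.
by apply: PA; apply: PM => //; apply: inOK_int.
Qed.

Lemma inOP_OK x : inOK d x -> inOP d P x.
Proof.
have [_ [_ [_ [_ [P1 _]]]]] := hP.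
by move=> hx; exists x, 1; split=> //; [apply: (inOK_int 1) | rewrite mulr1].
Qed.

Lemma inOP_int (n : int) : inOP d P n%:~R.
Proof. exact/inOP_OK/inOK_int. Qed.

Lemma inOPD x y : inOP d P x -> inOP d P y -> inOP d P (x + y).
Proof.
have [_ [_ [_ [_ [_ [Pp _]]]]]] := hP.
move=> [a [b [ha hb nb e]]] [a' [b' [ha' hb' nb' e']]].
exists (a * b' + a' * b), (b * b'); split.
- by apply: inOKD; apply: inOKM.
- exact: inOKM.
- by case/Pp.
- by rewrite -e -e'; ring.
Qed.

Lemma inOPM x y : inOP d P x -> inOP d P y -> inOP d P (x * y).
Proof.
have [_ [_ [_ [_ [_ [Pp _]]]]]] := hP.
move=> [a [b [ha hb nb e]]] [a' [b' [ha' hb' nb' e']]].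
exists (a * a'), (b * b'); split; [exact: inOKM|exact: inOKM|by case/Pp|].
by rewrite -e -e'; ring.
Qed.

Lemma inOPN x : inOP d P x -> inOP d P (- x).
Proof.
by move=> [a [b [ha hb nb e]]]; exists (- a), b; split=> //; [apply: inOKN | rewrite -e mulNr].
Qed.

Lemma inOPB x y : inOP d P x -> inOP d P y -> inOP d P (x - y).
Proof. by move=> hx hy; apply: inOPD => //; apply: inOPN. Qed.

Lemma inOPX x n : inOP d P x -> inOP d P (x ^+ n).
Proof.
move=> hx; elim: n => [|n IH]; first exact: (inOP_int 1).
by rewrite exprS; apply: inOPM.
Qed.

Lemma nideal_neq0 x : ~ P x -> x != 0.
Proof. by have [_ [P0 _]] := hP; move=> nP; apply/eqP => x0; apply: nP; rewrite x0. Qed.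

Lemma inOP_inv x : inOK d x -> ~ P x -> inOP d P x^-1.
Proof.
move=> hx nP; exists 1, x; split=> //; first exact: (inOK_int 1).
by rewrite mulVf // nideal_neq0.
Qed.

(** With x = a/b and y = a'/b' one has a a' = b b', which is outside the prime P; hence so is the
    numerator a. *)
Lemma unitOP_pair x y : inOP d P x -> inOP d P y -> x * y = 1 -> unitOP d P x.
Proof.
have [_ [_ [_ [PM [_ [Pp _]]]]]] := hP.
move=> [a [b [ha hb nb e]]] [a' [b' [ha' hb' nb' e']]] xy.
exists a, b; split=> // Pa.
have : P (b * b').
  have -> : b * b' = a' * a.
    by rewrite -e -e' -[LHS]mul1r -xy; ring.
  exact: PM.
by case/Pp.
Qed.

Lemma unitOP_OK x : inOK d x -> ~ P x -> unitOP d P x.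
Proof.
by move=> hx nP; apply: unitOP_pair (inOP_OK hx) (inOP_inv hx nP) _; rewrite divff // nideal_neq0.
Qed.

Lemma unitOP_inOP x : unitOP d P x -> inOP d P x.
Proof. by move=> [a [b [? ? ? ? ?]]]; exists a, b. Qed.

Lemma unitOP_neq0 x : unitOP d P x -> x != 0.
Proof.
move=> [a [b [ha hb na nb e]]]; apply/eqP => x0; apply: na; rewrite -e x0 mul0r.
by have [_ []] := hP.
Qed.

Lemma unitOP_inv x : unitOP d P x -> inOP d P x^-1.
Proof.
move=> hx; have x0 := unitOP_neq0 hx; move: hx => [a [b [ha hb na nb e]]].
exists b, a; split=> //; by rewrite -e mulKf.
Qed.

Lemma unitOPV x : unitOP d P x -> unitOP d P x^-1.
Proof.
move=> hx; apply: unitOP_pair (unitOP_inv hx) (unitOP_inOP hx) _.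
by rewrite mulVf // unitOP_neq0.
Qed.

Lemma unitOPM x y : unitOP d P x -> unitOP d P y -> unitOP d P (x * y).
Proof.
move=> hx hy; apply: (@unitOP_pair _ (x^-1 * y^-1)).
- by apply: inOPM; apply: unitOP_inOP.
- by apply: inOPM; apply: unitOP_inv.
by rewrite mulrACA !divff ?unitOP_neq0 // mulr1.
Qed.

Lemma unitOPX x n : unitOP d P x -> unitOP d P (x ^+ n).
Proof.
move=> hx; elim: n => [|n IH]; last by rewrite exprS; apply: unitOPM.
by apply: (@unitOP_pair _ 1); rewrite ?mulr1 //; apply: (inOP_int 1).
Qed.

Lemma unitOP_int p (n : int) : prime p -> P p%:R -> ~~ (p%:Z %| n)%Z -> unitOP d P n%:~R.
Proof.
move=> pp Pp npn; apply: unitOP_OK; first exact: inOK_int.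
by move=> Pn; move: npn; rewrite (ideal_int pp Pp Pn).
Qed.

Lemma inOP_frac x p (n : int) : prime p -> P p%:R -> ~~ (p%:Z %| n)%Z ->
  inOP d P x -> inOP d P (x / n%:~R).
Proof. by move=> pp Pp npn hx; apply: inOPM => //; apply/unitOP_inv/(unitOP_int pp Pp). Qed.

End LocalRing.

(** * Integral models *)

Section Models.
Local Open Scope ring_scope.

Definition wc6 (E : weier) := - wb2 E ^+ 3 + 36 * wb2 E * wb4 E - 216 * wb6 E.

Definition short_weier (c4 c6 : algC) := Weier 0 0 0 (- c4 / 48) (- c6 / 864).

Lemma wdisc_c46 E : 1728 * wdisc E = wc4 E ^+ 3 - wc6 E ^+ 2.
Proof. by case: E => a b c e f; rewrite /wdisc /wc4 /wc6 /wb2 /wb4 /wb6 /wb8 /=; ring. Qed.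

Lemma short_weier_c4 c4 c6 : wc4 (short_weier c4 c6) = c4.
Proof. by rewrite /wc4 /wb2 /wb4 /=; field. Qed.

Lemma short_weier_c6 c4 c6 : wc6 (short_weier c4 c6) = c6.
Proof. by rewrite /wc6 /wb2 /wb4 /wb6 /=; field. Qed.

(** These values of r, s and t undo the completion of the square and of the cube. *)
Lemma short_weier_change E u c4 c6 : u != 0 ->
  u ^+ 4 * wc4 E = c4 -> u ^+ 6 * wc6 E = c6 ->
  wchange (short_weier c4 c6) E u (u ^+ 2 * wb2 E / 12) (u * a1 E / 2) (u ^+ 3 * a3 E / 2).
Proof.
move=> u0 <- <-; split=> //.
case: E => a b c e f; rewrite /wc4 /wc6 /wb2 /wb4 /wb6 /=.
by split; field.
Qed.

Variables (d : int) (P : algC -> Prop) (D A t : int).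
Hypothesis d0 : d < 0.
Hypothesis hP : prime_ideal d P.
Hypothesis hA : D * t ^+ 2 = A ^+ 3 - 1728.
Variables (mu u m delta : algC).
Hypothesis u0 : u != 0.
Hypothesis Ku : inK d u.
Hypothesis Kdelta : inK d delta.
Hypothesis Om : unitOP d P m.
Hypothesis Odelta : inOP d P delta.
Hypothesis delta2 : delta ^+ 2 = D%:~R * m.
Hypothesis um4 : u ^+ 4 * m = D%:~R * mu ^+ 2.
Hypothesis um6 : u ^+ 6 * (delta * m) = D%:~R ^+ 2 * mu ^+ 3.

Let AC : algC := A%:~R.
Let tC : algC := t%:~R.
Let DC : algC := D%:~R.

Lemma hAC : DC * tC ^+ 2 = AC ^+ 3 - 1728.
Proof.
by rewrite /DC /tC /AC -!rmorphXn -rmorphM /= hA rmorphB /= rmorphXn.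
Qed.

Let E0 := short_weier (AC * DC * mu ^+ 2) (DC ^+ 2 * tC * mu ^+ 3).

(** c4 and c6 determine the discriminant, here m^3 (A^3 - D t^2) / 1728 = m^3, a unit. The lemmas
    that follow only have to exhibit an integral model with these invariants. *)
Lemma model_good E : wc4 E = AC * m -> wc6 E = tC * delta * m ->
  inK d (a1 E) -> inK d (a2 E) -> inK d (a3 E) ->
  inOP d P (a1 E) -> inOP d P (a2 E) -> inOP d P (a3 E) ->
  inOP d P (a4 E) -> inOP d P (a6 E) -> good_red_at d E0 P.
Proof.
move=> h4 h6 K1 K2 K3 O1 O2 O3 O4 O6.
have hdisc : wdisc E = m ^+ 3.
  apply: (@mulfI _ (1728 : algC)); first by rewrite pnatr_eq0.
  rewrite wdisc_c46 h4 h6.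
  transitivity (m ^+ 3 * (AC ^+ 3) - tC ^+ 2 * delta ^+ 2 * m ^+ 2); first by ring.
  rewrite delta2 -/DC.
  transitivity (m ^+ 3 * (AC ^+ 3 - DC * tC ^+ 2)); first by ring.
  by rewrite hAC; ring.
exists E, u, (u ^+ 2 * wb2 E / 12), (u * a1 E / 2), (u ^+ 3 * a3 E / 2).
split; last split.
- split=> //.
  + apply: (@inK_div d _ 12); apply: inKM; first exact: inKX.
    by apply: inKD; [apply: inKX | apply: inKM => //; apply: (inK_int _ 4)].
  + by apply: (@inK_div d _ 2); apply: inKM.
  + by apply: (@inK_div d _ 2); apply: inKM => //; apply: inKX.
- apply: short_weier_change => //.
    by rewrite h4 mulrCA um4 /DC mulrA.
  by rewrite h6 -mulrA mulrCA um6 /DC; ring.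
by split=> //; rewrite hdisc; apply: unitOPX.
Qed.

Lemma model_away6 : inOP d P (AC / 48) -> inOP d P (tC / 864) -> good_red_at d E0 P.
Proof.
move=> h1 h2; have K0 : inK d 0 by apply: (inK_int _ 0).
have O0 : inOP d P 0 by apply: (inOP_int hP 0).
apply: (@model_good (short_weier (AC * m) (tC * delta * m))) => //=.
- exact: short_weier_c4.
- exact: short_weier_c6.
- rewrite mulNr mulrAC; apply: inOPN => //; apply: inOPM => //; exact: unitOP_inOP.
- rewrite mulNr -mulrA mulrAC; apply: inOPN => //; apply: inOPM => //.
  by apply: inOPM => //; exact: unitOP_inOP.
Qed.

(* The twist of y^2 + x y = x^3 - 36 x / (j - 1728) - 1 / (j - 1728) with the
   given c4 and c6, up to the choice of a1 with a1^2 = e. *)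
Lemma model_A_unit (e : int) : e ^+ 2 = e -> unitOP d P AC ->
  inOP d P ((- tC * delta / AC - e%:~R) / 4) -> good_red_at d E0 P.
Proof.
move=> e2 uA h.
have A0 : AC != 0 by apply: unitOP_neq0 uA.
have e2C : (e%:~R : algC) ^+ 2 = e%:~R by rewrite -rmorphXn /= e2.
have O0 : inOP d P 0 by apply: (inOP_int hP 0).
have Ke : inK d e%:~R by apply: inK_int.
pose E := Weier e%:~R ((- tC * delta / AC - e%:~R) / 4) 0 (- 36 * m / AC ^+ 2)
   (tC * delta * m / AC ^+ 3).
have hb2 : wb2 E = - tC * delta / AC by rewrite /wb2 /= e2C; field.
have hb4 : wb4 E = - 72 * m / AC ^+ 2 by rewrite /wb4 /=; field.
have hb6 : wb6 E = 4 * tC * delta * m / AC ^+ 3 by rewrite /wb6 /=; field.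
have key : tC ^+ 2 * delta ^+ 2 = m * (AC ^+ 3 - 1728).
  by rewrite -hAC delta2 /DC; ring.
apply: (@model_good E) => //=.
- rewrite /wc4 hb2 hb4.
  transitivity ((tC ^+ 2 * delta ^+ 2 + 1728 * m) / AC ^+ 2); first by field.
  by rewrite key; field.
- rewrite /wc6 hb2 hb4 hb6.
  transitivity (tC * delta * (tC ^+ 2 * delta ^+ 2 + 1728 * m) / AC ^+ 3); first by field.
  by rewrite key; field.
- apply: (@inK_div d _ 4); apply: inKD; last exact: inKN.
  by apply: inK_div; apply: inKM => //; apply: inKN; apply: inK_int.
- exact: (inK_int _ 0).
- exact: inOP_int.
- apply: inOPM => //; last by apply: unitOP_inv => //; apply: unitOPX.
  by apply: inOPM => //; [apply: (inOP_int hP (- 36)) | apply: unitOP_inOP].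
- apply: inOPM => //; last by apply: unitOP_inv => //; apply: unitOPX.
  by apply: inOPM => //; [apply: inOPM => //; apply: inOP_int | apply: unitOP_inOP].
Qed.

(** With a3 = 1 and a1 = a2 = 0 one has c4 = -48 a4 and c6 = -216 (1 + 4 a6); solving for a4 and a6
    gives the two conditions. It serves the primes above 2 when 16 divides A. *)
Lemma model_16 : inOP d P (AC / 48) -> inOP d P ((- tC * delta * m / 216 - 1) / 4) ->
  good_red_at d E0 P.
Proof.
move=> h1 h2; have O0 : inOP d P 0 by apply: (inOP_int hP 0).
have O1 : inOP d P 1 by apply: (inOP_int hP 1).
have K0 : inK d 0 by apply: (inK_int _ 0).
have K1 : inK d 1 by apply: (inK_int _ 1).
apply: (@model_good (Weier 0 0 1 (- (AC / 48 * m)) ((- tC * delta * m / 216 - 1) / 4))) => //=.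
- by rewrite /wc4 /wb2 /wb4 /=; field.
- by rewrite /wc6 /wb2 /wb4 /wb6 /=; field.
- by apply: inOPN => //; apply: inOPM => //; apply: unitOP_inOP.
Qed.

(** With a1 = w and a3 = 1, the integer b prescribes b2 = 2 b; then a2, a4 and a6 are forced by b2,
    c4 and c6. It serves the ramified prime above 2. *)
Lemma model_4 (b : int) (w : algC) : w ^+ 2 = d%:~R -> inK d w -> inOP d P w ->
  inOP d P ((2 * b%:~R - d%:~R) / 4) ->
  inOP d P ((4 * b%:~R ^+ 2 - AC * m - 24 * w) / 48) ->
  inOP d P ((8 * b%:~R ^+ 3 - 6 * b%:~R * (AC * m) - 2 * (tC * delta * m) - 432) / 1728) ->
  good_red_at d E0 P.
Proof.
move=> w2 Kw Ow h2 h4 h6.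
have O1 : inOP d P 1 by apply: (inOP_int hP 1).
have K1 : inK d 1 by apply: (inK_int _ 1).
pose E := Weier w ((2 * b%:~R - d%:~R) / 4) 1 ((4 * b%:~R ^+ 2 - AC * m - 24 * w) / 48)
   ((8 * b%:~R ^+ 3 - 6 * b%:~R * (AC * m) - 2 * (tC * delta * m) - 432) / 1728).
have hb2 : wb2 E = 2 * b%:~R by rewrite /wb2 /= w2; field.
have hb4 : wb4 E = (4 * b%:~R ^+ 2 - AC * m) / 24 by rewrite /wb4 /=; field.
have hb6 : wb6 E = (8 * b%:~R ^+ 3 - 6 * b%:~R * (AC * m) - 2 * (tC * delta * m)) / 432.
  by rewrite /wb6 /=; field.
apply: (@model_good E) => //=.
- by rewrite /wc4 hb2 hb4; field.
- by rewrite /wc6 hb2 hb4 hb6; field.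
- rewrite -(intrM _ 2) -intrB; apply: (@inK_div d _ 4); exact: inK_int.
Qed.

End Models.

(** * Congruences modulo 8 and 4 for the model at 2 when D is even *)

Section ModEight.
Local Open Scope ring_scope.

Definition oddz (x : int) := exists k : int, x = 2 * k + 1.

Lemma oddz_sqr x : oddz x -> exists k : int, x ^+ 2 = 1 + 8 * k.
Proof.
move=> [k ->].
have [j ej] : exists j : int, k * (k + 1) = 2 * j.
  have : (2 %| k * (k + 1))%Z.
    have [/dvdzP[j ->]|/dvdzP[j ej]] : (2 %| k)%Z \/ (2 %| k + 1)%Z by lia.
      by rewrite -mulrA mulrC dvdz_mulr // dvdz_mulr.
    by rewrite ej dvdz_mull // dvdz_mull.
  by case/dvdzP => j ->; exists j; rewrite mulrC.
exists j; transitivity (1 + 4 * (k * (k + 1))); first by ring.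
by rewrite ej; ring.
Qed.

Lemma oddzM x y : oddz x -> oddz y -> oddz (x * y).
Proof. by move=> [k ->] [l ->]; exists (2 * k * l + k + l); ring. Qed.

Lemma oddz_ndvd x : ~~ (2 %| x)%Z -> oddz x.
Proof. by move=> h; exists (x %/ 2)%Z; lia. Qed.

Lemma ndvd_oddz x : oddz x -> ~~ (2 %| x)%Z.
Proof. by move=> [k ->]; lia. Qed.

Lemma dvdz_Zp (n : nat) (k : int) : (1 < n)%N -> (k%:~R = 0 :> 'Z_n) -> (n%:Z %| k)%Z.
Proof.
move=> n1 h; have aux (j : nat) : (j%:R = 0 :> 'Z_n) -> (n %| j)%N.
  by move/(congr1 val); rewrite /= Zp_nat /= Zp_cast // => /eqP.
rewrite dvdzE /=; apply: aux; move: h; case: k => j; first by rewrite -pmulrn.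
by rewrite NegzE mulrNz -pmulrn => /eqP; rewrite oppr_eq0 => /eqP.
Qed.

Lemma natr_Zp_self n : (1 < n)%N -> n%:R = 0 :> 'Z_n.
Proof. by move=> n1; apply: val_inj; rewrite /= Zp_nat /= Zp_cast // modnn. Qed.

Section Ring8.
Variables (A : comNzRingType) (x y b D q t : A).
Hypothesis h8 : (8 : A) = 0.
Hypothesis hx : x ^+ 2 = 1.
Hypothesis hy : y ^+ 2 = 1.
Hypothesis hb : b ^+ 2 = 1.
Hypothesis hx4 : 4 * x = 4.
Hypothesis hy4 : 4 * y = 4.
Hypothesis hb4 : 4 * b = 4.
Hypothesis hD : 2 * D = 4.
Hypothesis hDD : D ^+ 2 = 4.
Hypothesis hq : q = 1 + D.
Hypothesis ht4 : 4 * t = 4.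
Hypothesis ht2 : 2 * t = - (2 * b * x).

(** In the application the ring is Z/8, the integers x, y, b, t are odd, D = 2 modulo 4, and q^2 m =
    M0 + M1 sqrt(D q). *)
Let M0 := q * y ^+ 2 + x ^+ 2 * D.
Let M1 := 2 * x * y.

Lemma ring8_q2 : q ^+ 2 = 1.
Proof.
rewrite hq; transitivity (1 + 2 * D + D ^+ 2); first by ring.
by rewrite hD hDD; transitivity (1 + (8 : A)); [ring | rewrite h8 addr0].
Qed.

Lemma ring8_q4 : 4 * q = 4.
Proof. by rewrite hq; transitivity (4 + 2 * (2 * D)); [ring | rewrite hD -[RHS]addr0 -h8; ring]. Qed.

Lemma ring8_M0 : M0 = 5.
Proof. by rewrite /M0 hx hy hq; transitivity (1 + 2 * D); [ring | rewrite hD; ring]. Qed.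

(** This is the rational part of 216 q^3 a6 for the a6 of [model_4], and [ring8_sqrt] treats the
    coefficient of sqrt(D q). The factor 8 of 216 has to cancel. Multiples of 4 are collected, where
    odd elements act as 1. *)
Lemma ring8_const :
  q ^+ 3 * b ^+ 3 - 3 * b * (2 * b - 1) * (q * M0)
    - 2 * t * (x * D * M0 + y * M1 * (D * q)) - 54 * q ^+ 3 = 0.
Proof.
rewrite ring8_M0 /M1.
transitivity (q ^+ 2 * q * (b ^+ 2 * b - 54) - 15 * q * (2 * b ^+ 2 - b)
  - t * x * (2 * D) * (5 + 2 * y ^+ 2 * q)); first by ring.
rewrite ring8_q2 hb hy hD.
transitivity (4 * (4 * b) * q - 21 * (4 * q) - (4 * t) * x * (5 + 2 * q)); first by ring.
rewrite hb4 ht4 ring8_q4.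
transitivity (4 * (4 * q) - 84 - 5 * (4 * x) - 2 * (4 * x) * q); first by ring.
rewrite ring8_q4 hx4.
transitivity (- 88 - 2 * (4 * q) : A); first by ring.
rewrite ring8_q4; transitivity (- 12 * (8 : A)); first by ring.
by rewrite h8 mulr0.
Qed.

Lemma ring8_sqrt :
  - 3 * b * (2 * b - 1) * (q * M1) - 2 * t * (y * M0 + x * D * M1) = 0.
Proof.
rewrite ring8_M0 /M1.
transitivity (- 3 * (4 * x) * y * q * b ^+ 2 + 6 * b * q * x * y
   - 2 * t * (5 * y + x ^+ 2 * y * (2 * D))); first by ring.
rewrite hb hx hD ht2 hx4 hq.
transitivity (- 3 * (4 * y) - 6 * y * (2 * D) + 6 * b * x * y + 3 * b * x * y * (2 * D)
  + 18 * b * x * y); first by ring.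
rewrite hD; transitivity ((8 : A) * (3 * b * x * y) - 9 * (4 * y) + 3 * (4 * b) * x * y); first by ring.
rewrite hb4 h8 mul0r add0r.
transitivity (- 9 * (4 * y) + 3 * (4 * x) * y); first by ring.
rewrite hx4; transitivity (- 6 * (4 * y)); first by ring.
by rewrite hy4; transitivity (- 3 * (8 : A)); [ring | rewrite h8 mulr0].
Qed.

End Ring8.

Lemma mod8_congruences (x y b D q t : int) : oddz x -> oddz y -> oddz b ->
  (exists k, D = 2 + 4 * k) -> (exists k, q = 1 + D + 8 * k) -> (exists k, t = - b * x + 4 * k) ->
  (8 %| q ^+ 3 * b ^+ 3 - 3 * b * (2 * b - 1) * (q * (q * y ^+ 2 + x ^+ 2 * D))
    - 2 * t * (x * D * (q * y ^+ 2 + x ^+ 2 * D) + y * (2 * x * y) * (D * q)) - 54 * q ^+ 3)%Z /\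
  (8 %| - 3 * b * (2 * b - 1) * (q * (2 * x * y))
    - 2 * t * (y * (q * y ^+ 2 + x ^+ 2 * D) + x * D * (2 * x * y)))%Z.
Proof.
move=> ox oy ob [kD eD] [kq eq] [kt et].
pose f := fun n : int => n%:~R : 'Z_8.
have h8 : (8 : 'Z_8) = 0 by apply: natr_Zp_self.
have h8i k : f (8 * k) = 0 by rewrite /f intrM -[8%:~R]pmulrn h8 mul0r.
have sq z : oddz z -> f z ^+ 2 = 1.
  by case/oddz_sqr => k e; rewrite /f -rmorphXn /= e intrD -/(f (8 * k)) h8i addr0.
have f4 z : oddz z -> 4 * f z = 4.
  move=> [k ->]; rewrite /f -[4 in LHS]/(4%:~R) -intrM (_ : 4 * (2 * k + 1) = 8 * k + 4); last by ring.
  by rewrite intrD -/(f (8 * k)) h8i add0r.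
have hD : 2 * f D = 4.
  by rewrite /f eD -[2 in LHS]/(2%:~R) -intrM (_ : 2 * (2 + 4 * kD) = 4 + 8 * kD) ?intrD -?/(f (8 * kD)) ?h8i ?addr0 //; ring.
have hDD : f D ^+ 2 = 4.
  rewrite /f -rmorphXn /= eD (_ : (2 + 4 * kD) ^+ 2 = 4 + 8 * (2 * kD + 2 * kD ^+ 2)); last by ring.
  by rewrite intrD -/(f (8 * _)) h8i addr0.
have hq : f q = 1 + f D by rewrite /f eq intrD -/(f (8 * kq)) h8i addr0 intrD.
have [kx ex] := ox; have [kb eb] := ob.
have ot : oddz t.
  by exists (- 2 * kb * kx - kb - kx - 1 + 2 * kt); rewrite et ex eb; ring.
have ht2 : 2 * f t = - (2 * f b * f x).
  rewrite /f -[2 in LHS]/(2%:~R) -[2 in RHS]/(2%:~R) -!intrM -mulrNz et.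
  by rewrite (_ : 2 * (- b * x + 4 * kt) = - (2 * b * x) + 8 * kt) ?intrD -?/(f (8 * kt)) ?h8i ?addr0 //; ring.
have c1 := ring8_const h8 (sq _ ox) (sq _ oy) (sq _ ob) (f4 _ ox) (f4 _ ob) hD hDD hq (f4 _ ot).
have c2 := ring8_sqrt h8 (sq _ ox) (sq _ oy) (sq _ ob) (f4 _ ox) (f4 _ oy) (f4 _ ob) hD hq ht2.
split; apply: (@dvdz_Zp 8) => //.
  by rewrite -c1 /f !(rmorphD, rmorphB, rmorphN, rmorphM, rmorphXn) /=.
by rewrite -c2 /f !(rmorphD, rmorphB, rmorphN, rmorphM, rmorphXn) /=.
Qed.

(** The two coordinates of 12 q^2 a4 for the a4 of [model_4]; the factor 4 of 12 has to cancel. *)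
Lemma mod4_congruences (x y b D q : int) : oddz x -> oddz y -> oddz b ->
  (exists k, D = 2 + 4 * k) -> (exists k, q = 3 + 4 * k) ->
  (4 %| q ^+ 2 * b ^+ 2 - (2 * b - 1) * (q * y ^+ 2 + x ^+ 2 * D))%Z /\
  (4 %| - (2 * b - 1) * (2 * x * y) - 6 * q ^+ 2)%Z.
Proof.
move=> ox oy ob [kD eD] [kq eq].
pose f := fun n : int => n%:~R : 'Z_4.
have h4 : (4 : 'Z_4) = 0 by apply: natr_Zp_self.
have h4i k : f (4 * k) = 0 by rewrite /f intrM -[4%:~R]pmulrn h4 mul0r.
have sq z : oddz z -> f z ^+ 2 = 1.
  case/oddz_sqr => k e; rewrite /f -rmorphXn /= e (_ : 8 * k = 4 * (2 * k)); last by ring.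
  by rewrite intrD -/(f (4 * _)) h4i addr0.
have f2 z : oddz z -> 2 * f z = 2.
  move=> [k ->]; rewrite /f -[2 in LHS]/(2%:~R) -intrM (_ : 2 * (2 * k + 1) = 4 * k + 2); last by ring.
  by rewrite intrD -/(f (4 * k)) h4i add0r.
have hD : f D = 2 by rewrite /f eD intrD -/(f (4 * kD)) h4i addr0.
have hq : f q = 3 by rewrite /f eq intrD -/(f (4 * kq)) h4i addr0.
split; apply: (@dvdz_Zp 4) => //.
  transitivity (f q ^+ 2 * f b ^+ 2 - (2 * f b - 1) * (f q * f y ^+ 2 + f x ^+ 2 * f D)).
    by rewrite /f !(rmorphD, rmorphB, rmorphN, rmorphM, rmorphXn) /=.
  rewrite (sq b) // (sq y) // (sq x) // (f2 b) // hD hq; transitivity (4 : 'Z_4); [ring | exact: h4].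
transitivity (- (2 * f b - 1) * (2 * f x * f y) - 6 * f q ^+ 2).
  by rewrite /f !(rmorphD, rmorphB, rmorphN, rmorphM, rmorphXn) /=.
rewrite (f2 x) // (f2 y) // (f2 b) // hq; transitivity (- 14 * (4 : 'Z_4)); first by ring.
by rewrite h4 mulr0.
Qed.

End ModEight.

(** * Reduction of the twisted curve *)

Section CurveLocal.
Local Open Scope ring_scope.

Lemma squarefree_ndvd (d : int) p : squarefree d -> prime p -> ~~ ((p%:Z ^+ 2) %| d)%Z.
Proof.
move=> [_ h] pp; apply/negP => hd.
have : p = 1%N by apply: h; move: hd; rewrite dvdzE abszX.
by move=> p1; rewrite p1 in pp.
Qed.

Lemma dvdz_sqr_mul p (a v : int) : prime p -> ~~ ((p%:Z ^+ 2) %| a)%Z ->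
  ((p%:Z ^+ 2) %| a * v ^+ 2)%Z -> (p%:Z %| v)%Z.
Proof.
move=> pp na h; apply/negPn/negP => nv; move/negP: na; apply.
move: h; rewrite Gauss_dvdzl // coprimezE !abszX coprimeXl // coprimeXr //.
by rewrite prime_coprime.
Qed.

Variables (D q A t X Y Z s : int).
Local Notation d := (D * q).
Hypothesis d0 : d < 0.
Hypothesis dsq : squarefree d.
Hypothesis hR : in_Rset A.
Hypothesis hA : D * t ^+ 2 = A ^+ 3 - 1728.
Hypothesis hN : D * X ^+ 2 - q * Y ^+ 2 = 4 * s * Z ^+ 2.
Hypothesis s2 : s ^+ 2 = 1.
Hypothesis Z0 : Z != 0.
Hypothesis hgcd : forall p, prime p -> (p%:Z %| X)%Z -> (p%:Z %| Y)%Z -> (p%:Z %| Z)%Z -> False.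

Let w : algC := sqrtC (D * q)%:~R.
Definition twist_mu : algC := (D%:~R * X%:~R + Y%:~R * w) / 2.
Let mu := twist_mu.
Let w2 : w ^+ 2 = (D * q)%:~R. Proof. exact: sqr_sqrt_d. Qed.

Lemma D_neq0 : D != 0. Proof. by apply: contraTneq d0 => ->; rewrite mul0r. Qed.
Lemma q_neq0 : q != 0. Proof. by apply: contraTneq d0 => ->; rewrite mulr0. Qed.

Let D0C : (D%:~R : algC) != 0. Proof. by rewrite intr_eq0 D_neq0. Qed.
Let q0C : (q%:~R : algC) != 0. Proof. by rewrite intr_eq0 q_neq0. Qed.
Let Z0C : (Z%:~R : algC) != 0. Proof. by rewrite intr_eq0. Qed.

Let w0 : w != 0.
Proof. by rewrite -sqrf_eq0 w2 intr_eq0 mulf_neq0 ?D_neq0 ?q_neq0. Qed.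

Lemma Dsqr_ndvd p : prime p -> ~~ ((p%:Z ^+ 2) %| D)%Z.
Proof. by move=> pp; apply: contra (squarefree_ndvd dsq pp); apply: dvdz_mulr. Qed.

Lemma qsqr_ndvd p : prime p -> ~~ ((p%:Z ^+ 2) %| q)%Z.
Proof. by move=> pp; apply: contra (squarefree_ndvd dsq pp); apply: dvdz_mull. Qed.

Lemma q_ndvd p : prime p -> (p%:Z %| D)%Z -> ~~ (p%:Z %| q)%Z.
Proof.
move=> pp pD; apply: contra (squarefree_ndvd dsq pp) => pq.
by rewrite expr2 dvdz_mul.
Qed.

Let mu_conj : mu^* = (D%:~R * X%:~R - Y%:~R * w) / 2.
Proof.
rewrite /mu /twist_mu fmorph_div rmorphD !rmorphM /= !rmorph_int rmorph_nat.
by rewrite conj_sqrt // mulrN.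
Qed.

Let mu_trace : mu + mu^* = D%:~R * X%:~R.
Proof. by rewrite mu_conj /mu /twist_mu; field. Qed.

Let hNC : D%:~R * X%:~R ^+ 2 - q%:~R * Y%:~R ^+ 2 = 4 * s%:~R * Z%:~R ^+ 2 :> algC.
Proof.
by rewrite -[4]/(4%:~R) -!rmorphXn -!intrM -intrB hN.
Qed.

Let s2C : (s%:~R : algC) ^+ 2 = 1.
Proof. by rewrite -rmorphXn /= s2. Qed.

Let mu_norm : mu * mu^* = D%:~R * s%:~R * Z%:~R ^+ 2.
Proof.
rewrite mu_conj /mu /twist_mu.
transitivity ((D%:~R ^+ 2 * X%:~R ^+ 2 - Y%:~R ^+ 2 * w ^+ 2) / 4); first by field.
rewrite w2 intrM.
transitivity (D%:~R * (D%:~R * X%:~R ^+ 2 - q%:~R * Y%:~R ^+ 2) / 4 : algC); first by field.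
by rewrite hNC; field.
Qed.

Let Kw : inK (D * q) w. Proof. exact: inK_sqrt. Qed.

Let Kmu : inK (D * q) mu.
Proof.
apply: (@inK_div _ _ 2); apply: inKD; first by apply: inKM; apply: inK_int.
by apply: inKM => //; apply: inK_int.
Qed.

Let OKmu : inOK (D * q) mu.
Proof.
split=> //; apply: (@Aint_quadratic _ (D * X) (D * s * Z ^+ 2)).
rewrite intrM [X in _ + X](_ : _ = mu * mu^*) -?mu_trace; first by ring.
by rewrite mu_norm -rmorphXn -!intrM.
Qed.

Let s0 : s != 0.
Proof. by apply: contra_eq_neq s2 => ->. Qed.

Let mu_neq0 : mu != 0.
Proof.
apply: contra_eq_neq mu_norm => ->; rewrite mul0r eq_sym.
by rewrite !mulf_neq0 // ?expf_neq0 // intr_eq0.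
Qed.

Variable P : algC -> Prop.
Hypothesis hP : prime_ideal (D * q) P.
Variable p : nat.
Hypothesis pp : prime p.
Hypothesis Pp : P p%:R.

Let E0 := short_weier (A%:~R * D%:~R * mu ^+ 2) (D%:~R ^+ 2 * t%:~R * mu ^+ 3).

(* Over a prime not dividing D one takes m = D nu^2, delta = D nu with
   nu = mu / u^2; over a prime dividing D, u = w, m = nu^2 / q, delta = w nu / q
   with nu = mu / w.  Either way c4 / u^4 = A m and c6 / u^6 = t delta m. *)
Definition local_data (u m delta : algC) : Prop :=
  [/\ u != 0, inK (D * q) u, inK (D * q) delta & unitOP (D * q) P m] /\
  [/\ inOP (D * q) P delta, delta ^+ 2 = D%:~R * m, u ^+ 4 * m = D%:~R * mu ^+ 2
    & u ^+ 6 * (delta * m) = D%:~R ^+ 2 * mu ^+ 3].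

(** Otherwise the trace D X and the norm D s Z^2 lie in P, so p divides X and Z, and then Y because
    q is square-free, against primitivity. *)
Lemma not_both_conj : ~~ (p%:Z %| D)%Z -> ~ P mu \/ ~ P mu^*.
Proof.
move=> pD; have [_ [_ [PA [PM [_ [Pmul _]]]]]] := hP.
have [h1|h1] := pselect (P mu); last by left.
have [h2|h2] := pselect (P mu^*); last by right.
exfalso.
have pX : (p%:Z %| X)%Z.
  have : P (D * X)%:~R by rewrite intrM -mu_trace; apply: PA.
  by move/(ideal_int hP pp Pp); rewrite Euclid_dvdzM // (negbTE pD).
have pZ : (p%:Z %| Z)%Z.
  have : P (D * s * Z ^+ 2)%:~R.
    have -> : (D * s * Z ^+ 2)%:~R = mu * mu^* by rewrite mu_norm -rmorphXn -!intrM.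
    by apply: PM => //; exact: OKmu.
  move/(ideal_int hP pp Pp); rewrite expr2 !Euclid_dvdzM // (negbTE pD) /= orbb.
  case/orP => // ps; exfalso.
  have : (p%:Z %| s ^+ 2)%Z by rewrite expr2 dvdz_mull.
  by rewrite s2 dvdzE /= dvdn1 => /eqP p1; move: pp; rewrite p1.
have pY : (p%:Z %| Y)%Z.
  apply: (dvdz_sqr_mul pp (qsqr_ndvd pp)).
  have -> : q * Y ^+ 2 = D * X ^+ 2 - 4 * s * Z ^+ 2 by rewrite -hN; ring.
  by apply: rpredB; apply: dvdz_mull; rewrite !expr2 dvdz_mul.
exact: hgcd pX pY pZ.
Qed.

Lemma local_data_unramified u nu : ~~ (p%:Z %| D)%Z -> u != 0 -> inK (D * q) u ->
  inK (D * q) nu -> unitOP (D * q) P nu -> u ^+ 2 * nu = mu ->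
  local_data u (D%:~R * nu ^+ 2) (D%:~R * nu).
Proof.
move=> pD u0 Ku Knu Onu e; split; split=> //.
- by apply: inKM => //; apply: inK_int.
- by apply: unitOPM => //; [apply: (unitOP_int hP pp Pp) | apply: unitOPX].
- by apply: inOPM => //; [apply: inOP_int | apply: unitOP_inOP].
- by ring.
- by rewrite -e; ring.
by rewrite -e; ring.
Qed.

(** If mu is outside P, u = 1 works. Otherwise the conjugate of mu is a unit at P, and so is mu /
    Z^2 = D s / conj(mu): scaling by u = Z removes the factor Z^2 that mu carries at P. *)
Lemma unramified_choice : ~~ (p%:Z %| D)%Z -> exists u nu,
  local_data u (D%:~R * nu ^+ 2) (D%:~R * nu) /\
  ((u = 1 /\ nu = mu /\ unitOP (D * q) P mu) \/
   (u = Z%:~R /\ nu = D%:~R * s%:~R / mu^* /\ unitOP (D * q) P mu^*)).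
Proof.
move=> pD; have [h|h] := not_both_conj pD.
  exists 1, mu; split=> //; last by left; split=> //; split=> //; apply: unitOP_OK.
  apply: local_data_unramified => //; rewrite ?oner_eq0 ?expr1n ?mul1r //.
    exact: (inK_int _ 1).
  exact: unitOP_OK.
have Oc : unitOP (D * q) P mu^* by apply: unitOP_OK => //; apply: inOK_conj.
have c0 : mu^* != 0 by rewrite fmorph_eq0.
have us : unitOP (D * q) P s%:~R.
  apply: (@unitOP_pair _ _ hP _ s%:~R); rewrite -?expr2 //; exact: inOP_int.
exists Z%:~R, (D%:~R * s%:~R / mu^*); split=> //; last by right.
have e : Z%:~R ^+ 2 * (D%:~R * s%:~R / mu^*) = mu.
  by rewrite mulrA [_ ^+ 2 * _]mulrC -mu_norm mulfK.
apply: local_data_unramified => //; first exact: inK_int.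
  have -> : D%:~R * s%:~R / mu^* = mu / (Z ^+ 2)%:~R.
    rewrite rmorphXn /=; apply: (canRL (mulfK _)); first by rewrite expf_neq0.
    by rewrite mulrC.
  exact: inK_div.
apply: unitOPM => //; last exact: unitOPV.
by apply: unitOPM => //; apply: (unitOP_int hP pp Pp).
Qed.

(** The element q mu / w is integral with trace q Y and norm -s q Z^2. Here p does not divide Z, by
    primitivity, nor q, because D q is square-free; so the element is a unit. *)
Lemma local_data_ramified : (p%:Z %| D)%Z ->
  local_data w ((mu / w) ^+ 2 / q%:~R) (w * (mu / w) / q%:~R).
Proof.
move=> pD; have [PO [_ [_ [PM [_ [Pmul _]]]]]] := hP.
have nq := q_ndvd pp pD.
have uq : unitOP (D * q) P q%:~R by apply: (unitOP_int hP pp Pp).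
pose al := q%:~R * (mu / w).
have ewd : w / (D * q)%:~R = w^-1 by rewrite -w2; field.
have Kal : inK (D * q) al.
  apply: inKM; first exact: inK_int.
  by rewrite -ewd mulrA; apply/inK_div/inKM.
have alc : al^* = - (q%:~R * (mu^* / w)).
  by rewrite /al rmorphM fmorph_div /= rmorph_int conj_sqrt // invrN !mulrN.
have al_tr : al + al^* = (q * Y)%:~R.
  by rewrite alc mu_conj /al /mu /twist_mu intrM; field.
have al_n : al * al^* = (- (s * q * Z ^+ 2))%:~R.
  rewrite alc /al.
  transitivity (- (q%:~R ^+ 2 * (mu * mu^*)) / w ^+ 2); first by field.
  rewrite mu_norm w2 rmorphN /= (_ : (s * q * Z ^+ 2)%:~R = s%:~R * q%:~R * Z%:~R ^+ 2); last first.
    by rewrite -rmorphXn -!intrM.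
  by rewrite intrM; field; rewrite D0C q0C.
have OKal : inOK (D * q) al.
  split=> //; apply: (@Aint_quadratic _ (q * Y) (- (s * q * Z ^+ 2))).
  by rewrite -al_tr -al_n; ring.
have pZ : ~~ (p%:Z %| Z)%Z.
  apply/negP => pZ.
  have pY : (p%:Z %| Y)%Z.
    have : (p%:Z %| q * Y ^+ 2)%Z.
      have -> : q * Y ^+ 2 = D * X ^+ 2 - 4 * s * Z ^+ 2 by rewrite -hN; ring.
      by apply: rpredB; [apply: dvdz_mulr | rewrite expr2; do 2!apply: dvdz_mull].
    by rewrite expr2 !Euclid_dvdzM // (negbTE nq) /= orbb.
  have pX : (p%:Z %| X)%Z.
    apply: (dvdz_sqr_mul pp (Dsqr_ndvd pp)).
    have -> : D * X ^+ 2 = q * Y ^+ 2 + 4 * s * Z ^+ 2 by rewrite -hN; ring.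
    by apply: rpredD; apply: dvdz_mull; rewrite !expr2 dvdz_mul.
  exact: hgcd pX pY pZ.
have ps : ~~ (p%:Z %| s)%Z.
  apply/negP => ps; have : (p%:Z %| s ^+ 2)%Z by rewrite expr2 dvdz_mull.
  by rewrite s2 dvdzE /= dvdn1 => /eqP p1; move: pp; rewrite p1.
have ual : unitOP (D * q) P al.
  apply: unitOP_OK => // Pal.
  have : P (- (s * q * Z ^+ 2))%:~R by rewrite -al_n mulrC; apply: PM => //; apply: inOK_conj.
  move/(ideal_int hP pp Pp).
  by rewrite rpredN expr2 !Euclid_dvdzM // (negbTE ps) (negbTE nq) (negbTE pZ).
have unu : unitOP (D * q) P (mu / w).
  have -> : mu / w = al / q%:~R by rewrite /al [RHS]mulrAC divff // mul1r.
  by apply: unitOPM => //; apply: unitOPV.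
have Knu : inK (D * q) (mu / w) by rewrite -ewd mulrA; apply/inK_div/inKM.
split; split=> //.
- by apply: inK_div; apply: inKM.
- by apply: unitOPM => //; [apply: unitOPX | apply: unitOPV].
- apply: inOPM => //; last exact: unitOP_inv.
  by apply: inOPM => //; [apply/inOP_OK/inOK_sqrt | apply: unitOP_inOP].
- transitivity (mu ^+ 2 / q%:~R ^+ 2); first by field; rewrite q0C w0.
  transitivity (D%:~R * (mu ^+ 2 / w ^+ 2 / q%:~R)); last by field; rewrite q0C w0.
  by rewrite w2 intrM; field; rewrite q0C D0C.
- transitivity (w ^+ 2 * mu ^+ 2 / q%:~R); first by field; rewrite q0C w0.
  by rewrite w2 intrM; field.
transitivity ((w ^+ 2) ^+ 2 * mu ^+ 3 / q%:~R ^+ 2); first by field; rewrite q0C w0.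
by rewrite w2 intrM; field.
Qed.

(** For A = 27 k + 12 the number A^3 - 1728 is divisible by 729 = 3^6. As D has at most one factor
    3, three of them can be extracted from t. *)
Lemma Rset_3 : (3 %| A)%Z -> (27 %| t)%Z.
Proof.
move=> h3; have [_ /(_ h3)/dvdzP[k ek]] := hR.
have D9 : ~~ ((3%:Z ^+ 2) %| D)%Z by apply: Dsqr_ndvd.
have e : D * t ^+ 2 = 729 * (k * (16 + 36 * k + 27 * k ^+ 2)).
  by rewrite hA (_ : A = k * 27 + 12); [ring | rewrite -ek; ring].
have pr3 : prime 3 by [].
have /dvdzP[t1 e1] : (3%:Z %| t)%Z.
  by apply: (dvdz_sqr_mul pr3 D9); rewrite e (_ : 729 = 3%:Z ^+ 2 * 81) // -mulrA dvdz_mulr.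
have e2 : D * t1 ^+ 2 = 81 * (k * (16 + 36 * k + 27 * k ^+ 2)).
  apply: (@mulfI _ (9 : int)) => //; rewrite [RHS]mulrA (_ : 9 * 81 = 729) // -e e1; ring.
have /dvdzP[t2 e3] : (3%:Z %| t1)%Z.
  by apply: (dvdz_sqr_mul pr3 D9); rewrite e2 (_ : 81 = 3%:Z ^+ 2 * 9) // -mulrA dvdz_mulr.
have e4 : D * t2 ^+ 2 = 9 * (k * (16 + 36 * k + 27 * k ^+ 2)).
  apply: (@mulfI _ (9 : int)) => //; rewrite [RHS]mulrA (_ : 9 * 9 = 81) // -e2 e3; ring.
have /dvdzP[t3 e5] : (3%:Z %| t2)%Z.
  by apply: (dvdz_sqr_mul pr3 D9); rewrite e4 (_ : 9 = 3%:Z ^+ 2) // dvdz_mulr.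
by rewrite e1 e3 e5 -!mulrA dvdz_mull.
Qed.

(** Away from 6 the short model is integral. At 3 it still is when 3 divides A, by [Rset_3];
    otherwise A is a unit and [model_A_unit] applies with e = 0, since 4 is invertible. *)
Lemma good_at_odd u m delta : local_data u m delta -> p != 2%N ->
  good_red_at (D * q) E0 P.
Proof.
move=> [[u0 Ku Kd Om] [Od d2 e4 e6]] p2.
have frac n k : ~~ (p%:Z %| k)%Z -> inOP (D * q) P (n%:~R / k%:~R).
  by move=> pk; apply: (inOP_frac hP pp Pp) => //; apply: inOP_int.
have pk2 k : (p%:Z %| (2 ^ k)%:Z)%Z = false.
  apply/negbTE; rewrite dvdzE /= Euclid_dvdX // dvdn_prime2 //; apply/negP => /andP[/eqP e _].
  by rewrite e in p2.
have pk3 k : p != 3%N -> (p%:Z %| (3 ^ k)%:Z)%Z = false.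
  move=> p3; apply/negbTE; rewrite dvdzE /= Euclid_dvdX // dvdn_prime2 //.
  by apply/negP => /andP[/eqP e _]; rewrite e in p3.
case: (eqVneq p 3%N) => [p3|p3]; last first.
  apply: (model_away6 hP hA u0 Ku Om Od d2 e4 e6).
    apply: (frac _ 48); rewrite (_ : 48 = (2 ^ 4)%:Z * (3 ^ 1)%:Z) //.
    by rewrite Euclid_dvdzM // pk2 pk3.
  apply: (frac _ 864); rewrite (_ : 864 = (2 ^ 5)%:Z * (3 ^ 3)%:Z) //.
  by rewrite Euclid_dvdzM // pk2 pk3.
have [h3|h3] := boolP (3 %| A)%Z.
  have /dvdzP[t1 et] := Rset_3 h3; have /dvdzP[a1 ea] := h3.
  apply: (model_away6 hP hA u0 Ku Om Od d2 e4 e6).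
    have -> : (A%:~R : algC) / 48 = a1%:~R / 16%:~R.
      by rewrite ea intrM -[3%:~R]/(3%:R : algC) -[16%:~R]/(16%:R : algC); field.
    by apply: frac; rewrite (_ : 16 = (2 ^ 4)%:Z) // pk2.
  have -> : (t%:~R : algC) / 864 = t1%:~R / 32%:~R.
    by rewrite et intrM -[27%:~R]/(27%:R : algC) -[32%:~R]/(32%:R : algC); field.
  by apply: frac; rewrite (_ : 32 = (2 ^ 5)%:Z) // pk2.
have uA : unitOP (D * q) P A%:~R by apply: (unitOP_int hP pp Pp); rewrite p3.
apply: (@model_A_unit _ _ _ _ _ hP hA _ _ _ _ u0 Ku Kd Om Od d2 e4 e6 0) => //.
rewrite subr0; apply: (inOP_frac hP pp Pp (n := 4)); first by rewrite (pk2 2).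
apply: inOPM => //; last exact: unitOP_inv.
by apply: inOPM => //; apply: inOPN; apply: inOP_int.
Qed.

(** The integer [sg] is congruent to nu modulo 4. It turns the integrality conditions of
    [model_A_unit] (e = 1) and [model_16] into congruences between integers, which the sign of t can
    be made to satisfy. *)
Lemma good_at_two_odd (sg : int) : p = 2%N -> oddz D -> (4 %| D * q - 1)%Z -> oddz sg ->
  ((exists z, Z = 2 * z) /\ sg = D * X /\ (4 %| s * D - 1)%Z) \/
    (exists x y, [/\ X = 2 * x, Y = 4 * y, oddz Z & sg = D * x + 2 * y]) ->
  (oddz A /\ (4 %| t * D * sg + A)%Z) \/
    (exists a t', [/\ A = 16 * a, t = 8 * t' & (4 %| t' * D ^+ 2 * sg ^+ 3 + 27)%Z]) ->
  good_red_at (D * q) E0 P.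
Proof.
move=> p2 oD d4 osg hsg hAt.
have Oi n : inOP (D * q) P n%:~R by apply: inOP_int.
have P2 k : oddz k -> ~~ (p%:Z %| k)%Z by move=> ok; rewrite p2; apply: ndvd_oddz.
have npD := P2 _ oD.
have [u [nu [hloc hnu]]] : exists u nu,
    local_data u (D%:~R * nu ^+ 2) (D%:~R * nu) /\ inOP (D * q) P ((nu - sg%:~R) / 4).
  case: hsg => [[[z ez] [esg /dvdzP[k1 ek1]]]|[x [y [eX eY oZ esg]]]].
    have munorm4 : mu * mu^* = 4 * (D%:~R * s%:~R * z%:~R ^+ 2).
      by rewrite mu_norm ez intrM; ring.
    have mutr : mu + mu^* = sg%:~R by rewrite mu_trace esg intrM.
    have Oz : inOP (D * q) P (D%:~R * s%:~R * z%:~R ^+ 2).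
      by apply: inOPM => //; [apply: inOPM | apply: inOPX].
    have [u [nu [hloc [[_ [enu umu]]|[_ [enu umu]]]]]] := unramified_choice npD;
      exists u, nu; split=> //.
      (* Here nu - sg = mu - (mu + conj(mu)) = - conj(mu), which is divisible by 4 because the norm
         is and mu is a unit. *)
      have e : (nu - sg%:~R) / 4 = - (D%:~R * s%:~R * z%:~R ^+ 2 / mu).
        transitivity (- (mu * mu^* / 4 / mu)); last by rewrite munorm4; field.
        by rewrite enu -mutr; field.
      by rewrite e; apply: inOPN; apply: inOPM => //; apply: unitOP_inv.
    have c0 : mu^* != 0 by rewrite fmorph_eq0.
    have [k2 ek2] := oddz_sqr osg.
    (* Here nu = D s / conj(mu). Both D s and sg^2 are 1 modulo 4, and sg - conj(mu) = mu is
       divisible by 4. *)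
    have e : (nu - sg%:~R) / 4
       = ((k1 - 2 * k2)%:~R + sg%:~R * (D%:~R * s%:~R * z%:~R ^+ 2 / mu^*)) / mu^*.
      have e1 : (D%:~R * s%:~R : algC) = sg%:~R ^+ 2 + 4 * (k1 - 2 * k2)%:~R.
        rewrite -[4]/(4%:~R) -!rmorphXn -!intrM -intrD ek2; congr (_%:~R).
        by rewrite mulrC -[LHS](subrK 1) ek1; ring.
      transitivity ((D%:~R * s%:~R - sg%:~R * mu^*) / 4 / mu^*); first by rewrite enu; field.
      congr (_ / _); rewrite {1}e1.
      transitivity ((k1 - 2 * k2)%:~R + sg%:~R * (sg%:~R - mu^*) / 4 : algC); first by field.
      rewrite -{2}mutr addrK; congr (_ + _); rewrite -mulrA; congr (_ * _).
      by transitivity (mu * mu^* / 4 / mu^*); [field | rewrite munorm4; field].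
    rewrite e; apply: inOPM => //; last exact: unitOP_inv.
    by apply: inOPD => //; apply: inOPM => //; apply: inOPM => //; apply: unitOP_inv.
  have os : ~~ (p%:Z %| s)%Z.
    apply/negP => ps; have : (p%:Z %| s ^+ 2)%Z by rewrite expr2 dvdz_mull.
    by rewrite s2 p2.
  have umu : unitOP (D * q) P mu.
    apply: unitOP_OK => // Pmu; have [_ [_ [_ [PM _]]]] := hP.
    have : P (D * s * Z ^+ 2)%:~R.
      have -> : (D * s * Z ^+ 2)%:~R = mu^* * mu by rewrite [RHS]mulrC mu_norm -rmorphXn -!intrM.
      by apply: PM => //; apply: inOK_conj.
    move/(ideal_int hP pp Pp); rewrite expr2 !Euclid_dvdzM // (negbTE npD) (negbTE os) /= orbb.
    by rewrite (negbTE (P2 _ oZ)).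
  exists 1, mu; split.
    apply: local_data_unramified => //; rewrite ?oner_eq0 ?expr1n ?mul1r //.
    exact: (inK_int _ 1).
  have /dvdzP[k ek] := d4.
  (* Integral because D q = 1 modulo 4; it occurs since mu = D x + 2 y w and sg = D x + 2 y. *)
  have Oeta : inOK (D * q) ((w - 1) / 2).
    split; first by apply: (@inK_div _ _ 2); apply: inKD => //; apply: (inK_int _ (- 1)).
    apply: (@Aint_quadratic _ (- 1) (- k)).
    transitivity ((w ^+ 2 - 1) / 4 - k%:~R); first by rewrite mulrN1z rmorphN /=; field.
    by rewrite w2 -[1]/(1%:~R) -intrB ek intrM -[4%:~R]/(4 : algC); field.
  have -> : (mu - sg%:~R) / 4 = y%:~R * ((w - 1) / 2).
    by rewrite /mu /twist_mu eX eY esg intrD !intrM -[4%:~R]/(4 : algC) -[2%:~R]/(2 : algC); field.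
  by apply: inOPM => //; apply: inOP_OK.
have hloc' := hloc.
move: hloc' => [[u0 Ku Kd Om] [Od d2 e4 e6]].
case: hAt => [[oA /dvdzP[k ek]]|[a [t' [eA et /dvdzP[k ek]]]]].
  have uA : unitOP (D * q) P A%:~R by apply: (unitOP_int hP pp Pp); apply: P2.
  apply: (@model_A_unit _ _ _ _ _ hP hA _ _ _ _ u0 Ku Kd Om Od d2 e4 e6 1) => //.
  have A0 : (A%:~R : algC) != 0 by apply: unitOP_neq0 uA.
  have ekC : t%:~R * D%:~R * sg%:~R + A%:~R = 4 * k%:~R :> algC.
    by rewrite -[4]/(4%:~R) -!intrM -intrD ek mulrC.
  have -> : (- t%:~R * (D%:~R * nu) / A%:~R - 1) / 4
     = - (t%:~R * D%:~R) / A%:~R * ((nu - sg%:~R) / 4) - k%:~R / A%:~R :> algC.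
    apply: (@mulfI _ (4 : algC)); first by rewrite pnatr_eq0.
    transitivity (- (t%:~R * D%:~R) / A%:~R * (nu - sg%:~R)
       - (t%:~R * D%:~R * sg%:~R + A%:~R) / A%:~R); first by field.
    by rewrite ekC; field.
  have iA : inOP (D * q) P A%:~R^-1 by apply: unitOP_inv.
  apply: inOPB => //; last by apply: inOPM.
  by apply: inOPM => //; apply: inOPM => //; apply: inOPN; apply: inOPM.
apply: (model_16 hP hA u0 Ku Om d2 e4 e6).
  have -> : (A%:~R : algC) / 48 = a%:~R / 3%:~R.
    by rewrite eA intrM -[3%:~R]/(3%:R : algC) -[16%:~R]/(16%:R : algC); field.
  by apply: (inOP_frac hP pp Pp) => //; rewrite p2.
have ekC : t'%:~R * D%:~R ^+ 2 * sg%:~R ^+ 3 + 27 = 4 * k%:~R :> algC.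
  by rewrite -[4]/(4%:~R) -[27]/(27%:~R) -!rmorphXn -!intrM -intrD ek mulrC.
have -> : (- t%:~R * (D%:~R * nu) * (D%:~R * nu ^+ 2) / 216 - 1) / 4
  = (- (t'%:~R * D%:~R ^+ 2) * ((nu - sg%:~R) / 4 * (nu ^+ 2 + nu * sg%:~R + sg%:~R ^+ 2))
      - k%:~R) / 27%:~R :> algC.
  have -> : t%:~R = 8 * t'%:~R :> algC by rewrite et intrM.
  rewrite -[27%:~R]/(27%:R : algC).
  transitivity (((- (t'%:~R * D%:~R ^+ 2) * (nu ^+ 3 - sg%:~R ^+ 3))
     - (t'%:~R * D%:~R ^+ 2 * sg%:~R ^+ 3 + 27)) / 4 / 27 : algC); first by field.
  by rewrite ekC; field.
have Onu : inOP (D * q) P nu.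
  have -> : nu = 4 * ((nu - sg%:~R) / 4) + sg%:~R by field.
  by apply: inOPD => //; apply: inOPM => //; apply: (Oi 4).
apply: (inOP_frac hP pp Pp); first by rewrite p2.
apply: inOPB => //; apply: inOPM => //.
  by apply: inOPN; apply: inOPM => //; apply: inOPX.
apply: inOPM => //; apply: inOPD => //; last exact: inOPX.
by apply: inOPD => //; [apply: inOPX | apply: inOPM].
Qed.

(** Since 2 divides D, the ramified data and [model_4] are used. Expanding m and delta m in the
    basis 1, w reduces the integrality of a4 and a6 to [mod4_congruences] and [mod8_congruences]. *)
Lemma good_at_two_even b x y t' : p = 2%N -> A = 4 * (2 * b - 1) -> t = 8 * t' ->
  X = 2 * x -> Y = 2 * y -> oddz x -> oddz y -> oddz b ->
  (exists k, D = 2 + 4 * k) -> (exists k, q = 1 + D + 8 * k) ->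
  (exists k, t' = - b * x + 4 * k) -> good_red_at (D * q) E0 P.
Proof.
move=> p2 eA et eX eY ox oy ob hD hq ht.
have Oi n : inOP (D * q) P n%:~R by apply: inOP_int.
have pD : (p%:Z %| D)%Z by rewrite p2; case: hD => k ->; apply/dvdzP; exists (1 + 2 * k); ring.
have [[u0 Ku Kd Om] [Od d2 e4 e6]] := local_data_ramified pD.
have oq : oddz q by case: hD hq => k -> [l ->]; exists (1 + 2 * k + 4 * l); ring.
have hq4 : exists k, q = 3 + 4 * k.
  by case: hD hq => k -> [l ->]; exists (k + 2 * l); ring.
have Ow : inOP (D * q) P w by apply/inOP_OK/inOK_sqrt.
have [/dvdzP[k0 ek0] /dvdzP[k1 ek1]] := mod4_congruences ox oy ob hD hq4.
have [/dvdzP[l0 el0] /dvdzP[l1 el1]] := mod8_congruences ox oy ob hD hq ht.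
set m := (mu / w) ^+ 2 / q%:~R in Om d2 e4 e6 *.
set del := w * (mu / w) / q%:~R in Kd Od d2 e6 *.
pose M0 : algC := q%:~R * y%:~R ^+ 2 + x%:~R ^+ 2 * D%:~R.
pose M1 : algC := 2 * x%:~R * y%:~R.
have emu : mu = D%:~R * x%:~R + y%:~R * w.
  by rewrite /mu /twist_mu eX eY !intrM -[2%:~R]/(2 : algC); field.
have em : m = (M0 + M1 * w) / q%:~R ^+ 2.
  transitivity (mu ^+ 2 / (w ^+ 2 * q%:~R)); first by rewrite /m; field; rewrite q0C w0.
  transitivity ((D%:~R ^+ 2 * x%:~R ^+ 2 + 2 * D%:~R * x%:~R * y%:~R * w + y%:~R ^+ 2 * w ^+ 2)
      / (w ^+ 2 * q%:~R)); first by rewrite emu; congr (_ / _); ring.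
  by rewrite w2 intrM /M0 /M1; field; rewrite q0C D0C.
have ed : del = (y%:~R * w + x%:~R * D%:~R) / q%:~R.
  by rewrite /del emu; field; rewrite q0C w0.
have edm : del * m = (x%:~R * D%:~R * M0 + y%:~R * M1 * (D%:~R * q%:~R)
    + (y%:~R * M0 + x%:~R * D%:~R * M1) * w) / q%:~R ^+ 3.
  transitivity ((x%:~R * D%:~R * M0 + y%:~R * M1 * w ^+ 2
    + (y%:~R * M0 + x%:~R * D%:~R * M1) * w) / q%:~R ^+ 3); first by rewrite ed em; field.
  by rewrite w2 intrM.
have eAC : A%:~R = 4 * (2 * b%:~R - 1) :> algC by rewrite eA intrM intrB intrM.
have etC : t%:~R = 8 * t'%:~R :> algC by rewrite et intrM.
have uq n : ~~ (p%:Z %| q ^+ n)%Z.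
  rewrite p2; apply: ndvd_oddz; elim: n => [|n IH]; first by exists 0.
  by rewrite exprS; apply: oddzM.
apply: (model_4 (b := b) (w := w) hP hA u0 Ku Om d2 e4 e6) => //.
- have -> : (2 * b%:~R - (D * q)%:~R) / 4 = (2 * b - D * q)%:~R / 4%:~R :> algC.
    by rewrite intrB !intrM.
  have /dvdzP[k ->] : (4 %| 2 * b - D * q)%Z.
    case: ob hD oq => kb -> [kD ->] [kq ->]; apply/dvdzP.
    by exists (kb - kq - 2 * kD * kq - kD); ring.
  by rewrite intrM mulfK // intr_eq0.
- have c0 : q%:~R ^+ 2 * b%:~R ^+ 2 - (2 * b%:~R - 1) * M0 = 4 * k0%:~R :> algC.
    have := congr1 (fun n : int => n%:~R : algC) ek0; rewrite [(k0 * 4)%:~R]intrM [k0%:~R * _]mulrC => <-.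
    by rewrite /M0 !(rmorphD, rmorphB, rmorphN, rmorphM, rmorphXn) /=.
  have c1 : - (2 * b%:~R - 1) * M1 - 6 * q%:~R ^+ 2 = 4 * k1%:~R :> algC.
    have := congr1 (fun n : int => n%:~R : algC) ek1; rewrite [(k1 * 4)%:~R]intrM [k1%:~R * _]mulrC => <-.
    by rewrite /M1 !(rmorphD, rmorphB, rmorphN, rmorphM, rmorphXn) /=.
  have -> : (4 * b%:~R ^+ 2 - A%:~R * m - 24 * w) / 48 = (k0%:~R + k1%:~R * w) / (3 * q ^+ 2)%:~R.
    transitivity (((q%:~R ^+ 2 * b%:~R ^+ 2 - (2 * b%:~R - 1) * M0)
      + (- (2 * b%:~R - 1) * M1 - 6 * q%:~R ^+ 2) * w) / (12 * q%:~R ^+ 2)).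
      by rewrite eAC em; field.
    rewrite c0 c1 intrM rmorphXn /= -[3%:~R]/(3%:R : algC); field.
    by rewrite q0C.
  apply: (inOP_frac hP pp Pp); last by apply: inOPD => //; apply: inOPM.
  by rewrite Euclid_dvdzM // (negbTE (uq 2%N)) p2.
have c0 : q%:~R ^+ 3 * b%:~R ^+ 3 - 3 * b%:~R * (2 * b%:~R - 1) * (q%:~R * M0)
    - 2 * t'%:~R * (x%:~R * D%:~R * M0 + y%:~R * M1 * (D%:~R * q%:~R)) - 54 * q%:~R ^+ 3
    = 8 * l0%:~R :> algC.
  have := congr1 (fun n : int => n%:~R : algC) el0; rewrite [(l0 * 8)%:~R]intrM [l0%:~R * _]mulrC => <-.
  by rewrite /M0 /M1 !(rmorphD, rmorphB, rmorphN, rmorphM, rmorphXn) /=.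
have c1 : - 3 * b%:~R * (2 * b%:~R - 1) * (q%:~R * M1)
    - 2 * t'%:~R * (y%:~R * M0 + x%:~R * D%:~R * M1) = 8 * l1%:~R :> algC.
  have := congr1 (fun n : int => n%:~R : algC) el1; rewrite [(l1 * 8)%:~R]intrM [l1%:~R * _]mulrC => <-.
  by rewrite /M0 /M1 !(rmorphD, rmorphB, rmorphN, rmorphM, rmorphXn) /=.
have -> : (8 * b%:~R ^+ 3 - 6 * b%:~R * (A%:~R * m) - 2 * (t%:~R * del * m) - 432) / 1728
   = (l0%:~R + l1%:~R * w) / (27 * q ^+ 3)%:~R.
  transitivity ((8 * b%:~R ^+ 3 - 6 * b%:~R * (A%:~R * m) - 2 * t%:~R * (del * m) - 432) / 1728).
    by field.
  transitivity (((q%:~R ^+ 3 * b%:~R ^+ 3 - 3 * b%:~R * (2 * b%:~R - 1) * (q%:~R * M0)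
    - 2 * t'%:~R * (x%:~R * D%:~R * M0 + y%:~R * M1 * (D%:~R * q%:~R)) - 54 * q%:~R ^+ 3)
    + (- 3 * b%:~R * (2 * b%:~R - 1) * (q%:~R * M1)
    - 2 * t'%:~R * (y%:~R * M0 + x%:~R * D%:~R * M1)) * w) / (216 * q%:~R ^+ 3)).
    by rewrite eAC etC edm em; field.
  rewrite c0 c1 intrM rmorphXn /= -[27%:~R]/(27%:R : algC); field.
  by rewrite q0C.
apply: (inOP_frac hP pp Pp); last by apply: inOPD => //; apply: inOPM.
by rewrite Euclid_dvdzM // (negbTE (uq 3%N)) p2.
Qed.

End CurveLocal.

(** * From norms to counted fields *)

Section CountedFields.
Local Open Scope ring_scope.

(** It decides the sign of t: negating t exchanges the two alternatives. *)
Lemma odd_sum4 (u v : int) : oddz u -> oddz v -> (4 %| u + v)%Z \/ (4 %| - u + v)%Z.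
Proof. by move=> [a ->] [b ->]; lia. Qed.

Lemma oddz_or (x : int) : oddz x \/ exists k : int, x = 2 * k.
Proof.
case: (boolP (2 %| x)%Z) => [/dvdzP[k ->]|/oddz_ndvd]; last by left.
by right; exists k; rewrite mulrC.
Qed.

Lemma oddzX x n : oddz x -> oddz (x ^+ n).
Proof.
move=> ox; elim: n => [|n IH]; first by exists 0.
by rewrite exprS; apply: oddzM.
Qed.

Lemma oddz_sqrP x : oddz (x ^+ 2) -> oddz x.
Proof.
move=> [k ek]; have [//|[l el]] := oddz_or x; exfalso.
have : 2 * (2 * l ^+ 2) = 2 * k + 1 by rewrite -ek el; ring.
lia.
Qed.

Lemma oddzM_r x y : oddz (x * y) -> oddz y.
Proof.
move=> [k ek]; have [//|[l el]] := oddz_or y; exfalso.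
have : 2 * (x * l) = 2 * k + 1 by rewrite -ek el; ring.
lia.
Qed.

Lemma odd_not_even x : oddz x -> (exists k : int, x = 2 * k) -> False.
Proof. by move=> [k ->] [l]; lia. Qed.

Section Fixed.
Variables (D A t : int).
Hypothesis Dsq : squarefree D.
Hypothesis hR : in_Rset A.
Hypothesis hA : D * t ^+ 2 = A ^+ 3 - 1728.

Lemma eight_dvd_t n : D * t ^+ 2 = 64 * n -> exists t', t = 8 * t' /\ D * t' ^+ 2 = n.
Proof.
have D4 : ~~ ((2%:Z ^+ 2) %| D)%Z by apply: squarefree_ndvd.
have step v m : D * v ^+ 2 = 4 * m -> exists v', v = 2 * v' /\ D * v' ^+ 2 = m.
  move=> e; have /dvdzP[v' ev] : (2%:Z %| v)%Z.
    by apply: (dvdz_sqr_mul (isT : prime 2) D4); rewrite e dvdz_mulr.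
  exists v'; split; first by rewrite ev mulrC.
  by apply: (@mulfI _ (4 : int)) => //; rewrite -e ev; ring.
move=> e; have [t1 [e1 h1]] := step t (16 * n) ltac:(by rewrite e; ring).
have [t2 [e2 h2]] := step t1 (4 * n) ltac:(by rewrite h1; ring).
have [t3 [e3 h3]] := step t2 n h2.
by exists t3; split=> //; rewrite e1 e2 e3; ring.
Qed.

Lemma A_odd_t_odd : oddz A -> oddz D /\ oddz t.
Proof.
move=> oA; have o : oddz (t ^+ 2 * D).
  have [k ek] := oddzX 3 oA; exists (k - 864); rewrite mulrC hA ek; ring.
split; first exact: oddzM_r o.
by apply: oddz_sqrP; move: o; rewrite mulrC; apply: oddzM_r.
Qed.

(** The third case is A = 4 modulo 16: there D t'^2 is twice an odd number, which makes D even and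
    t' odd. *)
Lemma A_cases : [\/ oddz A /\ oddz D /\ oddz t,
  exists a t' : int, [/\ A = 16 * a, t = 8 * t', D * t' ^+ 2 = 64 * a ^+ 3 - 27, oddz D & oddz t'] |
  exists b t' k : int, [/\ A = 4 * (2 * b - 1), t = 8 * t', oddz b, oddz t' & D = 2 + 4 * k]].
Proof.
have [oA|[a0 ea0]] := oddz_or A; first by apply: Or31; split=> //; apply: A_odd_t_odd.
have [|/dvdzP[a ea]|/dvdzP[a ea]] := hR.1; first by rewrite ea0 dvdz_mulr.
  have eA : A = 16 * a by rewrite ea mulrC.
  have [|t' [et ht]] := @eight_dvd_t (64 * a ^+ 3 - 27); first by rewrite hA eA; ring.
  have o : oddz (D * t' ^+ 2) by exists (32 * a ^+ 3 - 14); rewrite ht; ring.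
  apply: Or32; exists a, t'; split=> //.
    by move: o; rewrite mulrC; apply: oddzM_r.
  exact/oddz_sqrP/oddzM_r/o.
have eA : A = 4 * (4 * a + 1) by rewrite -[LHS](subrK 4) ea; ring.
have [|t' [et ht]] := @eight_dvd_t (2 * (2 * a - 1) * (16 * a ^+ 2 + 20 * a + 13)).
  by rewrite hA eA; ring.
have o : oddz ((2 * a - 1) * (16 * a ^+ 2 + 20 * a + 13)).
  by apply: oddzM; [exists (a - 1); ring | exists (8 * a ^+ 2 + 10 * a + 6); ring].
have [oD|[D' eD]] := oddz_or D; last first.
  have e : D' * t' ^+ 2 = (2 * a - 1) * (16 * a ^+ 2 + 20 * a + 13).
    apply: (@mulfI _ (2 : int)) => //; transitivity (D * t' ^+ 2); first by rewrite eD; ring.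
    by rewrite ht; ring.
  rewrite -e in o.
  have [k ek] : oddz D' by move: o; rewrite mulrC; apply: oddzM_r.
  apply: Or33; exists (2 * a + 1), t', k; split=> //.
  - by rewrite eA; ring.
  - by exists a.
  - exact/oddz_sqrP/oddzM_r/o.
  by rewrite eD ek; ring.
have [t1 [et1 ht1]] : exists t1, t' = 2 * t1 /\ True.
  have [ot|[t1 e1]] := oddz_or t'; last by exists t1.
  exfalso; apply: (odd_not_even (oddzM oD (oddzX 2 ot))); rewrite ht.
  by exists ((2 * a - 1) * (16 * a ^+ 2 + 20 * a + 13)); ring.
exfalso; apply: (odd_not_even o); exists (D * t1 ^+ 2).
apply: (@mulfI _ (2 : int)) => //; transitivity (D * t' ^+ 2); first by rewrite ht; ring.
by rewrite et1; ring.
Qed.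

Variables (q X Y Z s : int).
Hypothesis d0 : D * q < 0.
Hypothesis dsq : squarefree (D * q).
Hypothesis hN : D * X ^+ 2 - q * Y ^+ 2 = 4 * s * Z ^+ 2.
Hypothesis s2 : s ^+ 2 = 1.
Hypothesis Z0 : Z != 0.
Hypothesis hgcd : forall p, prime p -> (p%:Z %| X)%Z -> (p%:Z %| Y)%Z -> (p%:Z %| Z)%Z -> False.

(** Odd primes are settled by [good_at_odd] for either sign of t, so [t0] is +-t and only the primes
    above 2 remain. The j-invariant is A^3. *)
Lemma counted_of_model (t0 : int) : D * t0 ^+ 2 = A ^+ 3 - 1728 ->
  (forall P, prime_ideal (D * q) P -> P 2%:R ->
    good_red_at (D * q) (short_weier (A%:~R * D%:~R * twist_mu D q X Y ^+ 2)
      (D%:~R ^+ 2 * t0%:~R * twist_mu D q X Y ^+ 3)) P) ->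
  counted D q.
Proof.
move=> hA0 h2; set mu := twist_mu D q X Y in h2.
split=> //; split=> //.
exists (short_weier (A%:~R * D%:~R * mu ^+ 2) (D%:~R ^+ 2 * t0%:~R * mu ^+ 3)).
have D0 : (D%:~R : algC) != 0 by rewrite intr_eq0; apply: contraTneq d0 => ->; rewrite mul0r.
have hAC : D%:~R * t0%:~R ^+ 2 = A%:~R ^+ 3 - 1728 :> algC.
  by rewrite -[1728]/(1728%:~R) -!rmorphXn -intrM -intrB hA0.
have mu0 : mu != 0.
  have w := sqr_sqrt_d (D * q).
  apply: contraNneq Z0 => m0.
  have K : (D%:~R * X%:~R) ^+ 2 = (D * q)%:~R * Y%:~R ^+ 2 :> algC.
    have : (D%:~R * X%:~R + Y%:~R * sqrtC (D * q)%:~R) = 0 :> algC.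
      by move/eqP: m0; rewrite /mu /twist_mu mulf_eq0 invr_eq0 pnatr_eq0 orbF => /eqP.
    by move/eqP; rewrite addr_eq0 => /eqP ->; rewrite sqrrN exprMn w mulrC.
  have K' : D * (D * X ^+ 2 - q * Y ^+ 2) = 0.
    have /eqP := K; rewrite -intrM -!rmorphXn -intrM eqr_int => /eqP K1.
    by transitivity ((D * X) ^+ 2 - D * q * Y ^+ 2); [ring | rewrite K1 subrr].
  have s0 : s != 0 by apply: contra_eq_neq s2 => ->.
  have D0' : D != 0 by rewrite -(intr_eq0 algC).
  move/eqP: K'; rewrite hN mulf_eq0 (negbTE D0') /= mulf_eq0 mulf_eq0 (negbTE s0) orbF /=.
  by rewrite expf_eq0.
set E := short_weier _ _.
have hd : wdisc E = D%:~R ^+ 3 * mu ^+ 6.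
  apply: (@mulfI _ (1728 : algC)); first by rewrite pnatr_eq0.
  rewrite wdisc_c46 short_weier_c4 short_weier_c6.
  transitivity (D%:~R ^+ 3 * mu ^+ 6 * (A%:~R ^+ 3 - D%:~R * t0%:~R ^+ 2)); first by ring.
  by rewrite hAC; ring.
have hd0 : wdisc E != 0 by rewrite hd mulf_neq0 // expf_neq0.
have Kmu : inK (D * q) mu.
  apply: (@inK_div _ _ 2); apply: inKD; first by apply: inKM; apply: inK_int.
  by apply: inKM; [apply: inK_int | apply: inK_sqrt].
have K0 : inK (D * q) 0 by apply: (inK_int _ 0).
split.
- split=> //; split=> //=.
    apply: (@inK_div _ _ 48); apply: inKN; apply: inKM; last exact: inKX.
    by apply: inKM; apply: inK_int.
  apply: (@inK_div _ _ 864); apply: inKN; apply: inKM; last exact: inKX.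
  by apply: inKM; [apply: inKX; apply: inK_int | apply: inK_int].
- move=> P hP; have [p [pp Pp]] := residue_char d0 hP.
  case: (eqVneq p 2%N) => [p2|p2]; first by apply: h2 => //; rewrite -p2.
  case: (boolP (p%:Z %| D)%Z) => pD.
    have hl := local_data_ramified d0 dsq hN s2 hgcd hP pp Pp pD.
    exact: (good_at_odd dsq hR hA0 hP pp Pp hl p2).
  have [u [nu [hl _]]] := unramified_choice d0 dsq hN s2 Z0 hgcd hP pp Pp pD.
  exact: (good_at_odd dsq hR hA0 hP pp Pp hl p2).
rewrite /jinv hd short_weier_c4.
have -> : (A%:~R * D%:~R * mu ^+ 2) ^+ 3 / (D%:~R ^+ 3 * mu ^+ 6) = (A%:~R : algC) ^+ 3.
  by field; rewrite D0 mu0.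
by rewrite rpredX // rpred_int.
Qed.

End Fixed.

Lemma primitive_solution (E Q : nat) : (0 < E)%N -> (0 < Q)%N -> is_norm E Q%:Z ->
  exists x y z : int, [/\ E%:Z * x ^+ 2 + Q%:Z * y ^+ 2 = z ^+ 2, z != 0 &
    forall p, prime p -> (p%:Z %| x)%Z -> (p%:Z %| y)%Z -> (p%:Z %| z)%Z -> False].
Proof.
move=> E0 Q0 [x0 [y0 [z0 [y00 e]]]].
pose g := gcdn (gcdn `|x0| `|y0|) `|z0|.
have g0 : (0 < g)%N by rewrite !gcdn_gt0 [(0 < `|y0|)%N]absz_gt0 y00 orbT.
have /dvdzP[x ex] : (g%:Z %| x0)%Z by rewrite dvdzE /= (dvdn_trans (dvdn_gcdl _ _)) ?dvdn_gcdl.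
have /dvdzP[y ey] : (g%:Z %| y0)%Z by rewrite dvdzE /= (dvdn_trans (dvdn_gcdl _ _)) ?dvdn_gcdr.
have /dvdzP[z ez] : (g%:Z %| z0)%Z by rewrite dvdzE /= dvdn_gcdr.
have g0z : g%:Z != 0 by rewrite -lt0n.
exists x, y, z; have e1 : E%:Z * x ^+ 2 + Q%:Z * y ^+ 2 = z ^+ 2.
  apply: (@mulfI _ (g%:Z ^+ 2)); first by rewrite expf_neq0.
  transitivity (E%:Z * x0 ^+ 2 + Q%:Z * y0 ^+ 2); first by rewrite ex ey; ring.
  by rewrite e ez; ring.
split=> //.
  apply/eqP => z00; move: e1; rewrite z00 expr0n /=.
  have y1 : y != 0 by apply: contraNneq y00 => h; rewrite ey h mul0r.
  move=> h; have : 0 < E%:Z * x ^+ 2 + Q%:Z * y ^+ 2.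
    apply: ltr_wpDl; first by rewrite mulr_ge0 // sqr_ge0.
    by rewrite mulr_gt0 // exprn_even_gt0.
  by rewrite h ltxx.
move=> p pp px py pz.
have : (p * g %| g)%N.
  rewrite {2}/g !dvdn_gcd ex ey ez !abszM /= !dvdn_mul //; rewrite dvdzE in px py pz => //.
by move/(dvdn_leq g0); rewrite leqNgt ltn_Pmull // prime_gt1.
Qed.

Lemma squarefree_of_sqfree_on (n : int) : sqfree_on prime `|n|%N -> squarefree n.
Proof.
move/sqfree_onP => [n0 h]; split; first by rewrite -absz_gt0.
move=> k hk; have k0 : (0 < k)%N.
  by case: k hk => // hk; move: hk; rewrite dvd0n => /eqP hk; rewrite hk in n0.
case: (ltnP 1 k) => [k1|]; last by lia.
have pp := pdiv_prime k1; have pk := pdiv_dvd k.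
have h2 : (pdiv k ^ 2 %| `|n|)%N by apply: dvdn_trans hk; rewrite dvdn_exp2r.
have [_ l1] := h _ pp (dvdn_trans (dvdn_exp (isT : (0 < 2)%N) (dvdnn _)) h2).
by move: h2; rewrite pfactor_dvdn // l1.
Qed.

(** Parity analysis of a primitive solution of E x^2 + Q y^2 = z^2. For odd D, either x and y are
    odd and (x, y, z/2) is used, or y alone is even and (2x, 2y, z) is used. For even D all three
    are odd and (2x, 2y, z) is used. *)
Theorem counted_of_norm (D A t : int) (Q : nat) : squarefree D -> in_Rset A ->
  D * t ^+ 2 = A ^+ 3 - 1728 -> Num.sg D = eps D -> sqfree_on prime (`|D| * Q)%N ->
  is_norm `|D|%N Q%:Z ->
  (oddz D -> (8 %| Q%:Z + `|D|%N%:Z)%Z) -> (~~ (2 %| D)%Z \/ (8 %| Q%:Z + `|D|%N%:Z - 1)%Z) ->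
  counted D (- Num.sg D * Q%:Z).
Proof.
move=> Dsq hR hA hsg hDQ hn odd8 even8.
have D0 : D != 0 by case: Dsq.
set s := Num.sg D; set E := `|D|%N in hDQ hn odd8 even8 *; set q := - s * Q%:Z.
have s2 : s ^+ 2 = 1 by rewrite sqr_sg D0.
have eD : D = s * E%:Z by rewrite /s /E abszE -numEsg.
have eE : E%:Z = s * D by rewrite [X in s * X]eD mulrA -expr2 s2 mul1r.
have EQ0 := sqfree_on_gt0 hDQ; have [E0 Q0] : (0 < E)%N /\ (0 < Q)%N by move: EQ0; rewrite muln_gt0 => /andP.
have ed : D * q = - (E * Q)%N%:Z.
  by rewrite /q {1}eD PoszM; transitivity (- (s ^+ 2 * (E%:Z * Q%:Z))); [ring | rewrite s2 mul1r].
have d0 : D * q < 0 by rewrite ed oppr_lt0.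
have dsq : squarefree (D * q).
  by apply: squarefree_of_sqfree_on; rewrite ed abszN.
have [x [y [z [exyz z0 hprim]]]] := primitive_solution E0 Q0 hn.
have hN X Y Z : E%:Z * X ^+ 2 + Q%:Z * Y ^+ 2 = 4 * Z ^+ 2 ->
    D * X ^+ 2 - q * Y ^+ 2 = 4 * s * Z ^+ 2.
  move=> e; rewrite {1}eD /q; transitivity (s * (E%:Z * X ^+ 2 + Q%:Z * Y ^+ 2)); first by ring.
  by rewrite e; ring.
have hA' : D * (- t) ^+ 2 = A ^+ 3 - 1728 by rewrite sqrrN.
have [oD|[D' eD']] := oddz_or D.
  (* The sign hypothesis gives |D| = 1 modulo 4. *)
  have sD4 : (4 %| s * D - 1)%Z.
    by case: (oD) => k ek; move: hsg; rewrite -/s /eps; case: eqP => h -> //; clear -h ek; lia.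
  have /dvdzP[k8 ek8] := odd8 oD.
  have [k4 ek4] : exists k, E%:Z = 1 + 4 * k.
    by have /dvdzP[k ek] := sD4; exists k; rewrite eE -[LHS](subrK 1) ek; ring.
  have eQ : Q%:Z = 8 * k8 - E%:Z by rewrite mulrC -ek8 addrK.
  have d4 : (4 %| D * q - 1)%Z.
    by rewrite ed PoszM eQ ek4; apply/dvdzP; exists (4 * k4 ^+ 2 + 2 * k4 - 2 * k8 - 8 * k4 * k8); ring.
  have main X Y Z sg : E%:Z * X ^+ 2 + Q%:Z * Y ^+ 2 = 4 * Z ^+ 2 -> Z != 0 ->
      (forall p, prime p -> (p%:Z %| X)%Z -> (p%:Z %| Y)%Z -> (p%:Z %| Z)%Z -> False) ->
      oddz sg ->
      ((exists z, Z = 2 * z) /\ sg = D * X /\ (4 %| s * D - 1)%Z) \/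
      (exists x y, [/\ X = 2 * x, Y = 4 * y, oddz Z & sg = D * x + 2 * y]) ->
      counted D q.
    move=> /hN e Z0 hg osg hcase.
    have finish t0 : D * t0 ^+ 2 = A ^+ 3 - 1728 ->
       (oddz A /\ (4 %| t0 * D * sg + A)%Z) \/
       (exists a t', [/\ A = 16 * a, t0 = 8 * t' & (4 %| t' * D ^+ 2 * sg ^+ 3 + 27)%Z]) ->
       counted D q.
      move=> h0 hc; apply: (counted_of_model hR d0 dsq e s2 Z0 hg h0) => P hP P2.
      by apply: (good_at_two_odd d0 dsq h0 e s2 Z0 hg hP (isT : prime 2) P2 _ oD d4 osg hcase hc).
    case: (A_cases Dsq hR hA) => [[oA [_ ot]]|[a [t' [eA et _ _ ot]]]|[b [t' [k [_ _ _ _ ek]]]]].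
    - have o : oddz (t * D * sg) by do 2!apply: oddzM => //.
      case: (odd_sum4 o oA) => h; first by apply: (finish t hA); left.
      by apply: (finish (- t) hA'); left; split=> //; rewrite !mulNr.
    - have o : oddz (t' * D ^+ 2 * sg ^+ 3).
        by apply: oddzM; [apply: oddzM => //; apply: oddzX | apply: oddzX].
      case: (odd_sum4 o (_ : oddz 27)) => [|h|h]; first by exists 13.
        by apply: (finish t hA); right; exists a, t'.
      apply: (finish (- t) hA'); right; exists a, (- t'); split=> //; first by rewrite et; ring.
      by rewrite !mulNr.
    by exfalso; apply: (odd_not_even oD); exists (1 + 2 * k); rewrite ek; ring.
  have [ox|[x1 ex]] := oddz_or x.
    have [oy|[y1 ey]] := oddz_or y.
      have [kx ekx] := oddz_sqr ox; have [ky eky] := oddz_sqr oy.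
      (* E + Q = 0 modulo 8, so 8 divides z^2 and 4 divides z. *)
      have e8 : z ^+ 2 = 8 * (E%:Z * kx + k8 + Q%:Z * ky).
        by rewrite -exyz ekx eky eQ; ring.
      have [oz|[z1 ez]] := oddz_or z.
        by exfalso; apply: (odd_not_even (oddzX 2 oz)); exists (4 * (E%:Z * kx + k8 + Q%:Z * ky)); rewrite e8; ring.
      have [oz1|[z2 ez1]] := oddz_or z1.
        exfalso; apply: (odd_not_even (oddzX 2 oz1)); exists (E%:Z * kx + k8 + Q%:Z * ky).
        by apply: (@mulfI _ (4 : int)) => //; transitivity (z ^+ 2); [rewrite ez; ring | rewrite e8; ring].
      apply: (main x y z1 (D * x)).
      - by rewrite exyz ez; ring.
      - by apply: contraNneq z0 => h; rewrite ez h mulr0.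
      - move=> p pp px py pz; apply: (hprim p pp px py); by rewrite ez dvdz_mull.
      - exact: oddzM.
      by left; split; [exists z2 | split].
    have oz : oddz z.
      apply: oddz_sqrP; rewrite -exyz ey; have [kx ekx] := oddz_sqr ox; rewrite ekx ek4.
      by exists (2 * k4 + 4 * kx + 16 * kx * k4 + 2 * (Q%:Z * y1 ^+ 2)); ring.
    apply: (main (2 * x) (2 * y) z (D * x + 2 * y1)) => //.
    - by rewrite -exyz; ring.
    - move=> p pp px py pz; case: (eqVneq p 2%N) => [p2|p2].
        by rewrite p2 in pz; move/negP: (ndvd_oddz oz).
      have p2' : (p%:Z %| 2)%Z = false.
        by apply/negbTE; rewrite dvdzE /= dvdn_prime2.
      by apply: (hprim p pp) => //; move: px py; rewrite !Euclid_dvdzM // p2'.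
    - by have [k ek] := oddzM oD ox; exists (k + y1); rewrite ek; ring.
    by right; exists x, y1; split=> //; rewrite ey; ring.
  have [oy|[y1 ey]] := oddz_or y; exfalso.
    have [ky eky] := oddz_sqr oy.
    (* With x even and y odd, z^2 = Q = -E = 3 modulo 4. *)
    have e3 : z ^+ 2 = 3 + 4 * (E%:Z * x1 ^+ 2 + 2 * k8 - k4 - 1 + Q%:Z * 2 * ky).
      by rewrite -exyz ex eky eQ ek4; ring.
    have [oz|[z1 ez]] := oddz_or z; last first.
      apply: (@odd_not_even (z ^+ 2)); last by exists (2 * z1 ^+ 2); rewrite ez; ring.
      by exists (1 + 2 * (E%:Z * x1 ^+ 2 + 2 * k8 - k4 - 1 + Q%:Z * 2 * ky)); rewrite e3; ring.
    have [kz ekz] := oddz_sqr oz; move: e3; rewrite ekz; move: (_ + Q%:Z * 2 * ky) => w; clear; lia.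
  have [oz|[z1 ez]] := oddz_or z.
    apply: (odd_not_even (oddzX 2 oz)); exists (2 * (E%:Z * x1 ^+ 2 + Q%:Z * y1 ^+ 2)).
    by rewrite -exyz ex ey; ring.
  by apply: (hprim 2%N isT); rewrite ?ex ?ey ?ez dvdz_mulr.
have s1 : s = - 1.
  by move: hsg; rewrite -/s /eps; case: eqP => h -> //; exfalso; clear -h eD'; lia.
have /dvdzP[k8 ek8] : (8 %| Q%:Z + E%:Z - 1)%Z.
  by case: even8 => // h; exfalso; apply: (odd_not_even (oddz_ndvd h)); exists D'.
have eED : E%:Z = - D by rewrite eE s1 mulN1r.
have eq8 : q = 1 + D + 8 * k8.
  by rewrite /q s1 opprK mul1r; transitivity (Q%:Z + E%:Z - 1 + 1 - E%:Z); [ring | rewrite ek8 eED; ring].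
have eqQ : q = Q%:Z by rewrite /q s1 opprK mul1r.
case: (A_cases Dsq hR hA) => [[_ [oD _]]|[a [t' [_ _ _ oD _]]]|[b [t' [k [eA et ob ot ek]]]]].
- by exfalso; apply: (odd_not_even oD); exists D'.
- by exfalso; apply: (odd_not_even oD); exists D'.
have oq : oddz Q%:Z by rewrite -eqQ eq8 ek; exists (1 + 2 * k + 4 * k8); ring.
have oy : oddz y.
  have [//|[y1 ey]] := oddz_or y; exfalso.
  have [oz|[z1 ez]] := oddz_or z.
    apply: (odd_not_even (oddzX 2 oz)); exists (2 * (Q%:Z * y1 ^+ 2) - (1 + 2 * k) * x ^+ 2).
    by rewrite -exyz ey eED ek; ring.
  have [ox|[x1 ex]] := oddz_or x.
    apply: (odd_not_even (oddzM (_ : oddz (1 + 2 * k)) (oddzX 2 ox))); first by exists k; ring.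
    exists (Q%:Z * y1 ^+ 2 - z1 ^+ 2).
    apply: (@mulfI _ (2 : int)) => //; transitivity (Q%:Z * y ^+ 2 - z ^+ 2); last by rewrite ey ez; ring.
    by rewrite -exyz eED ek; ring.
  by apply: (hprim 2%N isT); rewrite ?ex ?ey ?ez dvdz_mulr.
have oz : oddz z.
  apply: oddz_sqrP; rewrite -exyz eED ek.
  by have [l el] := oddzM oq (oddzX 2 oy); rewrite el; exists (l - (1 + 2 * k) * x ^+ 2); ring.
(* An even x would give z^2 = Q = 3 modulo 4, as Q = 1 - E modulo 8 and E = 2 modulo 4. *)
have ox : oddz x.
  have [//|[x1 ex]] := oddz_or x; exfalso.
  have [ky eky] := oddz_sqr oy; have [kz ekz] := oddz_sqr oz.
  have : (1 + 8 * kz) = 3 + 4 * (E%:Z * x1 ^+ 2 + k + 2 * k8 + 2 * Q%:Z * ky).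
    by rewrite -ekz -exyz ex eky; transitivity (4 * E%:Z * x1 ^+ 2 + q * (1 + 8 * ky)); [rewrite eqQ; ring | rewrite {1}eq8 ek; rewrite -eqQ eq8 ek; ring].
  move: (_ + 2 * Q%:Z * ky) => w; clear; lia.
have Z0 := z0.
have e : E%:Z * (2 * x) ^+ 2 + Q%:Z * (2 * y) ^+ 2 = 4 * z ^+ 2 by rewrite -exyz; ring.
have hg p : prime p -> (p%:Z %| 2 * x)%Z -> (p%:Z %| 2 * y)%Z -> (p%:Z %| z)%Z -> False.
  move=> pp px py pz; case: (eqVneq p 2%N) => [p2|p2].
    by rewrite p2 in pz; move/negP: (ndvd_oddz oz).
  have p2' : (p%:Z %| 2)%Z = false.
    by apply/negbTE; rewrite dvdzE /= dvdn_prime2.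
  by apply: (hprim p pp) => //; move: px py; rewrite !Euclid_dvdzM // p2'.
have finish t0 t1 : D * t0 ^+ 2 = A ^+ 3 - 1728 -> t0 = 8 * t1 -> (4 %| t1 + b * x)%Z -> counted D q.
  move=> h0 e1 /dvdzP[l el].
  apply: (counted_of_model hR d0 dsq (hN _ _ _ e) s2 Z0 hg h0) => P hP P2.
  apply: (good_at_two_even d0 dsq h0 (hN _ _ _ e) s2 hg hP (isT : prime 2) P2 _ eA e1
     _ _ ox oy ob _ _ _) => //.
  - by exists k.
  - by exists k8.
  by exists l; rewrite -[LHS](addrK (b * x)) el; ring.
have obx := oddzM ob ox.
case: (odd_sum4 ot obx) => h; first exact: finish hA et h.
by apply: (finish (- t) (- t') hA' _ h); rewrite et; ring.
Qed.

End CountedFields.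

(** * Lower bound for the count *)

Section Assembly.
Local Open Scope ring_scope.

Lemma coprime_mul_square a b c : (0 < a)%N -> coprime a b -> (a * b = c ^ 2)%N ->
  exists r, a = (r ^ 2)%N.
Proof.
move=> a0 cab e; have [u [v [hu v0 ea]]] := sqfree_decomposition a0.
case: (ltnP 1 u) => [u1|]; last first.
  by have u0 := sqfree_on_gt0 hu => u1; exists v; rewrite ea (_ : u = 1%N) ?mul1n //; lia.
exfalso; set p := pdiv u; have pp : prime p := pdiv_prime u1.
have [_ l1] := (sqfree_onP prime u hu).2 p pp (pdiv_dvd u).
have pa : (p %| a)%N by rewrite ea dvdn_mulr // pdiv_dvd.
have b0 : (0 < b)%N.
  case: b cab e => // + _; rewrite /coprime gcdn0 => /eqP a1.
  by move: pa; rewrite a1 dvdn1 => /eqP p1; rewrite p1 in pp.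
have pb : ~~ (p %| b)%N.
  apply/negP => pb; have : (p %| 1)%N by rewrite -(eqP cab) dvdn_gcd pa.
  by rewrite Euclid_dvd1.
have := congr1 (logn p) e.
rewrite lognM // lognX ea lognM ?expn_gt0 ?v0 ?(sqfree_on_gt0 hu) // l1 lognX.
by rewrite [logn p b]lognE (negbTE pb) !andbF; lia.
Qed.

Lemma odd_square_mod8 n r : odd n -> n = (r ^ 2)%N -> (n %% 8 = 1)%N.
Proof.
move=> on e; have or : odd r by move: on; rewrite e oddX /=.
by rewrite e expnS expn1; apply: odd_mulmod8.
Qed.

(** For D = +-1 and odd A, F B = t^2 with F = D (A - 12) = 5 modulo 8, and gcd(F, B) is a power of
    3. So F, or F/27 when 3 divides A, would be an odd square, against its residue 5 or 7 modulo 8.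
    If 16 divides A, the equation fails modulo 8; if A = 4 modulo 16, D is even. *)
Lemma good_neq_unit (D A t : int) : squarefree D -> in_Rset A ->
  D * t ^+ 2 = A ^+ 3 - 1728 -> `|D|%N != 1%N.
Proof.
move=> Dsq hR hA; apply/negP => /eqP D1.
have DD : D ^+ 2 = 1 by rewrite -[D ^+ 2]ger0_norm ?sqr_ge0 // normrX -abszE D1 expr1n.
have Dpm : D = 1 \/ D = -1 by lia.
case: (A_cases Dsq hR hA) => [[oA [oD ot]]|[a [t' [_ _ e _ ot]]]|[b [t' [k [_ _ _ _ ek]]]]]; last by lia.
  have [kA eA2] := oddz_sqr oA; have [kt et2] := oddz_sqr ot.
  pose F := D * (A - 12); pose B := A ^+ 2 + 12 * A + 144.
  have FB : F * B = t ^+ 2.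
    transitivity (D ^+ 2 * t ^+ 2); last by rewrite DD mul1r.
    by transitivity (D * (A ^+ 3 - 1728)); [rewrite /F /B; ring | rewrite -hA; ring].
  have F8 : exists k, F = 5 + 8 * k.
    have e : A * (1 + 8 * kA) - 1728 = D * (1 + 8 * kt) by rewrite -eA2 -et2 hA; ring.
    (* Odd squares are 1 and 1728 is 0 modulo 8, so the equation reads A = D modulo 8. *)
    have [W eA] : exists W, A = D + 8 * W.
      exists (216 + D * kt - A * kA).
      by transitivity (A * (1 + 8 * kA) - 1728 + 8 * (216 - A * kA)); [ring | rewrite e; ring].
    have [kD ekD] := oD.
    exists (D * W - 3 * kD - 2); rewrite /F eA.
    transitivity (D ^+ 2 + 8 * D * W - 12 * D); first by ring.
    by rewrite DD [X in 12 * X]ekD; ring.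
  have Bpos : 0 < B.
    have -> : B = (A + 6) ^+ 2 + 108 by rewrite /B; ring.
    by apply: ltr_wpDl => //; apply: sqr_ge0.
  have t0 : t != 0 by apply/eqP => t00; move: ot => [k]; rewrite t00; lia.
  have Fpos : 0 < F by rewrite -(pmulr_lgt0 _ Bpos) FB exprn_even_gt0.
  have [f ef] : exists f : nat, F = f%:Z by exists `|F|%N; rewrite gtz0_abs.
  have [g eg] : exists g : nat, B = g%:Z by exists `|B|%N; rewrite gtz0_abs.
  have fg : (f * g = `|t| ^ 2)%N.
    by apply/eqP; rewrite -eqz_nat PoszM -ef -eg FB -[t ^+ 2]ger0_norm ?sqr_ge0 // normrX -abszE -rmorphXn.
  have f0 : (0 < f)%N by move: Fpos; rewrite ef.
  have f8 : (f %% 8 = 5)%N by case: F8 => k; rewrite ef; clear; lia.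
  have [h3|h3] := boolP (3 %| A)%Z.
    have /dvdzP[k ek] := hR.2 h3.
    have eA : A = 12 + 27 * k by rewrite -[LHS](subrK 12) ek; ring.
    have dsq1 : squarefree (D * 1) by rewrite mulr1.
    have /dvdzP[t1 et1] := Rset_3 dsq1 hR hA h3.
    pose F1 := D * k; pose B1 := 16 + 36 * k + 27 * k ^+ 2.
    have eF : F = 27 * F1 by rewrite /F eA /F1; ring.
    have FB1 : F1 * B1 = t1 ^+ 2.
      apply: (@mulfI _ (729 : int)) => //; transitivity (F * B); last by rewrite FB et1; ring.
      by rewrite eF /B eA /B1; ring.
    have F1pos : 0 < F1 by move: Fpos; rewrite eF; clear; lia.
    have B1pos : 0 < B1.
      have : 0 < 27 * B1 by have -> : 27 * B1 = B; rewrite // /B eA /B1; ring.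
      clear; lia.
    have [f1 ef1] : exists f : nat, F1 = f%:Z by exists `|F1|%N; rewrite gtz0_abs.
    have [g1 eg1] : exists g : nat, B1 = g%:Z by exists `|B1|%N; rewrite gtz0_abs.
    have fg1 : (f1 * g1 = `|t1| ^ 2)%N.
      by apply/eqP; rewrite -eqz_nat PoszM -ef1 -eg1 FB1 -[t1 ^+ 2]ger0_norm ?sqr_ge0 // normrX -abszE -rmorphXn.
    have f18 : (f1 %% 8 = 7)%N.
      by case: F8 => l; rewrite eF ef1; clear; lia.
    have f10 : (0 < f1)%N by move: F1pos; rewrite ef1.
    have cop : coprime f1 g1.
      apply/negPn/negP; rewrite /coprime neq_ltn => /orP[|g2].
        by rewrite ltnS leqn0 => /eqP h; have := gcdn_gt0 f1 g1; rewrite h f10.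
      have pp := pdiv_prime g2; have := pdiv_dvd (gcdn f1 g1); set p := pdiv _ in pp *.
      rewrite dvdn_gcd => /andP[pf pg].
      have pF : (p%:Z %| F1)%Z by rewrite ef1.
      have pk : (p%:Z %| k)%Z.
        have -> : k = D * F1 by rewrite /F1 mulrA -expr2 DD mul1r.
        exact: dvdz_mull.
      have p16 : (p%:Z %| 16%:Z)%Z.
        have -> : 16%:Z = B1 - k * (36 + 27 * k) by rewrite /B1; ring.
        by apply: rpredB; [rewrite eg1 | apply: dvdz_mulr].
      have p2 : p = 2%N.
        move: p16; rewrite (_ : 16%:Z = (2 ^ 4)%N%:Z) // dvdzE /= Euclid_dvdX // andbT.
        by rewrite dvdn_prime2 // => /eqP.
      by move: pf f18; rewrite p2; clear; lia.
    have [r er] := coprime_mul_square f10 cop fg1.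
    by have := @odd_square_mod8 f1 r _ er; rewrite f18; move=> /(_ ltac:(clear -f18; lia)).
  have cop : coprime f g.
    apply/negPn/negP; rewrite /coprime neq_ltn => /orP[|g2].
      by rewrite ltnS leqn0 => /eqP h; have := gcdn_gt0 f g; rewrite h f0.
    have pp := pdiv_prime g2; have := pdiv_dvd (gcdn f g); set p := pdiv _ in pp *.
    rewrite dvdn_gcd => /andP[pf pg].
    have pA : (p%:Z %| A - 12)%Z.
      have -> : A - 12 = D * F by rewrite /F mulrA -expr2 DD mul1r.
      by apply: dvdz_mull; rewrite ef.
    have p432 : (p%:Z %| (2 ^ 4)%N%:Z * (3 ^ 3)%N%:Z)%Z.
      have -> : (2 ^ 4)%N%:Z * (3 ^ 3)%N%:Z = B - (A - 12) * (A + 24) by rewrite /B -[(2 ^ 4)%N%:Z]/(16 : int) -[(3 ^ 3)%N%:Z]/(27 : int); ring.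
      by apply: rpredB; [rewrite eg | apply: dvdz_mulr].
    move: p432; rewrite Euclid_dvdzM // !dvdzE /= !Euclid_dvdX // !andbT !dvdn_prime2 //.
    case/orP => /eqP p2.
      by move: pf f8; rewrite p2; clear; lia.
    move/negP: h3; apply; rewrite p2 in pA.
    have -> : A = (A - 12) + 3 * 4 by ring.
    by apply: rpredD => //; apply: dvdz_mulr.
  have [r er] := coprime_mul_square f0 cop fg.
  by have := @odd_square_mod8 f r _ er; rewrite f8; move=> /(_ ltac:(clear -f8; lia)).
have [kt et2] := oddz_sqr ot.
by case: Dpm => D1'; move: e; rewrite D1' et2; move: (a ^+ 3) => a3; clear; lia.
Qed.

Lemma sqfree_on_of_squarefree (n : int) : squarefree n -> sqfree_on prime `|n|%N.
Proof.
move=> [n0 h]; have n0' : (0 < `|n|)%N by rewrite absz_gt0.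
apply/sqfree_onP; split=> // p pp pn; split=> //.
have l0 : (0 < logn p `|n|)%N by rewrite logn_gt0 mem_primes pp n0'.
case: (ltnP 1 (logn p `|n|)) => [l1|]; last by lia.
have : p = 1%N by apply: h; rewrite pfactor_dvdn.
by move=> p1; rewrite p1 in pp.
Qed.

(* Q0 is the square-free part of z ^ 2 - E, with z chosen so that this norm is
   prime to E and congruent to - E, respectively 1 - E, modulo 8. *)
Lemma base_norm (E : nat) : (0 < E)%N -> sqfree_on prime E -> exists Q0 : nat,
  [/\ sqfree_on prime (E * Q0), is_norm E Q0%:Z,
      odd E -> (8 %| Q0%:Z + E%:Z)%Z & ~~ odd E -> (8 %| Q0%:Z + E%:Z - 1)%Z].
Proof.
move=> E0 hE; pose z := (if odd E then 4 * E.+1 else E.+1)%N.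
pose N := (z ^ 2 - E)%N.
have zE : (E < z ^ 2)%N by rewrite /z; case: ifP => _; rewrite expnS expn1; nia.
have N0 : (0 < N)%N by rewrite subn_gt0.
have Nz : N%:Z = z%:Z ^+ 2 - E%:Z by rewrite /N -subzn ?(ltnW zE) // -rmorphXn.
have [Q0 [b [hQ b0 eN]]] := sqfree_decomposition N0.
have Q00 := sqfree_on_gt0 hQ.
exists Q0; split.
- apply: sqfree_on_coprimeM => //.
  have : coprime E N.
    rewrite /N /z; case: ifP => oE.
      have -> : ((4 * E.+1) ^ 2 - E = 16 + (16 * E + 31) * E)%N.
        by apply/eqP; rewrite -(eqn_add2r E) subnK; [apply/eqP; rewrite expnS expn1; ring | rewrite expnS expn1; nia].
      by rewrite /coprime addnC gcdnMDl -/(coprime _ _) (_ : 16 = 2 ^ 4)%N // coprimeXr // coprimen2.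
    have -> : (E.+1 ^ 2 - E = 1 + (E + 1) * E)%N.
      by apply/eqP; rewrite -(eqn_add2r E) subnK; [apply/eqP; rewrite expnS expn1; ring | rewrite expnS expn1; nia].
    by rewrite /coprime addnC gcdnMDl gcdn1.
  by apply: coprime_dvdr; rewrite eN dvdn_mulr.
- by exists 1, b%:Z, z%:Z; split; [lia | rewrite expr1n mulr1 -Nz eN PoszM -rmorphXn].
- move=> oE; have oN : odd (Q0 * b ^ 2).
    by rewrite -eN oddB ?(ltnW zE) // /z oE oddX oddM.
  move: oN; rewrite oddM oddX /= => /andP[_ ob].
  have /oddz_sqr[l el] : oddz b%:Z by exists b./2%:Z; have := odd_double_half b; rewrite ob; lia.
  apply/dvdzP; exists (2 * E.+1%:Z ^+ 2 - Q0%:Z * l).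
  transitivity (Q0%:Z * b%:Z ^+ 2 + E%:Z - 8 * (Q0%:Z * l)); first by rewrite el; ring.
  by rewrite -rmorphXn -PoszM -eN Nz /z oE PoszM; ring.
move=> oE; have [e ee] : exists e : nat, E = e.*2 by exists E./2; rewrite even_halfK.
have oN : odd (Q0 * b ^ 2) by rewrite -eN oddB ?(ltnW zE) // /z (negbTE oE) oddX /= oE.
move: oN; rewrite oddM oddX /= => /andP[_ ob].
have /oddz_sqr[l el] : oddz b%:Z by exists b./2%:Z; have := odd_double_half b; rewrite ob; lia.
have [f ef] : exists f : int, e%:Z * (e%:Z + 1) = 2 * f.
  have [[k ek]|[k ek]] := oddz_or e%:Z; first by exists (e%:Z * (k + 1)); rewrite ek; ring.
  by exists (k * (e%:Z + 1)); rewrite {1}ek; ring.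
apply/dvdzP; exists (f - Q0%:Z * l).
transitivity (Q0%:Z * b%:Z ^+ 2 + E%:Z - 1 - 8 * (Q0%:Z * l)); first by rewrite el; ring.
rewrite -rmorphXn -PoszM -eN Nz /z (negbTE oE) intS.
have -> : E%:Z = 2 * e%:Z by rewrite ee -mul2n PoszM.
transitivity (4 * (e%:Z * (e%:Z + 1)) - 8 * (Q0%:Z * l)); first by ring.
by rewrite ef; ring.
Qed.

Lemma many_counted (D : int) : good D -> Num.sg D = eps D ->
  exists2 c : R, 0 < c & exists Y0, forall Y, (Y0 <= Y)%N -> exists s : seq int,
    [/\ uniq s, c * Y%:R <= (size s)%:R * Num.sqrt (exp.ln Y%:R) &
      forall q, q \in s -> (`|q| <= Y)%N /\ counted D q].
Proof.
move=> [Dsq [A [t [hR hA]]]] hsg.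
have D0 : D != 0 by case: Dsq.
have hE := sqfree_on_of_squarefree Dsq; have E0 := sqfree_on_gt0 hE.
have E1 : (1 < `|D|)%N by have := good_neq_unit Dsq hR hA; lia.
have [Q0 [hEQ nQ0 odd8 even8]] := base_norm E0 hE.
have [c c0 [Y0 hY]] := @norm_family R _ _ E1 hEQ nQ0.
exists c => //; exists Y0 => Y /hY[s [us hs hQ]].
have s0 : - Num.sg D != 0 by rewrite oppr_eq0 sgr_eq0.
exists [seq - Num.sg D * (Q : nat)%:Z | Q <- s]; split.
- rewrite map_inj_uniq // => Q Q' /(mulfI s0) []; exact.
- by rewrite size_map.
move=> q /mapP[Q /hQ[QY hEQ' Q8 nQ] ->]; split.
  by rewrite abszM abszN absz_sg D0 mul1n.
have e8 : exists k : int, Q%:Z = Q0%:Z + 8 * k.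
  by exists ((Q %/ 8)%N%:Z - (Q0 %/ 8)%N%:Z); have := divn_eq Q 8; have := divn_eq Q0 8; lia.
have [k ek] := e8.
have oE : odd `|D|%N -> (8 %| Q%:Z + `|D|%N%:Z)%Z.
  move=> /odd8/dvdzP[l el]; apply/dvdzP; exists (l + k).
  by transitivity (Q0%:Z + `|D|%N%:Z + 8 * k); [rewrite ek; ring | rewrite el; ring].
apply: (counted_of_norm Dsq hR hA hsg hEQ' nQ).
  by move=> [l el]; apply: oE; move: el; clear; lia.
case: (boolP (odd `|D|%N)) => oD; first by left; move: oD; clear; lia.
right; have /dvdzP[l el] := even8 oD; apply/dvdzP; exists (l + k).
by transitivity (Q0%:Z + `|D|%N%:Z - 1 + 8 * k); [rewrite ek; ring | rewrite el; ring].
Qed.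

(** For r >= 1 the exponent 1 - 1/2^r is at least 1/2, and the base ln X is at least 1. *)
Lemma Rbound_le (X : R) (r : nat) : 1 <= exp.ln X -> 0 <= X -> (0 < r)%N ->
  Rbound X r <= X / Num.sqrt (exp.ln X).
Proof.
move=> lX X0 r0; rewrite /Rbound RdivE RlnE.
have L0 : 0 < exp.ln X by apply: lt_le_trans lX; rewrite ltr01.
have h : Num.sqrt (exp.ln X) <= Rpower (exp.ln X) (Rminus (INR 1) (Rinv (pow (INR 2) r))).
  rewrite -RsqrtE -Rpower_sqrt; last exact/RltP.
  apply/RleP; apply: Rle_Rpower; first exact/RleP.
  apply/RleP; rewrite RminusE RpowE !INRE !RinvE.
  have -> : IZR 2 = 2%:R :> R by rewrite -INRE INR_IZR_INZ.
  have h2 : (2%:R : R) ^+ r >= 2.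
    by rewrite -natrX ler_nat -{1}[2%N]expn1 leq_exp2l.
  have h3 : ((2%:R : R) ^+ r)^-1 <= 2^-1 by rewrite lef_pV2 ?posrE ?exprn_gt0.
  by move: h3; lra.
apply: ler_wpM2l => //; rewrite lef_pV2 ?posrE ?sqrtr_gt0 //.
by apply: lt_le_trans h; rewrite sqrtr_gt0.
Qed.

Lemma counted_lower_bound (D : int) : good D -> Num.sg D = eps D ->
  exists c X0 : R, 0 < c /\ forall X : R, X0 <= X ->
    exists n, I_at_least D X n /\ c * Rbound X (nprimes D) <= n%:R.
Proof.
move=> gD hsg; have [c c0 [Y0 hY]] := many_counted gD hsg.
(* Halving c pays for replacing X by its integer part Y, as X <= 2 Y; X >= 4 makes ln X >= 1. *)
exists (c / 2), (maxn Y0 3).+1%:R; split.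
  by rewrite divr_gt0.
move=> X hX.
have X0 : 0 <= X by apply: le_trans hX.
have /andP[YX XY] := truncn_itv X0; set Y := Num.trunc X in YX XY.
have Ybig : ((maxn Y0 3).+1 <= Y)%N by rewrite -ltnS -(ltr_nat R) (le_lt_trans hX).
have [|s [us hs hq]] := hY Y; first by lia.
exists (size s); split.
  exists s; split=> // q /hq[qY cq]; split=> //.
  by apply/RleP; rewrite INRE; apply: le_trans YX; rewrite ler_nat.
have Y1 : 1 <= Y%:R :> R by rewrite ler1n; lia.
have Y0' : 0 < Y%:R :> R by rewrite ltr0n; lia.
have X0' : 0 < X by apply: lt_le_trans Y0' YX.
have lX : 1 <= exp.ln X.
  rewrite -[leLHS]expRK ler_ln ?posrE ?expR_gt0 // -RexpE.
  apply: le_trans (_ : 3%:R <= X); last by apply: le_trans hX; rewrite ler_nat; lia.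
  by rewrite -INRE; apply/RleP; apply: Rle_trans exp_le_3 _; rewrite INR_IZR_INZ; apply: Rle_refl.
have L0 : 0 < exp.ln X by apply: lt_le_trans lX.
have q0 : 0 < Num.sqrt (exp.ln X) by rewrite sqrtr_gt0.
have r0 : (0 < nprimes D)%N.
  have [Dsq [A [t [hR hA]]]] := gD.
  have D1 := good_neq_unit Dsq hR hA; have D0 : (0 < `|D|)%N by rewrite absz_gt0; case: Dsq.
  rewrite /nprimes lt0n size_eq0 primes_eq0; lia.
have hb := Rbound_le lX X0 r0.
apply: le_trans (ler_wpM2l (ltW (divr_gt0 c0 (ltr0Sn _ 1))) hb) _.
rewrite mulrA ler_pdivrMr //.
apply: le_trans (_ : c * Y%:R <= _).
  have XY2 : X <= 2 * Y%:R by move: XY Y1; rewrite -[Y.+1%:R]natr1; lra.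
  rewrite -mulrA ler_pM2l // mulrC ler_pdivrMr // [leRHS]mulrC; exact: XY2.
apply: le_trans hs _; apply: ler_wpM2l => //; apply: ler_wsqrtr.
by rewrite ler_ln ?posrE.
Qed.

End Assembly.

Theorem theorem1p6 (D : int) :
  good D -> Num.sg D = eps D ->
  exists (c X0 : R), Rlt (INR 0) c /\
    forall X : R, Rle X0 X ->
      exists n : nat, I_at_least D X n /\
        Rle (Rmult c (Rbound X (nprimes D))) (INR n).
Proof.
move=> gD hsg; have [c [X0 [c0 h]]] := counted_lower_bound gD hsg.
exists c, X0; split; first by apply/RltP; rewrite INRE.
move=> X /RleP/h[n [hn hc]]; exists n; split=> //.
by apply/RleP; rewrite RmultE INRE.
Qed.
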